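(* Let $\Omega\subset\mathbb{R}^2$ be a bounded simply connected domain with boundary $\Gamma=\{\gamma(t): t\in[0,2\pi)\}$ of class $C^2$, and let $\varphi\in C(\Gamma)$ be a real-valued function. (i) Let $N\ge 0$ be an integer and assume that both $\gamma$ and $\varphi\circ\gamma$ are $N$ times continuously differentiable at $t_0\in[0,2\pi)$. Let $z_0=\gamma(t_0)\in\Gamma$ and let $P_N(\cdot,z_0)$ be the $N$th-order $\varphi$-interpolant at $z_0$. Then the double-layer potential $\mathcal{D}\varphi$ can be expressed as $$(\mathcal{D}\varphi)(\boldsymbol{r})=-\mathrm{Re}\left\{\frac{1}{2\pi i}\int_{\Gamma}\frac{\varphi(\zeta)-P_N(\zeta,z_0)}{\zeta-z}\,\mathrm{d}\zeta+\mathbf{1}_{\Omega}(z)\,P_N(z,z_0)\right\}$$ for all $\boldsymbol{r}=(\mathrm{Re}\,z,\mathrm{Im}\,z)\in\mathbb{R}^2\setminus\Gamma$. (ii) Furthermore, let $N\ge 1$, assume that $\gamma$ and $\varphi\circ\gamma$ are ($2\pi$-periodic) functions of class $C^N$, and that $\varphi\in C^{1,\alpha}(\Gamma)$ for some $\alpha\in(0,1]$. Then the hypersingular operator $T$ can be expressed as $$(T\varphi)(\boldsymbol{x})=-\mathrm{Re}\left\{\frac{\nu(z)}{2\pi i}\int_\Gamma\frac{\varphi(\zeta)-P_N(\zeta,z)}{(\zeta-z)^2}\,\mathrm{d}\zeta\right\}$$ for all $\boldsymbol{x}=(\mathrm{Re}\,z,\mathrm{Im}\,z)\in\Gamma$,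 where $P_N(\cdot,z)$ is the $N$th-order $\varphi$-interpolant at $z\in\Gamma$.
   Context: $\mathbb{R}^2$ is identified with $\mathbb{C}$ via $(x,y)\leftrightarrow x+iy$, and the same symbols $\Omega$, $\Gamma$, $\nu$, $\varphi$, $\gamma$ denote both the real and the complex versions of an object (e.g. $\nu(z)=\nu_1+i\nu_2$ as a complex number, and $\varphi(\zeta)=\varphi(\boldsymbol{y})$ for $\boldsymbol{y}=(\mathrm{Re}\,\zeta,\mathrm{Im}\,\zeta)$). The map $\gamma:[0,2\pi)\to\Gamma$ is a counterclockwise, $2\pi$-periodic, regular ($\gamma'\neq0$) $C^2$ parametrization of the Jordan curve $\Gamma=\partial\Omega$; $\gamma$ and $\varphi\circ\gamma$ are regarded as $2\pi$-periodic functions on $\mathbb{R}$. Contour integrals over $\Gamma$ are taken counterclockwise, $\nu$ is the exterior unit normal to $\Gamma$, and $\mathbf{1}_\Omega$ is the indicator function of $\Omega$. Double-layer potential: $$(\mathcal{D}\varphi)(\boldsymbol{r})=\frac{1}{2\pi}\int_\Gamma\frac{\nu(\boldsymbol{y})\cdot(\boldsymbol{r}-\boldsymbol{y})}{|\boldsymbol{r}-\boldsymbol{y}|^2}\,\varphi(\boldsymbol{y})\,\mathrm{d}s(\boldsymbol{y}),\quad \boldsymbol{r}\in\mathbb{R}^2\setminus\Gamma.$$ Hypersingular operator $T:C^{1,\alpha}(\Gamma)\to C^{0,\alpha}(\Gamma)$: $$(T\varphi)(\boldsymbol{x})=\lim_{\epsilon\to0}\nu(\boldsymbol{x})\cdot\nabla(\mathcal{D}\varphi)(\boldsymbol{x}+\epsilon\nu(\boldsymbol{x})),\quad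 \boldsymbol{x}\in\Gamma.$$ Density interpolant: for a function $\varphi:\Gamma\to\mathbb{C}$ and $z_0=\gamma(t_0)\in\Gamma$ such that $\gamma$ and $\varphi\circ\gamma$ are $N$ times differentiable at $t_0$, the $N$th-order $\varphi$-interpolant at $z_0$ is the unique polynomial $$P_N(z,z_0)=\sum_{j=0}^N\frac{c_j(z_0)}{j!}(z-z_0)^j,\quad z\in\mathbb{C},$$ with coefficients $c_j(z_0)\in\mathbb{C}$ determined by the interpolation conditions $$\lim_{\tau\to t_0}\frac{\partial^m}{\partial\tau^m}\left[\varphi(\gamma(\tau))-P_N(\gamma(\tau),z_0)\right]=0,\quad m=0,\ldots,N.$$ *)

(* Defs.v *)
From Stdlib Require Import Reals Factorial ClassicalEpsilon.
From Coquelicot Require Import Coquelicot.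

Open Scope R_scope.

(* The plane R^2 and the complex plane are the same type: Coquelicot's [C] is
   [R * R].  A function on the curve is a function on all of [C] of which only
   the values on the curve are ever used. *)

Definition dot (u v : C) : R := Re u * Re v + Im u * Im v.

Definition indicator (A : C -> Prop) (z : C) : C :=
  if excluded_middle_informative (A z) then RtoC 1 else RtoC 0.

Definition boundary (A : C -> Prop) (z : C) : Prop :=
  forall U : C -> Prop, locally z U ->
    (exists u, U u /\ A u) /\ (exists u, U u /\ ~ A u).

Definition bounded (A : C -> Prop) : Prop :=
  exists M : R, forall z, A z -> Cmod z <= M.

(* Paths on [0,1] (and homotopies on [0,1]^2) are represented by maps that are
   continuous on R (on R^2), which is no restriction: extend by constants. *)
Definition path_connected (A : C -> Prop) : Prop :=
  forall a b, A a -> A b ->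
    exists p : R -> C,
      (forall t, continuous p t) /\ (forall t, 0 <= t <= 1 -> A (p t)) /\
      p 0 = a /\ p 1 = b.

Definition simply_connected (A : C -> Prop) : Prop :=
  path_connected A /\
  forall p : R -> C,
    (forall t, continuous p t) -> (forall t, 0 <= t <= 1 -> A (p t)) ->
    p 0 = p 1 ->
    exists H : R * R -> C,
      (forall st, continuous H st) /\
      (forall s t, 0 <= s <= 1 -> 0 <= t <= 1 -> A (H (s, t))) /\
      (forall t, 0 <= t <= 1 -> H (0, t) = p t /\ H (1, t) = p 0) /\
      (forall s, 0 <= s <= 1 -> H (s, 0) = p 0 /\ H (s, 1) = p 0).

Definition bounded_simply_connected_domain (Omega : C -> Prop) : Prop :=
  open (Omega : C_UniformSpace -> Prop) /\ (exists z, Omega z) /\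
  bounded Omega /\ simply_connected Omega.

(* [ex_derive_n f k] only speaks about the last differentiation step, hence the
   quantification over all orders [k <= n]. *)
Definition Cn_at (n : nat) (f : R -> R) (t0 : R) : Prop :=
  (forall k, (k <= n)%nat -> locally t0 (fun t => ex_derive_n f k t)) /\
  continuous (Derive_n f n) t0.

Definition CCn_at (n : nat) (f : R -> C) (t0 : R) : Prop :=
  Cn_at n (fun t => Re (f t)) t0 /\ Cn_at n (fun t => Im (f t)) t0.

Definition CDerive_n (f : R -> C) (n : nat) (t : R) : C :=
  (Derive_n (fun s => Re (f s)) n t, Derive_n (fun s => Im (f s)) n t).

Definition velocity (gamma : R -> C) (t : R) : C := CDerive_n gamma 1 t.

Definition curve (gamma : R -> C) (z : C) : Prop :=
  exists t, 0 <= t < 2 * PI /\ z = gamma t.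

Definition regular_C2_jordan (gamma : R -> C) : Prop :=
  (forall t, gamma (t + 2 * PI) = gamma t) /\
  (forall s t, 0 <= s < 2 * PI -> 0 <= t < 2 * PI -> gamma s = gamma t -> s = t) /\
  (forall t, CCn_at 2 gamma t) /\
  (forall t, velocity gamma t <> RtoC 0).

(* Positive orientation of the boundary: [Omega] lies to the left of the
   direction of travel. *)
Definition counterclockwise (Omega : C -> Prop) (gamma : R -> C) : Prop :=
  forall t, exists delta, 0 < delta /\
    forall eps, 0 < eps < delta ->
      Omega (gamma t + RtoC eps * (Ci * velocity gamma t))%C.

Definition exterior_unit_normal
    (Omega : C -> Prop) (gamma : R -> C) (nu : C -> C) : Prop :=
  forall t,
    Cmod (nu (gamma t)) = 1 /\
    dot (nu (gamma t)) (velocity gamma t) = 0 /\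
    exists delta, 0 < delta /\
      forall eps, 0 < eps < delta ->
        ~ Omega (gamma t + RtoC eps * nu (gamma t))%C /\
        ~ boundary Omega (gamma t + RtoC eps * nu (gamma t))%C.

Definition continuous_on_curve (gamma : R -> C) (phi : C -> R) : Prop :=
  forall z, curve gamma z ->
    filterlim phi (within (curve gamma) (locally z)) (locally (phi z)).

(* Derivative of [phi] with respect to arc length at the point [gamma t]. *)
Definition arc_derive (gamma : R -> C) (phi : C -> R) (t : R) : R :=
  Derive (fun s => phi (gamma s)) t / Cmod (velocity gamma t).

(* [phi] in C^{1,alpha} of the curve.  Coincident points are excluded because
   [Rpower 0 alpha] is a junk value. *)
Definition C1_holder (gamma : R -> C) (alpha : R) (phi : C -> R) : Prop :=
  (forall t, ex_derive (fun s => phi (gamma s)) t) /\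
  exists K, 0 <= K /\
    forall s t, gamma s <> gamma t ->
      Rabs (arc_derive gamma phi s - arc_derive gamma phi t)
        <= K * Rpower (Cmod (gamma s - gamma t)%C) alpha.

Definition contour_integral (gamma : R -> C) (f : C -> C) : C :=
  RInt (V := C_R_CompleteNormedModule)
    (fun t => f (gamma t) * velocity gamma t)%C 0 (2 * PI).

(* Improper contour integral over one period, for an integrand that may be
   singular at the point [gamma t0]. *)
Definition is_singular_contour_integral
    (gamma : R -> C) (t0 : R) (f : C -> C) (I : C) : Prop :=
  is_RInt_gen (V := C_R_NormedModule)
    (fun t => f (gamma t) * velocity gamma t)%C
    (at_right t0) (at_left (t0 + 2 * PI)) I.

Definition double_layer
    (gamma : R -> C) (nu : C -> C) (phi : C -> R) (r : C) : R :=
  / (2 * PI) *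
  RInt (fun t => dot (nu (gamma t)) (r - gamma t)%C / (Cmod (r - gamma t)%C) ^ 2
                 * phi (gamma t) * Cmod (velocity gamma t)) 0 (2 * PI).

Definition gradient (f : C -> R) (r : C) : C :=
  (Derive (fun x => f (x, Im r)) (Re r), Derive (fun y => f (Re r, y)) (Im r)).

(* [is_hypersingular gamma nu phi x v]: (T phi)(x) exists and equals [v]. *)
Definition is_hypersingular
    (gamma : R -> C) (nu : C -> C) (phi : C -> R) (x : C) (v : R) : Prop :=
  let D := double_layer gamma nu phi in
  let r := fun eps : R => (x + RtoC eps * nu x)%C in
  locally' 0 (fun eps =>
    ex_filterdiff (U := C_R_NormedModule) (V := R_NormedModule)
      D (locally (r eps))) /\
  filterlim (fun eps => dot (nu x) (gradient D (r eps))) (locally' 0) (locally v).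

Definition interp_poly (N : nat) (c : nat -> C) (z z0 : C) : C :=
  sum_n (fun j => c j / RtoC (INR (fact j)) * Cpow (z - z0) j)%C N.

Definition is_interpolant
    (gamma : R -> C) (phi : C -> C) (N : nat) (t0 : R) (c : nat -> C) : Prop :=
  forall m, (m <= N)%nat ->
    filterlim
      (CDerive_n
        (fun tau => phi (gamma tau) - interp_poly N c (gamma tau) (gamma t0))%C m)
      (locally' t0) (locally (RtoC 0)).

(* Main.v *)
Require Import Defs.
From Stdlib Require Import Reals Lra Lia ZArith ClassicalEpsilon.
From Coquelicot Require Import Coquelicot.
Open Scope R_scope.

(** Write [g] for the curve, [W z] for the integral of [g' / (g - z)], and [P] for
    the interpolant at [z0 = g t0].

    The exterior normal satisfies [nu |g'| = - i g'], hence the double-layer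
    kernel is the real part of a Cauchy kernel and, off the curve,
    [D phi = - Re (1 / (2 pi i) * integral of phi g' / (g - z))]
    ([double_layer_cauchy]).  Expanding powers of [g - z0] shows that the Cauchy
    integral of a polynomial [P] is [P z * W z], because the integrals of
    [(g - z0)^n g'] vanish.  Subtracting [P] from [phi] therefore changes the
    Cauchy integral by [P z * W z], and the representation off the curve
    amounts to [W = 2 pi i] on [Omega] and [W = 0] outside ([winding_number]).

    The winding number theorem is proved without homotopies.  The derivative of
    [W] is the integral of [g' / (g - z)^2], which has a periodic primitive, so
    [W] is constant along every path avoiding the curve.  Short normals to the
    curve do not meet it again ([tube_off_curve]), hence [W] has one value along
    the whole left side and one along the whole right side ([sides]).  The segment
    from a point to its nearest point on the curve is normal to it and meets it
    only at its end ([nearest_point]); so [W] takes only these two values, and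
    the orientation tells which one belongs to [Omega].  The outer value is [0]
    since [W] decays at infinity, and the two values differ by [2 pi i]: the
    difference of [W] at two mirror points is [2 i] times the integral of a
    perturbed Poisson kernel, whose mass is close to [pi] ([winding_jump]).

    For the hypersingular operator, differentiate the Cauchy integral at
    [r = z0 + e nu].  With [P'] the derivative of [P] this gives
    [nu . grad D = - Re (nu / (2 pi i) * integral of (phi - P) g' / (g - r)^2)
    - Re (nu 1_Omega P' r)].  The second term tends to [0], since [P' z0 * g' t0]
    is the derivative of [phi] along the curve, a real number, while [nu] is
    a negative multiple of [i g' t0] ([interp_slope_normal]).  In the first one,
    [phi - P] is of order [|t - t0|^(1 + alpha)] ([interp_error_bound]) and
    [|g t - r|] is at least a multiple of [|t - t0|] whatever [e] is
    ([normal_line_distance]), because moving along the normal leaves the tangential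
    component of the distance unchanged.  The integrands are thus dominated by
    an integrable power of [|t - t0|], and one may pass to the limit under the
    integral sign ([dominated_convergence]). *)

(** [C] as a normed space over [R]: the functions to be differentiated and
    integrated depend on a real variable. *)
Notation CR := C_R_NormedModule.
Notation CRc := C_R_CompleteNormedModule.

(** * Calculus of complex-valued functions of a real variable *)

(** The carrier of [CR] is only convertible to [C], which hides an equation
    between integrands from [ring] and [field]. *)
Ltac as_C_equation := match goal with |- ?a = ?b => change (@eq C a b) end.

(** The product uniform structure of [C] has squares as balls; discs define the
    same neighbourhoods. *)
Lemma locally_ball_Cmod (z : C) (P : C -> Prop) :
  locally z P <-> exists d, 0 < d /\ forall w, Cmod (w - z) < d -> P w.
Proof.
  split.
  - intros [eps H]. exists eps. split; [apply cond_pos|].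
    intros w Hw. apply H. apply (C_NormedModule_mixin_compat1 z w eps). exact Hw.
  - intros [d [Hd H]].
    assert (Hs : 0 < sqrt 2) by (apply sqrt_lt_R0; lra).
    assert (Hp : 0 < d / sqrt 2) by (apply Rdiv_lt_0_compat; lra).
    exists (mkposreal _ Hp). intros w Hw. apply H.
    assert (E := C_NormedModule_mixin_compat2 z w (mkposreal _ Hp) Hw). simpl in E.
    replace (sqrt 2 * (d / sqrt 2)) with d in E by (field; lra). exact E.
Qed.

Lemma locally_ball_R (x : R) (P : R -> Prop) :
  locally x P <-> exists d, 0 < d /\ forall y, Rabs (y - x) < d -> P y.
Proof.
  split.
  - intros [eps H]. exists eps. split; [apply cond_pos|]. exact H.
  - intros [d [Hd H]]. exists (mkposreal d Hd). exact H.
Qed.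

Lemma continuous_C_pair (f : R -> C) t :
  continuous (fun s => Re (f s)) t -> continuous (fun s => Im (f s)) t ->
  continuous f t.
Proof.
  intros H1 H2.
  apply (continuous_ext (fun s => (Re (f s), Im (f s)))).
  { intros s. now destruct (f s). }
  apply (continuous_comp_2 (fun s => Re (f s)) (fun s => Im (f s)) (fun x y => (x, y)) t H1 H2).
  apply (continuous_ext (fun x => x)); [now intros []|apply continuous_id].
Qed.

Lemma continuous_Re (f : R -> C) t : continuous f t -> continuous (fun s => Re (f s)) t.
Proof.
  intros H. apply (continuous_comp f (fun z : C => Re z) t H).
  unfold Re. destruct (f t). apply (continuous_fst (U := R_UniformSpace) (V := R_UniformSpace)).
Qed.

Lemma continuous_Im (f : R -> C) t : continuous f t -> continuous (fun s => Im (f s)) t.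
Proof.
  intros H. apply (continuous_comp f (fun z : C => Im z) t H).
  unfold Im. destruct (f t). apply (continuous_snd (U := R_UniformSpace) (V := R_UniformSpace)).
Qed.

Lemma continuous_Cplus (f g : R -> C) t :
  continuous f t -> continuous g t -> continuous (fun s => (f s + g s)%C) t.
Proof. apply (continuous_plus (V := CR)). Qed.

Lemma continuous_Cminus (f g : R -> C) t :
  continuous f t -> continuous g t -> continuous (fun s => (f s - g s)%C) t.
Proof. apply (continuous_minus (V := CR)). Qed.

Lemma continuous_Cmult (f g : R -> C) t :
  continuous f t -> continuous g t -> continuous (fun s => (f s * g s)%C) t.
Proof.
  intros Hf Hg.
  pose proof (continuous_Re f t Hf). pose proof (continuous_Im f t Hf).
  pose proof (continuous_Re g t Hg). pose proof (continuous_Im g t Hg).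
  apply continuous_C_pair; simpl.
  - apply (continuous_minus (V := R_NormedModule)); apply (continuous_mult (K := R_AbsRing)); assumption.
  - apply (continuous_plus (V := R_NormedModule)); apply (continuous_mult (K := R_AbsRing)); assumption.
Qed.

Lemma Csqnorm_pos (z : C) : z <> RtoC 0 -> 0 < fst z * (fst z * 1) + snd z * (snd z * 1).
Proof.
  intros H. apply Cmod_gt_0 in H. unfold Cmod in H. simpl in H.
  destruct (Rle_or_lt (fst z * (fst z * 1) + snd z * (snd z * 1)) 0) as [L|L]; [|exact L].
  rewrite sqrt_neg_0 in H; lra.
Qed.

Lemma continuous_Cinv (f : R -> C) t :
  continuous f t -> f t <> RtoC 0 -> continuous (fun s => (/ f s)%C) t.
Proof.
  intros Hf Hz. apply Csqnorm_pos in Hz.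
  pose proof (continuous_Re f t Hf) as H1. pose proof (continuous_Im f t Hf) as H2.
  assert (Hn : continuous (fun s => / (fst (f s) * (fst (f s) * 1) + snd (f s) * (snd (f s) * 1))) t).
  { apply (continuous_Rinv_comp (fun s : R => fst (f s) * (fst (f s) * 1) + snd (f s) * (snd (f s) * 1))).
    2: lra.
    apply (continuous_plus (V := R_NormedModule)).
    - apply (continuous_mult (K := R_AbsRing)); [exact H1|].
      apply (continuous_mult (K := R_AbsRing)); [exact H1|apply continuous_const].
    - apply (continuous_mult (K := R_AbsRing)); [exact H2|].
      apply (continuous_mult (K := R_AbsRing)); [exact H2|apply continuous_const]. }
  apply continuous_C_pair; simpl.
  - apply (continuous_mult (K := R_AbsRing)); assumption.
  - apply (continuous_mult (K := R_AbsRing)); [|assumption].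
    apply (continuous_opp (V := R_NormedModule)); assumption.
Qed.

Lemma continuous_Cpow (f : R -> C) n t :
  continuous f t -> continuous (fun s => (f s ^ n)%C) t.
Proof.
  intros H. induction n as [|n IH]; simpl.
  - apply continuous_const.
  - now apply continuous_Cmult.
Qed.

Lemma continuous_RtoC (f : R -> R) t :
  continuous f t -> continuous (fun s => RtoC (f s)) t.
Proof. intros H. apply continuous_C_pair; simpl; [exact H|apply continuous_const]. Qed.

Lemma continuous_Cmod (f : R -> C) t : continuous f t -> continuous (fun s => Cmod (f s)) t.
Proof.
  intros H. apply (continuous_ext (fun s => norm (V := CR) (f s))).
  { intros s. symmetry. apply Cmod_norm. }
  apply (continuous_comp f (fun z : CR => norm z) t H).
  apply (filterlim_norm (V := CR) (f t)).
Qed.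

Lemma continuous_eps (f : R -> C) t :
  continuous f t -> forall eps, 0 < eps ->
  exists d, 0 < d /\ forall s, Rabs (s - t) < d -> Cmod (f s - f t)%C < eps.
Proof.
  intros H eps He.
  apply (locally_ball_R t (fun s => Cmod (f s - f t)%C < eps)).
  apply (H (fun w => Cmod (w - f t)%C < eps)).
  apply locally_ball_Cmod. exists eps. split; [exact He|auto].
Qed.

Lemma is_derive_C_pair (f : R -> C) t (l : C) :
  is_derive (fun s => Re (f s)) t (Re l) -> is_derive (fun s => Im (f s)) t (Im l) ->
  is_derive (V := CR) f t l.
Proof.
  intros H1 H2.
  apply (is_derive_ext (V := CR)
    (fun s => plus (scal (Re (f s)) ((1, 0) : CR)) (scal (Im (f s)) ((0, 1) : CR)))).
  { intros s. destruct (f s) as [a b].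
    unfold plus, scal; simpl. unfold prod_plus, prod_scal, scal, plus, mult; simpl.
    unfold mult; simpl. f_equal; ring. }
  replace l with (plus (scal (Re l) ((1, 0) : CR)) (scal (Im l) ((0, 1) : CR))).
  { apply (is_derive_plus (V := CR)); apply (is_derive_scal_l (V := CR)); assumption. }
  destruct l as [a b]. unfold plus, scal; simpl. unfold prod_plus, prod_scal, scal, plus, mult; simpl.
  unfold mult; simpl. f_equal; ring.
Qed.

Lemma filterdiff_Re (F : (C -> Prop) -> Prop) :
  filterdiff (U := CR) (V := R_NormedModule) Re F Re.
Proof.
  apply (filterdiff_linear (U := CR) (V := R_NormedModule)).
  apply (is_linear_fst (U := R_NormedModule) (V := R_NormedModule)).
Qed.

Lemma filterdiff_Im (F : (C -> Prop) -> Prop) :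
  filterdiff (U := CR) (V := R_NormedModule) Im F Im.
Proof.
  apply (filterdiff_linear (U := CR) (V := R_NormedModule)).
  apply (is_linear_snd (U := R_NormedModule) (V := R_NormedModule)).
Qed.

Lemma is_derive_Re (f : R -> C) t (l : C) :
  is_derive (V := CR) f t l -> is_derive (fun s => Re (f s)) t (Re l).
Proof.
  intros H.
  apply (filterdiff_ext_lin (fun s => Re (f s)) (fun y : R => Re (scal y (l : CR)))).
  - apply (filterdiff_comp (V := CR) f Re); [exact H|apply filterdiff_Re].
  - intros y. reflexivity.
Qed.

Lemma is_derive_Im (f : R -> C) t (l : C) :
  is_derive (V := CR) f t l -> is_derive (fun s => Im (f s)) t (Im l).
Proof.
  intros H.
  apply (filterdiff_ext_lin (fun s => Im (f s)) (fun y : R => Im (scal y (l : CR)))).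
  - apply (filterdiff_comp (V := CR) f Im); [exact H|apply filterdiff_Im].
  - intros y. reflexivity.
Qed.

Lemma is_derive_C_continuous (f : R -> C) t l :
  is_derive (V := CR) f t l -> continuous f t.
Proof. intros H. apply (ex_derive_continuous (V := CR)). now exists l. Qed.

Lemma is_derive_Cmult (f g : R -> C) t (f' g' : C) :
  is_derive (V := CR) f t f' -> is_derive (V := CR) g t g' ->
  is_derive (V := CR) (fun s => (f s * g s)%C) t (f' * g t + f t * g')%C.
Proof.
  intros Hf Hg.
  pose proof (is_derive_Re f t f' Hf) as F1. pose proof (is_derive_Im f t f' Hf) as F2.
  pose proof (is_derive_Re g t g' Hg) as G1. pose proof (is_derive_Im g t g' Hg) as G2.
  set (f1 := fun s => Re (f s)) in *. set (f2 := fun s => Im (f s)) in *.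
  set (g1 := fun s => Re (g s)) in *. set (g2 := fun s => Im (g s)) in *.
  apply is_derive_C_pair.
  - change (is_derive (fun s : R => f1 s * g1 s - f2 s * g2 s) t
      (Re f' * g1 t - Im f' * g2 t + (f1 t * Re g' - f2 t * Im g'))).
    auto_derive. { repeat split; eexists; eassumption. }
    rewrite (is_derive_unique (fun s : R => f1 s) t (Re f') F1), (is_derive_unique (fun s : R => f2 s) t (Im f') F2),
      (is_derive_unique (fun s : R => g1 s) t (Re g') G1), (is_derive_unique (fun s : R => g2 s) t (Im g') G2). ring.
  - change (is_derive (fun s : R => f1 s * g2 s + f2 s * g1 s) t
      (Re f' * g2 t + Im f' * g1 t + (f1 t * Im g' + f2 t * Re g'))).
    auto_derive. { repeat split; eexists; eassumption. }
    rewrite (is_derive_unique (fun s : R => f1 s) t (Re f') F1), (is_derive_unique (fun s : R => f2 s) t (Im f') F2),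
      (is_derive_unique (fun s : R => g1 s) t (Re g') G1), (is_derive_unique (fun s : R => g2 s) t (Im g') G2). ring.
Qed.

Lemma is_derive_Cinv (f : R -> C) t (f' : C) :
  is_derive (V := CR) f t f' -> f t <> RtoC 0 ->
  is_derive (V := CR) (fun s => (/ f s)%C) t (- (f' / (f t * f t)))%C.
Proof.
  intros Hf Hz. pose proof (Csqnorm_pos _ Hz) as Hp.
  pose proof (is_derive_Re f t f' Hf) as F1. pose proof (is_derive_Im f t f' Hf) as F2.
  assert (E : (- (f' / (f t * f t)) = - f' * (/ f t * / f t))%C) by (field; exact Hz).
  rewrite E; clear E.
  set (f1 := fun s => Re (f s)) in *. set (f2 := fun s => Im (f s)) in *.
  assert (Hp' : 0 < f1 t * (f1 t * 1) + f2 t * (f2 t * 1)) by exact Hp.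
  set (n := fun s => f1 s * (f1 s * 1) + f2 s * (f2 s * 1)).
  apply is_derive_C_pair.
  - change (is_derive (fun s : R => f1 s / n s) t
      (- Re f' * (f1 t / n t * (f1 t / n t) - (- f2 t / n t) * (- f2 t / n t))
       - - Im f' * (f1 t / n t * (- f2 t / n t) + (- f2 t / n t) * (f1 t / n t)))).
    unfold n. auto_derive. { repeat split; try (eexists; eassumption). lra. }
    rewrite (is_derive_unique (fun s : R => f1 s) t (Re f') F1), (is_derive_unique (fun s : R => f2 s) t (Im f') F2). field; lra.
  - change (is_derive (fun s : R => - f2 s / n s) t
      (- Re f' * (f1 t / n t * (- f2 t / n t) + (- f2 t / n t) * (f1 t / n t))
       + - Im f' * (f1 t / n t * (f1 t / n t) - (- f2 t / n t) * (- f2 t / n t)))).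
    unfold n. auto_derive. { repeat split; try (eexists; eassumption). lra. }
    rewrite (is_derive_unique (fun s : R => f1 s) t (Re f') F1), (is_derive_unique (fun s : R => f2 s) t (Im f') F2). field; lra.
Qed.

Lemma is_derive_Cconst (c : C) t : is_derive (V := CR) (fun _ => c) t (RtoC 0).
Proof. apply (is_derive_const (V := CR)). Qed.

Lemma is_derive_Cplus (f g : R -> C) t (f' g' : C) :
  is_derive (V := CR) f t f' -> is_derive (V := CR) g t g' ->
  is_derive (V := CR) (fun s => (f s + g s)%C) t (f' + g')%C.
Proof. apply (is_derive_plus (V := CR)). Qed.

Lemma is_derive_Cminus (f g : R -> C) t (f' g' : C) :
  is_derive (V := CR) f t f' -> is_derive (V := CR) g t g' ->
  is_derive (V := CR) (fun s => (f s - g s)%C) t (f' - g')%C.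
Proof. apply (is_derive_minus (V := CR)). Qed.

Lemma is_derive_Cpow (f : R -> C) t (f' : C) n :
  is_derive (V := CR) f t f' ->
  is_derive (V := CR) (fun s => (f s ^ S n)%C) t (RtoC (INR (S n)) * f t ^ n * f')%C.
Proof.
  intros H. induction n as [|n IH].
  - apply (is_derive_ext (V := CR) f). { intros s. rewrite Cpow_1_r. reflexivity. }
    replace (RtoC (INR 1) * f t ^ 0 * f')%C with f'; [exact H|]. simpl. ring.
  - apply (is_derive_ext (V := CR) (fun s => f s * f s ^ S n)%C).
    { intros s. reflexivity. }
    replace (RtoC (INR (S (S n))) * f t ^ S n * f')%C
      with (f' * f t ^ S n + f t * (RtoC (INR (S n)) * f t ^ n * f'))%C.
    { now apply is_derive_Cmult. }
    rewrite (S_INR (S n)), RtoC_plus. rewrite !Cpow_S. ring.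
Qed.

Lemma is_derive_C_zero_const (f : R -> C) a b :
  a <= b -> (forall t, a <= t <= b -> is_derive (V := CR) f t (RtoC 0)) -> f a = f b.
Proof.
  intros Hab H.
  assert (K : forall h : R -> R, (forall t, a <= t <= b -> is_derive h t 0) -> h a = h b).
  { intros h Hh. destruct (MVT_gen h a b (fun _ => 0)) as [c [_ Hc]].
    - intros x. rewrite Rmin_left, Rmax_right by lra. intros Hx. apply Hh. lra.
    - intros x. rewrite Rmin_left, Rmax_right by lra. intros Hx.
      apply continuity_pt_filterlim. apply (ex_derive_continuous h). eexists. now apply Hh.
    - lra. }
  assert (E1 := K (fun s => Re (f s)) (fun t Ht => is_derive_Re f t 0%C (H t Ht))).
  assert (E2 := K (fun s => Im (f s)) (fun t Ht => is_derive_Im f t 0%C (H t Ht))).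
  simpl in E1, E2. destruct (f a), (f b). simpl in *. now f_equal.
Qed.

(** * Integrals of complex-valued functions *)

Lemma ex_RInt_C (f : R -> C) a b :
  a <= b -> (forall t, a <= t <= b -> continuous f t) -> ex_RInt (V := CR) f a b.
Proof.
  intros Hab H. apply (ex_RInt_continuous (V := CRc)).
  intros z. rewrite Rmin_left, Rmax_right by lra. apply H.
Qed.

Lemma is_RInt_C_correct (f : R -> C) a b :
  a <= b -> (forall t, a <= t <= b -> continuous f t) ->
  is_RInt (V := CR) f a b (RInt (V := CRc) f a b).
Proof. intros. apply (RInt_correct (V := CRc)). now apply ex_RInt_C. Qed.

Lemma is_RInt_Cscal (c : C) (f : R -> C) a b (l : C) :
  is_RInt (V := CR) f a b l -> is_RInt (V := CR) (fun t => (c * f t)%C) a b (c * l)%C.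
Proof.
  intros H.
  pose proof (is_RInt_fct_extend_fst (U := R_NormedModule) (V := R_NormedModule) f a b l H) as H1.
  pose proof (is_RInt_fct_extend_snd (U := R_NormedModule) (V := R_NormedModule) f a b l H) as H2.
  apply (is_RInt_fct_extend_pair (U := R_NormedModule) (V := R_NormedModule)); simpl.
  - apply (is_RInt_minus (V := R_NormedModule));
      apply (is_RInt_scal (V := R_NormedModule)); assumption.
  - apply (is_RInt_plus (V := R_NormedModule));
      apply (is_RInt_scal (V := R_NormedModule)); assumption.
Qed.

Lemma is_RInt_Cplus (f g : R -> C) a b (l m : C) :
  is_RInt (V := CR) f a b l -> is_RInt (V := CR) g a b m ->
  is_RInt (V := CR) (fun t => (f t + g t)%C) a b (l + m)%C.
Proof. apply (is_RInt_plus (V := CR)). Qed.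

Lemma is_RInt_Cminus (f g : R -> C) a b (l m : C) :
  is_RInt (V := CR) f a b l -> is_RInt (V := CR) g a b m ->
  is_RInt (V := CR) (fun t => (f t - g t)%C) a b (l - m)%C.
Proof. apply (is_RInt_minus (V := CR)). Qed.

Lemma is_RInt_C_Re (f : R -> C) a b (l : C) :
  is_RInt (V := CR) f a b l -> is_RInt (fun t => Re (f t)) a b (Re l).
Proof.
  apply (is_RInt_fct_extend_fst (U := R_NormedModule) (V := R_NormedModule) f a b l).
Qed.

Lemma is_RInt_RtoC (f : R -> R) a b l :
  is_RInt f a b l -> is_RInt (V := CR) (fun t => RtoC (f t)) a b (RtoC l).
Proof.
  intros H. apply (is_RInt_fct_extend_pair (U := R_NormedModule) (V := R_NormedModule)); simpl.
  - exact H.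
  - pose proof (is_RInt_const (V := R_NormedModule) a b 0) as Z.
    replace (scal (b - a) (0 : R_NormedModule)) with 0 in Z by (unfold scal; simpl; unfold mult; simpl; ring).
    exact Z.
Qed.

Lemma Cmod_is_RInt_le (f : R -> C) (g : R -> R) a b (l : C) m :
  a <= b -> (forall t, a <= t <= b -> Cmod (f t) <= g t) ->
  is_RInt (V := CR) f a b l -> is_RInt g a b m -> Cmod l <= m.
Proof.
  intros Hab H Hf Hg. rewrite Cmod_norm.
  apply (norm_RInt_le (V := CR) f g a b l m Hab); auto.
  intros x Hx. rewrite <- Cmod_norm. now apply H.
Qed.

Lemma Cmod_is_RInt_le_const (f : R -> C) a b (l : C) M :
  a <= b -> (forall t, a <= t <= b -> Cmod (f t) <= M) ->
  is_RInt (V := CR) f a b l -> Cmod l <= (b - a) * M.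
Proof.
  intros Hab H Hf. rewrite Cmod_norm.
  apply (norm_RInt_le_const (V := CR) f a b l M Hab); auto.
  intros x Hx. rewrite <- Cmod_norm. now apply H.
Qed.

Lemma is_RInt_C_derive (f df : R -> C) a b :
  a <= b -> (forall t, a <= t <= b -> is_derive (V := CR) f t (df t)) ->
  (forall t, a <= t <= b -> continuous df t) ->
  is_RInt (V := CR) df a b (f b - f a)%C.
Proof.
  intros Hab H1 H2.
  apply (is_RInt_derive (V := CRc) f df a b); intros x; rewrite Rmin_left, Rmax_right by lra; auto.
Qed.

Lemma is_RInt_C_unique (f : R -> C) a b (l : C) :
  is_RInt (V := CR) f a b l -> RInt (V := CRc) f a b = l.
Proof. apply (is_RInt_unique (V := CRc)). Qed.

Lemma Cmod_bounded (f : R -> C) a b :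
  (forall t, a <= t <= b -> continuous f t) ->
  exists M, 0 < M /\ forall t, a <= t <= b -> Cmod (f t) <= M.
Proof.
  intros H. destruct (bounded_continuity (V := CR) f a b H) as [M HM].
  exists (Rmax M 1). split. { apply Rlt_le_trans with 1; [lra|apply Rmax_r]. }
  intros t Ht. rewrite Cmod_norm. apply Rle_trans with M; [|apply Rmax_l].
  left. now apply HM.
Qed.

Lemma Cmod_bounded_below (f : R -> C) a b :
  a <= b -> (forall t, a <= t <= b -> continuous f t) ->
  (forall t, a <= t <= b -> f t <> RtoC 0) ->
  exists m, 0 < m /\ forall t, a <= t <= b -> m <= Cmod (f t).
Proof.
  intros Hab H Hz.
  destruct (continuity_ab_min (fun t => Cmod (f t)) a b Hab) as [t0 [H1 H2]].
  { intros t Ht. apply continuity_pt_filterlim. now apply (continuous_Cmod f t), H. }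
  exists (Cmod (f t0)). split; [|exact H1]. apply Cmod_gt_0. now apply Hz.
Qed.

(** * Locally constant functions *)

(** [T] carries no structure, so the values are turned into numbers by testing
    equality with the initial one; this test has derivative [0]. *)
Lemma locally_constant_const {T : Type} (F : R -> T) a b :
  (forall t, a <= t <= b -> locally t (fun s => F s = F t)) -> a <= b -> F a = F b.
Proof.
  intros H Hab.
  set (chi := fun t => if excluded_middle_informative (F t = F a) then RtoC 1 else RtoC 0).
  assert (E : chi a = chi b).
  { apply is_derive_C_zero_const; [exact Hab|]. intros t Ht.
    apply (is_derive_ext_loc (V := CR) (fun _ => chi t)); [|apply is_derive_Cconst].
    generalize (H t Ht). apply filter_imp. intros s Hs. unfold chi. now rewrite Hs. }
  unfold chi in E.
  destruct (excluded_middle_informative (F a = F a)) as [_|N]; [|now elim N].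
  destruct (excluded_middle_informative (F b = F a)) as [Y|_]; [congruence|].
  exfalso. injection E. lra.
Qed.

Lemma locally_constant_path {T : Type} (F : C -> T) (p : R -> C) a b :
  a <= b -> (forall t, a <= t <= b -> continuous p t) ->
  (forall t, a <= t <= b -> locally (p t) (fun z => F z = F (p t))) -> F (p a) = F (p b).
Proof.
  intros Hab Hp HF. apply (locally_constant_const (fun t => F (p t))); [|exact Hab].
  intros t Ht. apply (Hp t Ht (fun z => F z = F (p t))). now apply HF.
Qed.

(** * Regular simple closed curves *)

(** The velocity is a parameter of its own, so that what follows uses
    [is_derive] and never the total function [Derive]. *)
Record regular_loop (g dg : R -> C) : Prop := {
  loop_derive : forall t, is_derive (V := CR) g t (dg t);
  loop_dcont : forall t, continuous dg t;
  loop_period : forall t, g (t + 2 * PI) = g t;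
  loop_dperiod : forall t, dg (t + 2 * PI) = dg t;
  loop_inj : forall s t, 0 <= s < 2 * PI -> 0 <= t < 2 * PI -> g s = g t -> s = t;
  loop_regular : forall t, dg t <> RtoC 0 }.

Definition off_curve (g : R -> C) (z : C) : Prop := forall t, g t <> z.

Lemma periodic_shift {T} (f : R -> T) :
  (forall t, f (t + 2 * PI) = f t) ->
  forall (k : Z) t, f (t + IZR k * (2 * PI)) = f t.
Proof.
  intros H.
  assert (N : forall n t, f (t + INR n * (2 * PI)) = f t).
  { induction n as [|n IH]; intros t.
    - f_equal. simpl. ring.
    - rewrite S_INR. replace (t + (INR n + 1) * (2 * PI)) with ((t + INR n * (2 * PI)) + 2 * PI) by ring.
      now rewrite H. }
  intros k t. destruct (Z_le_gt_dec 0 k) as [L|L].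
  - rewrite <- (Z2Nat.id k L), <- INR_IZR_INZ. apply N.
  - rewrite <- (N (Z.to_nat (- k)) (t + IZR k * (2 * PI))).
    f_equal. rewrite INR_IZR_INZ, Z2Nat.id by lia. rewrite opp_IZR. ring.
Qed.

Lemma period_representative (a t : R) :
  exists k : Z, a <= t + IZR k * (2 * PI) < a + 2 * PI.
Proof.
  pose proof PI_RGT_0 as Hpi.
  destruct (archimed ((a - t) / (2 * PI))) as [H1 H2].
  set (u := up ((a - t) / (2 * PI))) in *.
  assert (E : (a - t) = (a - t) / (2 * PI) * (2 * PI)) by (field; lra).
  set (x := (a - t) / (2 * PI)) in *.
  destruct (Req_dec (IZR u - x) 1) as [K|K].
  - exists (u - 1)%Z. rewrite minus_IZR. split; nra.
  - exists u. split; nra.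
Qed.

Lemma periodic_reduce {T} (f : R -> T) (a t : R) :
  (forall t, f (t + 2 * PI) = f t) -> exists s, a <= s < a + 2 * PI /\ f s = f t.
Proof.
  intros H. destruct (period_representative a t) as [k Hk].
  exists (t + IZR k * (2 * PI)). split; [exact Hk|]. now apply periodic_shift.
Qed.

Lemma loop_continuous g dg : regular_loop g dg -> forall t, continuous g t.
Proof. intros H t. eapply is_derive_C_continuous. apply (loop_derive _ _ H). Qed.

Lemma loop_inj_near g dg : regular_loop g dg ->
  forall s t, g s = g t -> Rabs (s - t) < 2 * PI -> s = t.
Proof.
  intros H s t E Hst. pose proof PI_RGT_0 as Hpi.
  destruct (period_representative 0 s) as [k Hk].
  destruct (period_representative 0 t) as [l Hl].
  assert (E2 : s + IZR k * (2 * PI) = t + IZR l * (2 * PI)).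
  { apply (loop_inj _ _ H); try lra.
    rewrite !(periodic_shift g (loop_period _ _ H)). exact E. }
  assert (E3 : s - t = IZR (l - k) * (2 * PI)) by (rewrite minus_IZR; lra).
  assert (E4 : (l - k = 0)%Z).
  { apply Rabs_def2 in Hst. rewrite E3 in Hst.
    assert (-1 < IZR (l - k) < 1) by nra.
    destruct H0 as [A B]. apply lt_IZR in A. apply lt_IZR in B. lia. }
  rewrite E4 in E3. lra.
Qed.

Lemma curve_iff g dg : regular_loop g dg -> forall z, curve g z <-> exists t, z = g t.
Proof.
  intros H z. split.
  - intros [t [_ E]]. now exists t.
  - intros [t E]. destruct (periodic_reduce g 0 t (loop_period _ _ H)) as [s [Hs E2]].
    exists s. split; [lra|congruence].
Qed.

Lemma off_curve_iff g dg : regular_loop g dg -> forall z, off_curve g z <-> ~ curve g z.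
Proof.
  intros H z. rewrite (curve_iff g dg H). split.
  - intros A [t E]. now apply (A t).
  - intros A t E. apply A. now exists t.
Qed.

Lemma off_curve_distance g dg z : regular_loop g dg -> off_curve g z ->
  exists m, 0 < m /\ forall t, m <= Cmod (g t - z).
Proof.
  intros H Hz. pose proof PI_RGT_0 as Hpi.
  destruct (Cmod_bounded_below (fun t => g t - z)%C 0 (2 * PI)) as [m [Hm Hb]].
  - lra.
  - intros t _. apply continuous_Cminus; [now apply (loop_continuous g dg)|apply continuous_const].
  - intros t _ E. apply (Hz t). replace (g t) with ((g t - z) + z)%C by ring. rewrite E. ring.
  - exists m. split; [exact Hm|]. intros t.
    destruct (periodic_reduce g 0 t (loop_period _ _ H)) as [s [Hs E]].
    rewrite <- E. apply Hb. lra.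
Qed.

Lemma loop_separated g dg : regular_loop g dg -> forall t0 e, 0 < e <= PI ->
  exists m, 0 < m /\ forall t, t0 + e <= t <= t0 + 2 * PI - e -> m <= Cmod (g t - g t0).
Proof.
  intros H t0 e He.
  apply (Cmod_bounded_below (fun t => g t - g t0)%C).
  - lra.
  - intros t _. apply continuous_Cminus; [now apply (loop_continuous g dg)|apply continuous_const].
  - intros t Ht E. assert (t = t0); [|lra].
    apply (loop_inj_near g dg H).
    + replace (g t) with ((g t - g t0) + g t0)%C by ring. rewrite E. ring.
    + rewrite Rabs_pos_eq; lra.
Qed.

(** Near [t0] all velocities have a positive scalar product with each other, so
    the projection on the tangent at [t] is strictly monotone by the mean value
    theorem.  This is the local form of injectivity used below: it also rules out
    that a normal meets the curve again. *)
Lemma tangential_growth g dg : regular_loop g dg -> forall t0,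
  exists e c, 0 < e /\ e <= PI /\ 0 < c /\ forall s t,
    Rabs (s - t0) <= e -> Rabs (t - t0) <= e ->
    c * Rabs (s - t) <= Rabs (Re ((g s - g t) * Cconj (dg t))%C).
Proof.
  intros H t0. pose proof PI_RGT_0 as Hpi.
  set (r := Cmod (dg t0)).
  assert (Hr : 0 < r) by (apply Cmod_gt_0, (loop_regular _ _ H)).
  destruct (continuous_eps dg t0 (loop_dcont _ _ H t0) (r / 4)) as [d [Hd Hc]]; [lra|].
  exists (Rmin (d / 2) PI), (r * r / 8).
  split; [apply Rmin_pos; lra|]. split; [apply Rmin_r|]. split; [nra|].
  intros s t Hs Ht.
  assert (Hmin := Rmin_l (d / 2) PI).
  assert (Hdt : forall x, Rabs (x - t0) <= Rmin (d / 2) PI -> Cmod (dg x - dg t0) < r / 4).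
  { intros x Hx. apply Hc. lra. }
  assert (Hpos : forall x, Rabs (x - t0) <= Rmin (d / 2) PI ->
             r * r / 8 <= Re (dg x * Cconj (dg t))%C).
  { intros x Hx. pose proof (Hdt x Hx) as A. pose proof (Hdt t Ht) as B.
    replace (dg x * Cconj (dg t))%C
      with (dg t * Cconj (dg t) + (dg x - dg t) * Cconj (dg t))%C by ring.
    rewrite <- Cmod2_conj.
    assert (D : Cmod (dg x - dg t) <= r / 2).
    { replace (dg x - dg t)%C with ((dg x - dg t0) + - (dg t - dg t0))%C by ring.
      eapply Rle_trans; [apply Cmod_triangle|]. rewrite Cmod_opp. lra. }
    assert (L : 3 * r / 4 <= Cmod (dg t)).
    { assert (r <= Cmod (dg t) + Cmod (dg t - dg t0)); [|lra].
      unfold r. replace (dg t0) with (dg t + - (dg t - dg t0))%C at 1 by ring.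
      eapply Rle_trans; [apply Cmod_triangle|]. rewrite Cmod_opp. lra. }
    assert (Q : Rabs (Re ((dg x - dg t) * Cconj (dg t))%C) <= r / 2 * Cmod (dg t)).
    { eapply Rle_trans; [apply re_le_Cmod|]. rewrite Cmod_mult, Cmod_conj.
      apply Rmult_le_compat_r; [apply Cmod_ge_0|exact D]. }
    apply Rabs_le_between in Q.
    change (r * r / 8 <= Re (RtoC (Cmod (dg t) ^ 2)) + Re ((dg x - dg t) * Cconj (dg t))%C).
    change (Re (RtoC (Cmod (dg t) ^ 2))) with (Cmod (dg t) ^ 2).
    set (q := Re ((dg x - dg t) * Cconj (dg t))%C) in *. set (y := Cmod (dg t)) in *.
    assert (3 * r / 4 * (r / 4) <= y * (y - r / 2)) by (apply Rmult_le_compat; lra). nra. }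
  destruct (MVT_gen (fun x => Re (g x * Cconj (dg t))%C) t s
              (fun x => Re (dg x * Cconj (dg t))%C)) as [x [Hx E]].
  - intros x _. apply is_derive_Re.
    replace (dg x * Cconj (dg t))%C with (dg x * Cconj (dg t) + g x * 0)%C by ring.
    apply is_derive_Cmult; [apply (loop_derive _ _ H)|apply is_derive_Cconst].
  - intros x _. apply continuity_pt_filterlim.
    apply (continuous_Re (fun x => g x * Cconj (dg t))%C).
    apply continuous_Cmult; [now apply (loop_continuous g dg)|apply continuous_const].
  - replace (Re ((g s - g t) * Cconj (dg t))%C)
      with (Re (g s * Cconj (dg t))%C - Re (g t * Cconj (dg t))%C) by (simpl; ring).
    rewrite E, Rabs_mult.
    apply Rmult_le_compat_r; [apply Rabs_pos|].
    eapply Rle_trans; [|apply Rle_abs]. apply Hpos.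
    apply Rabs_le_between. apply Rabs_le_between in Hs. apply Rabs_le_between in Ht.
    destruct Hx as [X1 X2]. set (e := Rmin (d / 2) PI) in *.
    split.
    + eapply Rle_trans with (Rmin t s - t0); [|lra]. unfold Rmin; destruct (Rle_dec t s); lra.
    + eapply Rle_trans with (Rmax t s - t0); [lra|]. unfold Rmax; destruct (Rle_dec t s); lra.
Qed.

Definition normal_point (g dg : R -> C) (t s : R) : C := (g t + RtoC s * (Ci * dg t))%C.

(** A second point of the curve on the normal at [t] has tangential component [0]
    as seen from [g t], which [tangential_growth] excludes near [t0]; the rest of
    the curve keeps a positive distance from [g t0] by simplicity and
    compactness. *)
Lemma tube_off_curve g dg : regular_loop g dg -> forall t0,
  exists e, 0 < e /\ forall t s, Rabs (t - t0) < e -> 0 < Rabs s < e ->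
    off_curve g (normal_point g dg t s).
Proof.
  intros H t0. pose proof PI_RGT_0 as Hpi.
  destruct (tangential_growth g dg H t0) as (e1 & c & He1 & He1' & Hc & Hg).
  destruct (loop_separated g dg H t0 e1 (conj He1 He1')) as [m [Hm Hs]].
  destruct (continuous_eps g t0 (loop_continuous g dg H t0) (m / 2)) as [d1 [Hd1 C1]]; [lra|].
  set (r := Cmod (dg t0)).
  assert (Hr : 0 < r) by (apply Cmod_gt_0, (loop_regular _ _ H)).
  destruct (continuous_eps dg t0 (loop_dcont _ _ H t0) r Hr) as [d2 [Hd2 C2]].
  set (q := m / (4 * r)).
  assert (Hq : 0 < q) by (apply Rdiv_lt_0_compat; lra).
  exists (Rmin (Rmin e1 q) (Rmin d1 d2)).
  split. { repeat apply Rmin_pos; lra. }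
  intros t s Ht [Hs0 Hs1] x.
  assert (A1 := Rmin_l (Rmin e1 q) (Rmin d1 d2)). assert (A2 := Rmin_r (Rmin e1 q) (Rmin d1 d2)).
  assert (A3 := Rmin_l e1 q). assert (A4 := Rmin_r e1 q).
  assert (A5 := Rmin_l d1 d2). assert (A6 := Rmin_r d1 d2).
  destruct (periodic_reduce g (t0 - e1) x (loop_period _ _ H)) as [y [Hy <-]].
  unfold normal_point. intros E.
  assert (Hsd : Cmod (RtoC s * (Ci * dg t)) = Rabs s * Cmod (dg t)).
  { rewrite !Cmod_mult, Cmod_R, Cmod_Ci. ring. }
  destruct (Rle_or_lt y (t0 + e1)) as [L|L].
  - assert (K := Hg y t). rewrite E in K.
    replace (Re ((g t + RtoC s * (Ci * dg t) - g t) * Cconj (dg t))%C) with 0 in K by (simpl; ring).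
    rewrite Rabs_R0 in K.
    assert (y = t).
    { destruct (Req_dec y t) as [|N]; [assumption|exfalso].
      assert (0 < Rabs (y - t)) by (apply Rabs_pos_lt; lra).
      assert (0 < c * Rabs (y - t)) by (now apply Rmult_lt_0_compat).
      apply Rlt_not_le in H1. apply H1. apply K.
      - apply Rabs_le_between; lra.
      - lra. }
    subst y. assert (Z : (RtoC s * (Ci * dg t) = 0)%C).
    { replace (RtoC s * (Ci * dg t))%C with ((g t + RtoC s * (Ci * dg t)) - g t)%C by ring.
      rewrite <- E. ring. }
    rewrite Z, Cmod_0 in Hsd.
    assert (0 < Cmod (dg t)) by (apply Cmod_gt_0, (loop_regular _ _ H)). nra.
  - assert (K := Hs y). specialize (K ltac:(lra)). rewrite E in K.
    assert (B1 := C1 t ltac:(lra)). assert (B2 := C2 t ltac:(lra)).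
    assert (B3 : Cmod (dg t) < 2 * r).
    { replace (dg t) with ((dg t - dg t0) + dg t0)%C by ring.
      eapply Rle_lt_trans; [apply Cmod_triangle|]. fold r. lra. }
    assert (B4 : Cmod (g t + RtoC s * (Ci * dg t) - g t0) < m); [|lra].
    replace (g t + RtoC s * (Ci * dg t) - g t0)%C with ((g t - g t0) + RtoC s * (Ci * dg t))%C by ring.
    eapply Rle_lt_trans; [apply Cmod_triangle|]. rewrite Hsd.
    assert (Rabs s * Cmod (dg t) <= q * (2 * r)).
    { apply Rmult_le_compat; try lra. apply Cmod_ge_0. }
    assert (q * (2 * r) = m / 2) by (unfold q; field; lra). lra.
Qed.

(** * The two sides of the curve *)

Definition locally_constant_off {T} (g : R -> C) (F : C -> T) : Prop :=
  forall z, off_curve g z -> locally z (fun w => F w = F z).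

Lemma normal_point_continuous g dg (x y : R -> R) t :
  regular_loop g dg -> continuous x t -> continuous y t ->
  continuous (fun u => normal_point g dg (x u) (y u)) t.
Proof.
  intros H Hx Hy. unfold normal_point.
  apply continuous_Cplus.
  - apply (continuous_comp x g t Hx). now apply (loop_continuous g dg).
  - apply continuous_Cmult; [now apply continuous_RtoC|].
    apply continuous_Cmult; [apply continuous_const|].
    apply (continuous_comp x dg t Hx). apply (loop_dcont _ _ H).
Qed.

Lemma continuous_affine (a b t : R) : continuous (fun u : R => a + u * b) t.
Proof.
  apply (ex_derive_continuous (fun u : R => a + u * b)). auto_derive. exact I.
Qed.

(** The two sides are parametrized by [sigma = 1] and [sigma = -1].  Inside a tube
    any two points of the same side are joined by a path avoiding the curve, so
    the value of [F] close to the curve is locally constant in [t], hence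
    constant. *)
Lemma sides {T} g dg (F : C -> T) (sigma : R) :
  regular_loop g dg -> locally_constant_off g F -> Rabs sigma = 1 ->
  exists w, forall t, exists d, 0 < d /\ forall s, 0 < s < d ->
    F (normal_point g dg t (sigma * s)) = w.
Proof.
  intros H HF Hsig.
  assert (L : forall t0, exists w : T, exists e, 0 < e /\ forall t, Rabs (t - t0) < e ->
             forall s, 0 < s < e -> F (normal_point g dg t (sigma * s)) = w).
  { intros t0. destruct (tube_off_curve g dg H t0) as [e [He Ht]].
    exists (F (normal_point g dg t0 (sigma * (e / 2)))). exists e. split; [exact He|].
    intros t Htt s Hs. symmetry.
    (* Affine in both parameters, so that it stays in the tube. *)
    set (p := fun u => normal_point g dg (t0 + u * (t - t0)) (sigma * (e / 2) + u * (sigma * (s - e / 2)))).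
    replace (normal_point g dg t0 (sigma * (e / 2))) with (p 0).
    2: { unfold p. f_equal; ring. }
    replace (normal_point g dg t (sigma * s)) with (p 1).
    2: { unfold p. f_equal; ring. }
    apply (locally_constant_path F p 0 1); [lra| |].
    - intros u Hu. apply normal_point_continuous; [exact H| |]; apply continuous_affine.
    - intros u Hu. apply HF. apply Ht.
      + replace (t0 + u * (t - t0) - t0) with (u * (t - t0)) by ring.
        rewrite Rabs_mult, (Rabs_pos_eq u) by lra.
        assert (0 <= Rabs (t - t0)) by apply Rabs_pos. nra.
      + replace (sigma * (e / 2) + u * (sigma * (s - e / 2)))
          with (sigma * (e / 2 + u * (s - e / 2))) by ring.
        rewrite Rabs_mult, Hsig, Rabs_pos_eq by nra. nra. }
  destruct (constructive_indefinite_description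
              (fun w : R -> T => forall t0, exists e, 0 < e /\ forall t, Rabs (t - t0) < e ->
                 forall s, 0 < s < e -> F (normal_point g dg t (sigma * s)) = w t0)) as [w Hw].
  { exists (fun t0 => proj1_sig (constructive_indefinite_description _ (L t0))).
    intros t0. exact (proj2_sig (constructive_indefinite_description _ (L t0))). }
  assert (Hloc : forall t, locally t (fun s => w s = w t)).
  { intros t. destruct (Hw t) as [e [He Ht]].
    apply locally_ball_R. exists e. split; [exact He|]. intros y Hy.
    destruct (Hw y) as [e2 [He2 Hy2]].
    set (s := Rmin e e2 / 2).
    assert (0 < Rmin e e2) by (now apply Rmin_pos).
    assert (A1 := Rmin_l e e2). assert (A2 := Rmin_r e e2).
    rewrite <- (Ht y Hy s) by (unfold s; lra).
    symmetry. apply Hy2; [|unfold s; lra].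
    replace (y - y) with 0 by ring. now rewrite Rabs_R0. }
  exists (w 0). intros t. destruct (Hw t) as [e [He Ht]].
  exists e. split; [exact He|]. intros s Hs. rewrite (Ht t); [| |exact Hs].
  - destruct (Rle_or_lt 0 t) as [K|K].
    + symmetry. apply locally_constant_const; auto.
    + apply locally_constant_const; auto; lra.
  - replace (t - t) with 0 by ring. now rewrite Rabs_R0.
Qed.

(** The first-order condition at the nearest point of the curve puts [z] on its
    normal; the points in between are closer to [z] than the curve is. *)
Lemma nearest_point g dg z : regular_loop g dg -> off_curve g z ->
  exists t s, s <> 0 /\ z = normal_point g dg t s /\
    forall u, 0 < u <= 1 -> off_curve g (normal_point g dg t (u * s)).
Proof.
  intros H Hz. pose proof PI_RGT_0 as Hpi.
  destruct (continuity_ab_min (fun t => Cmod (g t - z)) 0 (2 * PI)) as [t [Hmin _]].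
  { lra. }
  { intros t _. apply continuity_pt_filterlim. apply (continuous_Cmod (fun t => g t - z)%C).
    apply continuous_Cminus; [now apply (loop_continuous g dg)|apply continuous_const]. }
  assert (Hm : forall x, Cmod (g t - z) <= Cmod (g x - z)).
  { intros x. destruct (periodic_reduce g 0 x (loop_period _ _ H)) as [y [Hy <-]].
    apply Hmin. lra. }
  set (r := Cmod (dg t)).
  assert (Hr : 0 < r) by (apply Cmod_gt_0, (loop_regular _ _ H)).
  (* The squared distance is differentiable and also minimal at [t]. *)
  assert (Ort : Re ((g t - z) * Cconj (dg t))%C = 0).
  { set (h := fun x => Re (g x - z)%C * Re (g x - z)%C + Im (g x - z)%C * Im (g x - z)%C).
    assert (Hd : is_derive h t (2 * Re ((g t - z) * Cconj (dg t))%C)).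
    { assert (D : is_derive (V := CR) (fun x => g x - z)%C t (dg t)).
      { replace (dg t) with (dg t - 0)%C by ring.
        apply is_derive_Cminus; [apply (loop_derive _ _ H)|apply is_derive_Cconst]. }
      pose proof (is_derive_Re _ _ _ D) as D1. pose proof (is_derive_Im _ _ _ D) as D2.
      set (a := fun x => Re (g x - z)%C) in *. set (b := fun x => Im (g x - z)%C) in *.
      change (is_derive (fun x : R => a x * a x + b x * b x) t (2 * Re ((g t - z) * Cconj (dg t))%C)).
      auto_derive. { repeat split; eexists; eassumption. }
      rewrite (is_derive_unique (fun x : R => a x) t _ D1), (is_derive_unique (fun x : R => b x) t _ D2).
      unfold a, b, Re, Im. simpl. ring. }
    assert (Hh : forall x, h t <= h x).
    { assert (E : forall x, h x = Cmod (g x - z) ^ 2).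
      { intros x. rewrite Cmod2_alt. unfold h. ring. }
      intros x. rewrite !E. apply pow_incr. split; [apply Cmod_ge_0|apply Hm]. }
    assert (pr : derivable_pt h t) by (eexists; apply is_derive_Reals; exact Hd).
    assert (Z : derive_pt h t pr = 0).
    { apply (deriv_minimum h (t - 1) (t + 1)); try lra. intros x _ _. apply Hh. }
    assert (Z2 := derive_pt_eq_0 h t _ pr (proj1 (is_derive_Reals h t _) Hd)). lra. }
  set (s := Im ((z - g t) * Cconj (dg t))%C / r ^ 2).
  assert (Ez : z = normal_point g dg t s).
  { assert (E1 : ((z - g t) * Cconj (dg t) = RtoC (s * r ^ 2) * Ci)%C).
    { assert (Ort' : Re ((z - g t) * Cconj (dg t))%C = 0) by (simpl in *; lra).
      unfold s. replace (Im ((z - g t) * Cconj (dg t))%C / r ^ 2 * r ^ 2) with (Im ((z - g t) * Cconj (dg t))%C)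
        by (field; lra).
      destruct ((z - g t) * Cconj (dg t))%C as [a b]. simpl in Ort'. rewrite Ort'.
      unfold Cmult, Ci, RtoC. simpl. f_equal; ring. }
    assert (E2 : (Cconj (dg t) * dg t = RtoC (r ^ 2))%C).
    { unfold r. rewrite Cmod2_conj. ring. }
    assert (Nz : RtoC (r ^ 2) <> RtoC 0).
    { intros E. injection E as E. nra. }
    unfold normal_point.
    replace z with (g t + (z - g t) * Cconj (dg t) * dg t / RtoC (r ^ 2))%C.
    2: { rewrite <- E2. field. split; [apply (loop_regular _ _ H)|].
         intros E. rewrite E in E2. apply Nz. rewrite <- E2. ring. }
    rewrite E1, RtoC_mult. field. exact Nz. }
  assert (Hd0 : Cmod (g t - z) > 0).
  { apply Cmod_gt_0. intros E. apply (Hz t). replace (g t) with ((g t - z) + z)%C by ring.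
    rewrite E. ring. }
  exists t, s. split; [|split; [exact Ez|]].
  - intros E. rewrite E in Ez. unfold normal_point in Ez. apply (Hz t). rewrite Ez. ring.
  - intros u Hu x E.
    assert (K := Hm x). rewrite E in K.
    replace (normal_point g dg t (u * s) - z)%C with (RtoC (1 - u) * (g t - z))%C in K.
    2: { rewrite Ez at 1. rewrite Ez at 1. unfold normal_point. rewrite RtoC_minus, RtoC_mult. ring. }
    rewrite Cmod_mult, Cmod_R, Rabs_pos_eq in K by lra. nra.
Qed.

(** [F] is constant along the normal segment, on which it can be evaluated
    arbitrarily close to the curve. *)
Lemma off_curve_sides {T} g dg (F : C -> T) wp wm :
  regular_loop g dg -> locally_constant_off g F ->
  (forall t, exists d, 0 < d /\ forall s, 0 < s < d -> F (normal_point g dg t s) = wp) ->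
  (forall t, exists d, 0 < d /\ forall s, 0 < s < d -> F (normal_point g dg t (- s)) = wm) ->
  forall t s, s <> 0 ->
    (forall u, 0 < u <= 1 -> off_curve g (normal_point g dg t (u * s))) ->
    F (normal_point g dg t s) = if Rlt_dec 0 s then wp else wm.
Proof.
  intros H HF Hp Hm t s Hs Hu.
  assert (K : forall u, 0 < u < 1 -> F (normal_point g dg t (u * s)) = F (normal_point g dg t s)).
  { intros u Hu1.
    set (p := fun v => normal_point g dg (t + v * 0) (0 + v * s)).
    replace (normal_point g dg t (u * s)) with (p u) by (unfold p; f_equal; ring).
    replace (normal_point g dg t s) with (p 1) by (unfold p; f_equal; ring).
    apply (locally_constant_path F p u 1); [lra| |].
    - intros v Hv. apply normal_point_continuous; [exact H| |]; apply continuous_affine.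
    - intros v Hv. apply HF. unfold p.
      replace (t + v * 0) with t by ring. replace (0 + v * s) with (v * s) by ring. apply Hu. lra. }
  destruct (Rlt_dec 0 s) as [P|P].
  - destruct (Hp t) as [d [Hd Hdd]].
    assert (0 < Rmin (d / (2 * s)) (1 / 2)).
    { apply Rmin_pos; [apply Rdiv_lt_0_compat|]; lra. }
    rewrite <- (K (Rmin (d / (2 * s)) (1 / 2))).
    + apply Hdd. split; [now apply Rmult_lt_0_compat|].
      apply Rle_lt_trans with (d / (2 * s) * s).
      * apply Rmult_le_compat_r; [lra|apply Rmin_l].
      * replace (d / (2 * s) * s) with (d / 2) by (field; lra). lra.
    + split; [assumption|]. assert (A := Rmin_r (d / (2 * s)) (1 / 2)). lra.
  - assert (P' : 0 < - s) by lra.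
    destruct (Hm t) as [d [Hd Hdd]].
    assert (0 < Rmin (d / (2 * - s)) (1 / 2)).
    { apply Rmin_pos; [apply Rdiv_lt_0_compat|]; lra. }
    rewrite <- (K (Rmin (d / (2 * - s)) (1 / 2))).
    + replace (Rmin (d / (2 * - s)) (1 / 2) * s) with (- (Rmin (d / (2 * - s)) (1 / 2) * - s)) by ring.
      apply Hdd. split; [now apply Rmult_lt_0_compat|].
      apply Rle_lt_trans with (d / (2 * - s) * - s).
      * apply Rmult_le_compat_r; [lra|apply Rmin_l].
      * replace (d / (2 * - s) * - s) with (d / 2) by (field; lra). lra.
    + split; [assumption|]. assert (A := Rmin_r (d / (2 * - s)) (1 / 2)). lra.
Qed.

(** * Cauchy integrals *)

(** The density [f] includes the velocity factor [dg] of the contour integral. *)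
Definition cauchy_integral (g f : R -> C) (z : C) : C :=
  RInt (V := CRc) (fun t => f t / (g t - z))%C 0 (2 * PI).

Definition cauchy_derivative (g f : R -> C) (z : C) : C :=
  RInt (V := CRc) (fun t => f t / (g t - z) ^ 2)%C 0 (2 * PI).

Lemma off_curve_sub g z t : off_curve g z -> (g t - z)%C <> RtoC 0.
Proof.
  intros H E. apply (H t). replace (g t) with ((g t - z) + z)%C by ring. rewrite E. ring.
Qed.

Lemma continuous_cauchy_kernel g dg f z t :
  regular_loop g dg -> continuous f t -> off_curve g z ->
  continuous (fun t => f t / (g t - z))%C t.
Proof.
  intros H Hf Hz. apply continuous_Cmult; [exact Hf|].
  apply (continuous_Cinv (fun t => g t - z)%C); [|now apply off_curve_sub].
  apply continuous_Cminus; [now apply (loop_continuous g dg)|apply continuous_const].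
Qed.

Lemma continuous_cauchy_kernel2 g dg f z t :
  regular_loop g dg -> continuous f t -> off_curve g z ->
  continuous (fun t => f t / (g t - z) ^ 2)%C t.
Proof.
  intros H Hf Hz. apply continuous_Cmult; [exact Hf|].
  apply (continuous_Cinv (fun t => (g t - z) ^ 2)%C); [|now apply Cpow_nz, off_curve_sub].
  apply continuous_Cpow.
  apply continuous_Cminus; [now apply (loop_continuous g dg)|apply continuous_const].
Qed.

Lemma two_PI_pos : 0 < 2 * PI.
Proof. pose proof PI_RGT_0. lra. Qed.

Lemma is_RInt_cauchy g dg f z :
  regular_loop g dg -> (forall t, continuous f t) -> off_curve g z ->
  is_RInt (V := CR) (fun t => f t / (g t - z))%C 0 (2 * PI) (cauchy_integral g f z).
Proof.
  intros H Hf Hz. pose proof two_PI_pos. apply is_RInt_C_correct; [lra|].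
  intros t _. now apply (continuous_cauchy_kernel g dg).
Qed.

Lemma is_RInt_cauchy_derivative g dg f z :
  regular_loop g dg -> (forall t, continuous f t) -> off_curve g z ->
  is_RInt (V := CR) (fun t => f t / (g t - z) ^ 2)%C 0 (2 * PI) (cauchy_derivative g f z).
Proof.
  intros H Hf Hz. pose proof two_PI_pos. apply is_RInt_C_correct; [lra|].
  intros t _. now apply (continuous_cauchy_kernel2 g dg).
Qed.

Lemma Cmod_sub_triangle (a b : C) : Cmod a - Cmod b <= Cmod (a - b).
Proof.
  assert (Cmod a <= Cmod (a - b) + Cmod b); [|lra].
  replace a with ((a - b) + b)%C at 1 by ring. apply Cmod_triangle.
Qed.

(** The remainder of the expansion is [(z - z0)^2] times the integral of
    [f / ((g - z) (g - z0)^2)], which is bounded near [z0]. *)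
Lemma cauchy_expansion g dg f z0 :
  regular_loop g dg -> (forall t, continuous f t) -> off_curve g z0 ->
  exists B d, 0 < B /\ 0 < d /\ forall z, Cmod (z - z0) < d ->
    off_curve g z /\
    Cmod (cauchy_integral g f z - cauchy_integral g f z0 - (z - z0) * cauchy_derivative g f z0)
      <= B * Cmod (z - z0) ^ 2.
Proof.
  intros H Hf Hz0. pose proof two_PI_pos as Hpi.
  destruct (off_curve_distance g dg z0 H Hz0) as [m [Hm Hd]].
  destruct (Cmod_bounded f 0 (2 * PI)) as [M [HM Hb]]; [auto|].
  assert (Hm3 : 0 < m / 2 * m ^ 2) by (apply Rmult_lt_0_compat; [lra|now apply pow_lt]).
  exists (2 * PI * (M / (m / 2 * m ^ 2))), (m / 2).
  split. { apply Rmult_lt_0_compat; [lra|]. now apply Rdiv_lt_0_compat. }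
  split; [lra|]. intros z Hz.
  assert (Hlow : forall t, m / 2 <= Cmod (g t - z)).
  { intros t. replace (g t - z)%C with ((g t - z0) - (z - z0))%C by ring.
    eapply Rle_trans; [|apply Cmod_sub_triangle]. specialize (Hd t). lra. }
  assert (Hoff : off_curve g z).
  { intros t E. specialize (Hlow t). replace (g t - z)%C with (RtoC 0) in Hlow by (rewrite E; ring).
    rewrite Cmod_0 in Hlow. lra. }
  split; [exact Hoff|].
  assert (I := is_RInt_Cminus _ _ _ _ _ _
     (is_RInt_Cminus _ _ _ _ _ _ (is_RInt_cauchy g dg f z H Hf Hoff) (is_RInt_cauchy g dg f z0 H Hf Hz0))
     (is_RInt_Cscal (z - z0) _ _ _ _ (is_RInt_cauchy_derivative g dg f z0 H Hf Hz0))).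
  replace (2 * PI * (M / (m / 2 * m ^ 2)) * Cmod (z - z0) ^ 2)
    with ((2 * PI - 0) * (M / (m / 2 * m ^ 2) * Cmod (z - z0) ^ 2)) by ring.
  eapply Cmod_is_RInt_le_const; [|  |exact I]; [lra|].
  intros t Ht. cbv beta.
  assert (N1 := off_curve_sub g z t Hoff). assert (N0 := off_curve_sub g z0 t Hz0).
  replace (f t / (g t - z) - f t / (g t - z0) - (z - z0) * (f t / (g t - z0) ^ 2))%C
    with (f t * / ((g t - z) * (g t - z0) ^ 2) * (z - z0) ^ 2)%C.
  2: { field. now split. }
  rewrite !Cmod_mult, Cmod_pow.
  rewrite Cmod_inv by (apply Cmult_neq_0; [|apply Cpow_nz]; assumption).
  rewrite Cmod_mult, Cmod_pow.
  apply Rmult_le_compat_r; [apply pow2_ge_0|].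
  apply Rmult_le_compat; [apply Cmod_ge_0| |now apply Hb|].
  - left. apply Rinv_0_lt_compat. apply Rmult_lt_0_compat; [|apply pow_lt]; now apply Cmod_gt_0.
  - apply Rinv_le_contravar; [exact Hm3|].
    apply Rmult_le_compat; [lra|apply pow2_ge_0|apply Hlow|].
    apply pow_incr. split; [lra|apply Hd].
Qed.

Lemma is_derive_quadratic (h : R -> C) x (l : C) B d :
  0 < d -> (forall y, Rabs (y - x) < d -> Cmod (h y - h x - RtoC (y - x) * l) <= B * Rabs (y - x) ^ 2) ->
  is_derive (V := CR) h x l.
Proof.
  intros Hd H. split; [apply is_linear_scal_l|].
  intros x' Hx'.
  apply (is_filter_lim_locally_unique (K := R_AbsRing) (V := R_NormedModule) x x') in Hx'. subst x'.
  intros eps. apply locally_ball_R.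
  assert (HB : 0 < Rabs B + 1) by (pose proof (Rabs_pos B); lra).
  exists (Rmin d (eps / (Rabs B + 1))). split.
  { apply Rmin_pos; [exact Hd|]. apply Rdiv_lt_0_compat; [apply cond_pos|exact HB]. }
  intros y Hy.
  assert (Hy1 : Rabs (y - x) < d) by (eapply Rlt_le_trans; [exact Hy|apply Rmin_l]).
  assert (Hy2 : Rabs (y - x) < eps / (Rabs B + 1)) by (eapply Rlt_le_trans; [exact Hy|apply Rmin_r]).
  specialize (H y Hy1). rewrite <- Cmod_norm.
  match goal with |- Cmod ?a <= _ => replace a with (h y - h x - RtoC (y - x) * l)%C end.
  2: { unfold minus, plus, opp, scal; simpl. unfold prod_plus, prod_opp, prod_scal, plus, opp, scal; simpl.
       unfold mult; simpl. unfold Cminus, Cplus, Copp, Cmult, RtoC; simpl. f_equal; ring. }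
  eapply Rle_trans; [exact H|].
  change (norm (minus y x)) with (Rabs (y - x)).
  apply Rle_trans with ((Rabs B + 1) * Rabs (y - x) * Rabs (y - x)).
  - simpl. pose proof (Rle_abs B). pose proof (Rabs_pos (y - x)). nra.
  - apply Rmult_le_compat_r; [apply Rabs_pos|].
    apply Rmult_lt_compat_l with (r := Rabs B + 1) in Hy2; [|exact HB].
    replace ((Rabs B + 1) * (eps / (Rabs B + 1))) with (pos eps) in Hy2 by (field; lra). lra.
Qed.

(** The integrand has the periodic primitive [- 1 / (g - z)]. *)
Lemma winding_derivative_zero g dg z :
  regular_loop g dg -> off_curve g z -> cauchy_derivative g dg z = RtoC 0.
Proof.
  intros H Hz. pose proof two_PI_pos.
  assert (D : forall t, is_derive (V := CR) (fun t => - / (g t - z))%C t (dg t / (g t - z) ^ 2)%C).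
  { intros t. assert (N := off_curve_sub g z t Hz).
    replace (dg t / (g t - z) ^ 2)%C with (- - ((dg t - 0) / ((g t - z) * (g t - z))))%C by (field; exact N).
    apply (is_derive_opp (V := CR)). apply (is_derive_Cinv (fun t => g t - z)%C); [|exact N].
    apply is_derive_Cminus; [apply (loop_derive _ _ H)|apply is_derive_Cconst]. }
  apply is_RInt_C_unique.
  replace (RtoC 0) with (- / (g (2 * PI)%R - z) - - / (g 0%R - z))%C.
  - apply (is_RInt_C_derive (fun t => - / (g t - z))%C); [lra| |].
    + intros t _. apply D.
    + intros t _. apply (continuous_cauchy_kernel2 g dg); auto. apply (loop_dcont _ _ H).
  - replace (2 * PI) with (0 + 2 * PI) by ring. rewrite (loop_period _ _ H). ring.
Qed.

(** Along a segment that avoids the curve, the derivative given by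
    [cauchy_expansion] vanishes by [winding_derivative_zero]. *)
Lemma winding_locally_constant g dg :
  regular_loop g dg -> locally_constant_off g (cauchy_integral g dg).
Proof.
  intros H z0 Hz0.
  pose proof (loop_dcont _ _ H) as Hc.
  destruct (cauchy_expansion g dg dg z0 H Hc Hz0) as (B & d & HB & Hd & He).
  apply locally_ball_Cmod. exists d. split; [exact Hd|]. intros z Hz.
  set (p := fun s : R => (z0 + RtoC s * (z - z0))%C).
  replace z with (p 1) by (unfold p; ring).
  replace (cauchy_integral g dg z0) with (cauchy_integral g dg (p 0)) by (f_equal; unfold p; ring).
  symmetry. apply (is_derive_C_zero_const (fun s => cauchy_integral g dg (p s))); [lra|].
  intros s Hs.
  assert (Hoff : off_curve g (p s)).
  { apply He. unfold p. replace (z0 + RtoC s * (z - z0) - z0)%C with (RtoC s * (z - z0))%C by ring.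
    rewrite Cmod_mult, Cmod_R, Rabs_pos_eq by lra.
    pose proof (Cmod_ge_0 (z - z0)). nra. }
  destruct (cauchy_expansion g dg dg (p s) H Hc Hoff) as (B' & d' & HB' & Hd' & He').
  rewrite (winding_derivative_zero g dg (p s) H Hoff) in He'.
  assert (Hq : 0 < Cmod (z - z0) + 1) by (pose proof (Cmod_ge_0 (z - z0)); lra).
  apply (is_derive_quadratic _ s 0 (B' * Cmod (z - z0) ^ 2) (d' / (Cmod (z - z0) + 1))).
  { now apply Rdiv_lt_0_compat. }
  intros y Hy.
  assert (E : (p y - p s = RtoC (y - s) * (z - z0))%C).
  { unfold p. rewrite RtoC_minus. ring. }
  assert (Em : Cmod (p y - p s) = Rabs (y - s) * Cmod (z - z0)) by (rewrite E, Cmod_mult, Cmod_R; reflexivity).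
  destruct (He' (p y)) as [_ K].
  { rewrite Em. apply Rle_lt_trans with (Rabs (y - s) * (Cmod (z - z0) + 1)).
    - apply Rmult_le_compat_l; [apply Rabs_pos|lra].
    - apply Rmult_lt_compat_r with (r := Cmod (z - z0) + 1) in Hy; [|exact Hq].
      replace (d' / (Cmod (z - z0) + 1) * (Cmod (z - z0) + 1)) with d' in Hy by (field; lra). exact Hy. }
  rewrite Em in K.
  replace (RtoC (y - s) * 0)%C with ((p y - p s) * 0)%C by ring.
  eapply Rle_trans; [exact K|]. right. ring.
Qed.

(** * The jump of the winding number across the curve *)

Lemma Cmod_mean_value (f df : R -> C) a b M :
  (forall t, is_derive (V := CR) f t (df t)) -> (forall t, continuous df t) ->
  (forall t, Rmin a b <= t <= Rmax a b -> Cmod (df t) <= M) ->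
  Cmod (f b - f a) <= M * Rabs (b - a).
Proof.
  intros Hd Hc Hb. destruct (Rle_or_lt a b) as [L|L].
  - rewrite Rabs_pos_eq, Rmult_comm by lra.
    apply (Cmod_is_RInt_le_const df a b); [exact L| |now apply is_RInt_C_derive].
    rewrite Rmin_left, Rmax_right in Hb by lra. exact Hb.
  - rewrite Rabs_left, Rmult_comm by lra. rewrite <- Cmod_opp.
    replace (- (f b - f a))%C with (f a - f b)%C by ring. replace (- (b - a)) with (a - b) by ring.
    apply (Cmod_is_RInt_le_const df b a); [lra| |apply is_RInt_C_derive; auto; lra].
    rewrite Rmin_right, Rmax_left in Hb by lra. exact Hb.
Qed.

Lemma atan_le_id x : 0 <= x -> atan x <= x.
Proof.
  intros Hx. destruct (MVT_gen atan 0 x (fun t => / (1 + t ^ 2))) as [c [_ E]].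
  - intros t _. apply is_derive_Reals. apply derivable_pt_lim_atan.
  - intros t _. apply derivable_continuous_pt, derivable_pt_atan.
  - rewrite atan_0 in E.
    assert (/ (1 + c ^ 2) <= 1).
    { rewrite <- Rinv_1. apply Rinv_le_contravar; [lra|]. pose proof (pow2_ge_0 c). lra. }
    nra.
Qed.

(** The Poisson kernel of the half-plane, centred at the middle [PI] of the
    parameter interval. *)
Lemma is_RInt_poisson e : 0 < e ->
  is_RInt (fun t => e / ((t - PI) ^ 2 + e ^ 2)) 0 (2 * PI) (2 * atan (PI / e)).
Proof.
  intros He. pose proof two_PI_pos.
  replace (2 * atan (PI / e)) with (minus (atan ((2 * PI - PI) / e)) (atan ((0 - PI) / e))).
  2: { unfold minus, plus, opp; simpl. replace ((0 - PI) / e) with (- (PI / e)) by (field; lra).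
       rewrite atan_opp. replace ((2 * PI - PI) / e) with (PI / e) by (field; lra). ring. }
  assert (P : forall x, 0 < (x - PI) ^ 2 + e ^ 2).
  { intros x. pose proof (pow2_ge_0 (x - PI)). assert (0 < e ^ 2) by (now apply pow_lt). lra. }
  apply (is_RInt_derive (V := R_CompleteNormedModule) (fun t => atan ((t - PI) / e))).
  - intros x _. auto_derive; [lra|]. specialize (P x). simpl in P. field. split; [|lra]. nra.
  - intros x _. apply (ex_derive_continuous (fun t => e / ((t - PI) ^ 2 + e ^ 2))).
    auto_derive. specialize (P x). simpl in P. lra.
Qed.

Lemma poisson_mass e : 0 < e -> Rabs (2 * atan (PI / e) - PI) <= e.
Proof.
  intros He. pose proof PI_RGT_0 as Hp.
  assert (Hq : 0 < PI / e) by (now apply Rdiv_lt_0_compat).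
  assert (E := atan_inv (PI / e) Hq).
  replace (2 * atan (PI / e) - PI) with (- (2 * atan (/ (PI / e)))) by (rewrite E; field).
  rewrite Rabs_Ropp.
  replace (/ (PI / e)) with (e / PI) by (field; lra).
  assert (Hep : 0 < e / PI) by (now apply Rdiv_lt_0_compat).
  assert (0 < atan (e / PI)) by (rewrite <- atan_0; now apply atan_increasing).
  rewrite Rabs_pos_eq by lra.
  pose proof (atan_le_id (e / PI) ltac:(lra)).
  assert (2 * (e / PI) <= e); [|lra].
  apply Rmult_le_reg_r with PI; [lra|]. replace (2 * (e / PI) * PI) with (2 * e) by (field; lra).
  pose proof PI2_1. unfold PI2 in *. nra.
Qed.

(** In the coordinate [u = (g - g t0) / g' t0] the curve is tangent to the real
    axis, with [u] close to [x = t - t0] and its velocity [v] close to [1].  The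
    error is bounded relative to the Poisson kernel of the tangent, whose integral
    is at most [PI] for all [e]. *)
Lemma poisson_kernel_perturbation (u v : C) (x e k : R) :
  0 < e -> 0 <= k <= 1 / 4 -> Cmod (v - 1) <= k -> Cmod (u - RtoC x) <= k * Rabs x ->
  Cmod (RtoC e * v / (u * u + RtoC (e * e)) - RtoC (e / (x ^ 2 + e ^ 2)))
    <= 16 * k * (e / (x ^ 2 + e ^ 2)).
Proof.
  intros He Hk Hv Hu.
  set (p := x ^ 2 + e ^ 2). set (q := (u * u + RtoC (e * e))%C).
  assert (Hp : 0 < p).
  { unfold p. pose proof (pow2_ge_0 x). assert (0 < e ^ 2) by (now apply pow_lt). lra. }
  assert (Hqp : Cmod (RtoC p - q) <= 3 * k * x ^ 2).
  { replace (RtoC p - q)%C with ((RtoC x - u) * ((u - RtoC x) + RtoC (2 * x)))%C.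
    2: { unfold p, q. rewrite RtoC_plus, !RtoC_pow, !RtoC_mult. ring. }
    rewrite Cmod_mult. replace (RtoC x - u)%C with (- (u - RtoC x))%C by ring. rewrite Cmod_opp.
    apply Rle_trans with ((k * Rabs x) * (3 * Rabs x)).
    - apply Rmult_le_compat; try apply Cmod_ge_0; [exact Hu|].
      eapply Rle_trans; [apply Cmod_triangle|]. rewrite Cmod_R, Rabs_mult, (Rabs_pos_eq 2) by lra.
      pose proof (Rabs_pos x). nra.
    - right. rewrite <- (pow2_abs x). ring. }
  assert (Hq : p / 4 <= Cmod q).
  { assert (p <= Cmod q + Cmod (RtoC p - q)).
    { replace p with (Cmod (RtoC p)) at 1 by (rewrite Cmod_R, Rabs_pos_eq; lra).
      replace (RtoC p) with (q + (RtoC p - q))%C at 1 by ring. apply Cmod_triangle. }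
    assert (x ^ 2 <= p) by (unfold p; pose proof (pow2_ge_0 e); lra).
    pose proof (pow2_ge_0 x).
    assert (3 * k * x ^ 2 <= 3 / 4 * p) by nra. lra. }
  assert (Nq : q <> RtoC 0) by (apply Cmod_gt_0; lra).
  assert (Np : RtoC p <> RtoC 0) by (intros E; injection E as E; lra).
  replace (RtoC e * v / q - RtoC (e / p))%C
    with (RtoC e * ((v - 1) * RtoC p + (RtoC p - q)) / (q * RtoC p))%C.
  2: { rewrite RtoC_div by lra. field. now split. }
  rewrite Cmod_div, !Cmod_mult, !Cmod_R by (now apply Cmult_neq_0).
  rewrite (Rabs_pos_eq e), (Rabs_pos_eq p) by lra.
  assert (Hn : Cmod ((v - 1) * RtoC p + (RtoC p - q)) <= 4 * k * p).
  { eapply Rle_trans; [apply Cmod_triangle|]. rewrite Cmod_mult, Cmod_R, (Rabs_pos_eq p) by lra.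
    assert (x ^ 2 <= p) by (unfold p; pose proof (pow2_ge_0 e); lra).
    assert (Cmod (v - 1) * p <= k * p) by (apply Rmult_le_compat_r; lra).
    assert (3 * k * x ^ 2 <= 3 * k * p) by (apply Rmult_le_compat_l; lra). lra. }
  replace (16 * k * (e / p)) with (e * (4 * k * p) * / (p / 4 * p)) by (field; lra).
  apply Rmult_le_compat.
  - apply Rmult_le_pos; [lra|apply Cmod_ge_0].
  - left. apply Rinv_0_lt_compat. apply Rmult_lt_0_compat; lra.
  - apply Rmult_le_compat_l; lra.
  - apply Rinv_le_contravar; [apply Rmult_lt_0_compat; lra|]. apply Rmult_le_compat_r; lra.
Qed.

(** Close to [PI] this is [poisson_kernel_perturbation]; far from it both kernels
    are of order [e]. *)
Lemma jump_kernel_estimate g dg k : regular_loop g dg -> 0 < k <= 1 / 4 ->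
  exists B e0, 0 < B /\ 0 < e0 /\ forall e t, 0 < e < e0 -> 0 <= t <= 2 * PI ->
    let u := ((g t - g PI) / dg PI)%C in
    Cmod (RtoC e * (dg t / dg PI) / (u * u + RtoC (e * e)) - RtoC (e / ((t - PI) ^ 2 + e ^ 2)))
      <= 16 * k * (e / ((t - PI) ^ 2 + e ^ 2)) + e * B.
Proof.
  intros H Hk. pose proof PI_RGT_0 as Hpi.
  assert (N0 := loop_regular _ _ H PI).
  set (U := fun t => ((g t - g PI) / dg PI)%C). set (dU := fun t => (dg t / dg PI)%C).
  assert (HU : forall t, is_derive (V := CR) U t (dU t)).
  { intros t. unfold U, dU.
    replace (dg t / dg PI)%C with ((dg t - 0) * / dg PI + (g t - g PI) * 0)%C by (field; exact N0).
    apply is_derive_Cmult; [|apply is_derive_Cconst].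
    apply is_derive_Cminus; [apply (loop_derive _ _ H)|apply is_derive_Cconst]. }
  assert (HdU : forall t, continuous dU t).
  { intros t. unfold dU. apply continuous_Cmult; [apply (loop_dcont _ _ H)|apply continuous_const]. }
  destruct (continuous_eps dU PI (HdU PI) k) as [d [Hd Hc]]; [lra|].
  assert (E1 : dU PI = RtoC 1) by (unfold dU; field; exact N0). rewrite E1 in Hc.
  set (n := Rmin (d / 2) PI).
  assert (Hn : 0 < n) by (apply Rmin_pos; lra).
  assert (Hn1 : n <= d / 2) by apply Rmin_l. assert (Hn2 : n <= PI) by apply Rmin_r.
  destruct (loop_separated g dg H PI n (conj Hn Hn2)) as [m [Hm Hs]].
  destruct (Cmod_bounded dU 0 (2 * PI)) as [M [HM HMb]]; [auto|].
  set (r := Cmod (dg PI)). assert (Hr : 0 < r) by now apply Cmod_gt_0.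
  set (m' := m / r). assert (Hm' : 0 < m') by now apply Rdiv_lt_0_compat.
  assert (Hm2 : 0 < m' ^ 2) by now apply pow_lt.
  assert (Hn3 : 0 < n ^ 2) by now apply pow_lt.
  exists (M * (2 / m' ^ 2) + / n ^ 2), (m' / 2).
  split. { apply Rplus_lt_0_compat; [|now apply Rinv_0_lt_compat].
           apply Rmult_lt_0_compat; [exact HM|]. apply Rdiv_lt_0_compat; lra. }
  split; [lra|]. intros e t He Ht u. change u with (U t). change (dg t / dg PI)%C with (dU t).
  assert (He2 : 0 < e ^ 2) by (apply pow_lt; lra).
  assert (Hp : 0 < (t - PI) ^ 2 + e ^ 2) by (pose proof (pow2_ge_0 (t - PI)); lra).
  assert (Hpp : 0 < e / ((t - PI) ^ 2 + e ^ 2)) by (apply Rdiv_lt_0_compat; lra).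
  assert (HB : 0 <= e * (M * (2 / m' ^ 2))).
  { apply Rmult_le_pos; [lra|]. apply Rmult_le_pos; [lra|]. left. apply Rdiv_lt_0_compat; lra. }
  assert (HB2 : 0 <= e * / n ^ 2).
  { apply Rmult_le_pos; [lra|]. left. now apply Rinv_0_lt_compat. }
  destruct (Rle_or_lt (Rabs (t - PI)) n) as [L|L].
  - apply Rle_trans with (16 * k * (e / ((t - PI) ^ 2 + e ^ 2))); [|lra].
    apply poisson_kernel_perturbation; try lra.
    + left. apply Hc. lra.
    + replace (U t - RtoC (t - PI))%C
        with ((fun x => U x - RtoC (x - PI)) t - (fun x => U x - RtoC (x - PI)) PI)%C.
      2: { cbv beta. unfold U at 2. rewrite !RtoC_minus. field. exact N0. }
      apply (Cmod_mean_value (fun x => U x - RtoC (x - PI))%C (fun x => dU x - 1)%C).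
      * intros x. apply is_derive_Cminus; [apply HU|].
        apply is_derive_C_pair; simpl; [|apply (is_derive_const (V := R_NormedModule))].
        change (is_derive (fun x : R => x - PI) x 1). auto_derive; [exact I|ring].
      * intros x. apply continuous_Cminus; [apply HdU|apply continuous_const].
      * intros x Hx. left. apply Hc. apply Rle_lt_trans with n; [|lra].
        apply Rabs_le_between. apply Rabs_le_between in L. revert Hx.
        unfold Rmin, Rmax; destruct (Rle_dec PI t); lra.
  - assert (HUt : m' <= Cmod (U t)).
    { unfold U, m'. rewrite Cmod_div by exact N0.
      apply Rmult_le_compat_r; [left; now apply Rinv_0_lt_compat|].
      destruct (Rle_or_lt PI t) as [K|K].
      - rewrite Rabs_pos_eq in L by lra. apply Hs. lra.
      - rewrite Rabs_left in L by lra. rewrite <- (loop_period _ _ H t). apply Hs. lra. }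
    set (q := (U t * U t + RtoC (e * e))%C).
    assert (Hq : m' ^ 2 / 2 <= Cmod q).
    { assert (K := Cmod_sub_triangle (U t * U t) (- RtoC (e * e))).
      rewrite Cmod_opp, Cmod_R, Cmod_mult, Rabs_pos_eq in K by nra.
      replace (U t * U t - - RtoC (e * e))%C with q in K by (unfold q; ring).
      assert (m' * m' <= Cmod (U t) * Cmod (U t)) by (apply Rmult_le_compat; lra).
      assert (e * e <= m' / 2 * (m' / 2)) by (apply Rmult_le_compat; lra).
      simpl. nra. }
    assert (Nq : q <> RtoC 0) by (apply Cmod_gt_0; lra).
    unfold Cminus. eapply Rle_trans; [apply Cmod_triangle|].
    rewrite Cmod_opp, Cmod_div, Cmod_mult, !Cmod_R by exact Nq.
    rewrite (Rabs_pos_eq e), (Rabs_pos_eq (e / _)) by lra.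
    assert (A1 : e * Cmod (dU t) / Cmod q <= e * (M * (2 / m' ^ 2))).
    { replace (e * (M * (2 / m' ^ 2))) with (e * M * / (m' ^ 2 / 2)) by (field; lra).
      apply Rmult_le_compat.
      - apply Rmult_le_pos; [lra|apply Cmod_ge_0].
      - left. apply Rinv_0_lt_compat. lra.
      - apply Rmult_le_compat_l; [lra|]. apply HMb. lra.
      - apply Rinv_le_contravar; lra. }
    assert (A2 : e / ((t - PI) ^ 2 + e ^ 2) <= e * / n ^ 2).
    { apply Rmult_le_compat_l; [lra|]. apply Rinv_le_contravar; [lra|].
      assert (n ^ 2 <= Rabs (t - PI) ^ 2) by (apply pow_incr; lra).
      rewrite pow2_abs in H0. lra. }
    assert (0 <= 16 * k * (e / ((t - PI) ^ 2 + e ^ 2))) by (apply Rmult_le_pos; lra).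
    lra.
Qed.

(** The difference of the two integrals is [2 i] times the integral estimated in
    [jump_kernel_estimate], so it differs from [2 PI i] by at most a fixed multiple
    of [k], once [e] is small; and [k] is arbitrary. *)
Lemma winding_jump g dg (wp wm : C) : regular_loop g dg ->
  (exists d, 0 < d /\ forall s, 0 < s < d -> cauchy_integral g dg (normal_point g dg PI s) = wp) ->
  (exists d, 0 < d /\ forall s, 0 < s < d -> cauchy_integral g dg (normal_point g dg PI (- s)) = wm) ->
  (wp - wm = RtoC (2 * PI) * Ci)%C.
Proof.
  intros H [d1 [Hd1 Hp]] [d2 [Hd2 Hm]].
  pose proof PI_RGT_0 as Hpi. pose proof PI_4 as Hpi4.
  assert (N0 := loop_regular _ _ H PI).
  destruct (tube_off_curve g dg H PI) as [d3 [Hd3 Ht]].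
  assert (Key : forall k, 0 < k <= 1 / 4 -> Cmod (wp - wm - RtoC (2 * PI) * Ci) <= 200 * k).
  { intros k Hk.
    destruct (jump_kernel_estimate g dg k H Hk) as (B & e0 & HB & He0 & Hest).
    (* Small enough to stay on the two sides of the curve, and for the errors [e]
       and [2 PI e B] to be at most multiples of [k]. *)
    set (e := Rmin (Rmin (Rmin d1 d2) (Rmin d3 e0) / 2) (Rmin k (k / (8 * B)))).
    assert (He : 0 < e).
    { apply Rmin_pos.
      - assert (0 < Rmin (Rmin d1 d2) (Rmin d3 e0)) by (repeat apply Rmin_pos; lra). lra.
      - apply Rmin_pos; [lra|]. apply Rdiv_lt_0_compat; lra. }
    assert (A1 : e <= Rmin (Rmin d1 d2) (Rmin d3 e0) / 2) by apply Rmin_l.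
    assert (A2 : e <= Rmin k (k / (8 * B))) by apply Rmin_r.
    pose proof (Rmin_l (Rmin d1 d2) (Rmin d3 e0)). pose proof (Rmin_r (Rmin d1 d2) (Rmin d3 e0)).
    pose proof (Rmin_l d1 d2). pose proof (Rmin_r d1 d2).
    pose proof (Rmin_l d3 e0). pose proof (Rmin_r d3 e0).
    pose proof (Rmin_l k (k / (8 * B))). pose proof (Rmin_r k (k / (8 * B))).
    assert (HeB : e * B <= k / 8).
    { apply Rle_trans with (k / (8 * B) * B); [apply Rmult_le_compat_r; lra|].
      right. field. lra. }
    assert (He1 : 0 < Rmin d1 d2) by (now apply Rmin_pos).
    assert (Op : off_curve g (normal_point g dg PI e)).
    { apply Ht; [rewrite Rminus_diag, Rabs_R0; lra|]. rewrite Rabs_pos_eq; lra. }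
    assert (Om : off_curve g (normal_point g dg PI (- e))).
    { apply Ht; [rewrite Rminus_diag, Rabs_R0; lra|]. rewrite Rabs_Ropp, Rabs_pos_eq; lra. }
    pose proof (loop_dcont _ _ H) as Hc.
    assert (Ip := is_RInt_cauchy g dg dg _ H Hc Op). rewrite Hp in Ip by lra.
    assert (Im := is_RInt_cauchy g dg dg _ H Hc Om). rewrite Hm in Im by lra.
    assert (I1 := is_RInt_Cscal (/ (2 * Ci)) _ _ _ _ (is_RInt_Cminus _ _ _ _ _ _ Ip Im)).
    assert (N2 : (2 * Ci <> 0)%C).
    { intros E. injection E as E1 E2. lra. }
    assert (I2 : is_RInt (V := CR) (fun t => RtoC (e / ((t - PI) ^ 2 + e ^ 2))) 0 (2 * PI)
                   (RtoC (2 * atan (PI / e)))).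
    { apply is_RInt_RtoC, (is_RInt_poisson e He). }
    assert (I3 := is_RInt_Cminus _ _ _ _ _ _ I1 I2).
    set (J := (/ (2 * Ci) * (wp - wm) - RtoC (2 * atan (PI / e)))%C) in I3.
    assert (I4 : is_RInt (fun t => 16 * k * (e / ((t - PI) ^ 2 + e ^ 2)) + e * B) 0 (2 * PI)
                   (16 * k * (2 * atan (PI / e)) + (2 * PI - 0) * (e * B))).
    { apply (is_RInt_plus (V := R_NormedModule)).
      - apply (is_RInt_scal (V := R_NormedModule)). now apply is_RInt_poisson.
      - apply (is_RInt_const (V := R_NormedModule)). }
    assert (HJ : Cmod J <= 16 * k * (2 * atan (PI / e)) + (2 * PI - 0) * (e * B)).
    { eapply Cmod_is_RInt_le; [|  |exact I3|exact I4]; [lra|].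
      intros t Htt. cbv beta.
      replace (/ (2 * Ci) * (dg t / (g t - normal_point g dg PI e) - dg t / (g t - normal_point g dg PI (- e))))%C
        with (RtoC e * (dg t / dg PI) / ((g t - g PI) / dg PI * ((g t - g PI) / dg PI) + RtoC (e * e)))%C.
      - apply Hest; lra.
      - assert (Np := off_curve_sub g _ t Op). assert (Nm := off_curve_sub g _ t Om).
        assert (Ci2 : (Ci * Ci = - 1)%C) by (unfold Ci, Cmult, Copp, RtoC; simpl; f_equal; ring).
        unfold normal_point in *. rewrite RtoC_opp in *.
        set (a := (g t - g PI)%C). set (b := dg PI) in *. set (c := RtoC e) in *.
        replace (g t - (g PI + c * (Ci * b)))%C with (a - c * (Ci * b))%C in * by (unfold a; ring).
        replace (g t - (g PI + - c * (Ci * b)))%C with (a + c * (Ci * b))%C in * by (unfold a; ring).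
        assert (P : ((a - c * (Ci * b)) * (a + c * (Ci * b)) = a * a + c * c * (b * b))%C).
        { replace ((a - c * (Ci * b)) * (a + c * (Ci * b)))%C with (a * a - c * c * (b * b) * (Ci * Ci))%C by ring.
          rewrite Ci2. ring. }
        assert (NP : (a * a + c * c * (b * b) <> 0)%C) by (rewrite <- P; now apply Cmult_neq_0).
        replace (dg t / (a - c * (Ci * b)) - dg t / (a + c * (Ci * b)))%C
          with (dg t * (2 * c * (Ci * b)) / (a * a + c * c * (b * b)))%C.
        2: { rewrite <- P. field. now split. }
        rewrite RtoC_mult. fold c.
        assert (NCi : Ci <> RtoC 0) by (intros E; apply N2; rewrite E; ring).
        replace (a / b * (a / b) + c * c)%C with ((a * a + c * c * (b * b)) / (b * b))%C by (field; exact N0).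
        field. repeat split; assumption. }
    replace (wp - wm - RtoC (2 * PI) * Ci)%C
      with (2 * Ci * (J + RtoC (2 * atan (PI / e) - PI)))%C.
    2: { unfold J. rewrite RtoC_minus. rewrite (RtoC_mult 2 PI). field.
         intros E; apply N2; rewrite E; ring. }
    rewrite Cmod_mult.
    replace (Cmod (2 * Ci)) with 2 by (rewrite Cmod_mult, Cmod_R, Cmod_Ci, Rabs_pos_eq; lra).
    assert (Hat : 0 < atan (PI / e) < PI / 2).
    { split; [|apply atan_bound]. rewrite <- atan_0. apply atan_increasing. now apply Rdiv_lt_0_compat. }
    assert (T := Cmod_triangle J (RtoC (2 * atan (PI / e) - PI))).
    rewrite Cmod_R in T. pose proof (poisson_mass e He).
    assert (16 * k * (2 * atan (PI / e)) <= 16 * k * 4) by (apply Rmult_le_compat_l; lra).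
    assert ((2 * PI - 0) * (e * B) <= 8 * (k / 8)).
    { apply Rmult_le_compat; try lra. apply Rmult_le_pos; lra. }
    lra. }
  assert (Z : Cmod (wp - wm - RtoC (2 * PI) * Ci) = 0).
  { set (x := Cmod (wp - wm - RtoC (2 * PI) * Ci)) in *.
    assert (0 <= x) by apply Cmod_ge_0.
    destruct (Req_dec x 0) as [|N]; [assumption|exfalso].
    set (k := Rmin (1 / 4) (x / 400)).
    assert (0 < k) by (apply Rmin_pos; lra).
    assert (k <= 1 / 4) by apply Rmin_l. assert (k <= x / 400) by apply Rmin_r.
    specialize (Key k). lra. }
  apply Cmod_eq_0 in Z.
  replace (wp - wm)%C with ((wp - wm - RtoC (2 * PI) * Ci) + RtoC (2 * PI) * Ci)%C by ring.
  rewrite Z. ring.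
Qed.

(** * The winding number of a positively oriented boundary *)

(** What the winding number theorem uses of the domain: near the curve it lies on
    the left and not on the right, its boundary stays on the curve, and it is
    bounded. *)
Record inside (g dg : R -> C) (Omega : C -> Prop) : Prop := {
  inside_left : forall t, exists d, 0 < d /\ forall s, 0 < s < d -> Omega (normal_point g dg t s);
  inside_right : forall t, exists d, 0 < d /\ forall s, 0 < s < d -> ~ Omega (normal_point g dg t (- s));
  inside_boundary : forall z, off_curve g z -> ~ boundary Omega z;
  inside_bounded : Defs.bounded Omega }.

Lemma indicator_locally_constant g dg Omega :
  inside g dg Omega -> locally_constant_off g (indicator Omega).
Proof.
  intros H z Hz. assert (B := inside_boundary _ _ _ H z Hz).
  apply NNPP. intros NL. apply B. intros U HU.
  split; apply NNPP; intros NE; apply NL.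
  - generalize (locally_singleton z U HU); intros Uz. revert HU.
    apply filter_imp. intros w Hw. unfold indicator.
    destruct (excluded_middle_informative (Omega w)); [exfalso; apply NE; now exists w|].
    destruct (excluded_middle_informative (Omega z)); [exfalso; apply NE; now exists z|reflexivity].
  - generalize (locally_singleton z U HU); intros Uz. revert HU.
    apply filter_imp. intros w Hw. unfold indicator.
    destruct (excluded_middle_informative (Omega w)); [|exfalso; apply NE; now exists w].
    destruct (excluded_middle_informative (Omega z)); [reflexivity|exfalso; apply NE; now exists z].
Qed.

Lemma indicator_in (A : C -> Prop) z : A z -> indicator A z = RtoC 1.
Proof. intros H. unfold indicator. now destruct (excluded_middle_informative (A z)). Qed.

Lemma indicator_out (A : C -> Prop) z : ~ A z -> indicator A z = RtoC 0.
Proof. intros H. unfold indicator. now destruct (excluded_middle_informative (A z)). Qed.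

(** A point off the curve lies on the normal through its nearest point, so the
    winding integral there is the value [wp] of the left side, reached from
    [Omega], or the value [wm] of the right side.  Points far away give
    [wm = 0], and [winding_jump] gives [wp]. *)
Lemma winding_number g dg Omega z :
  regular_loop g dg -> inside g dg Omega -> off_curve g z ->
  cauchy_integral g dg z = (RtoC (2 * PI) * Ci * indicator Omega z)%C.
Proof.
  intros H HO Hz. pose proof two_PI_pos as Hpi.
  assert (HW := winding_locally_constant g dg H).
  destruct (sides g dg (cauchy_integral g dg) 1 H HW Rabs_R1) as [wp Hp].
  destruct (sides g dg (cauchy_integral g dg) (-1) H HW) as [wm Hm]; [rewrite Rabs_left; lra|].
  assert (Hp' : forall t, exists d, 0 < d /\ forall s, 0 < s < d -> cauchy_integral g dg (normal_point g dg t s) = wp).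
  { intros t. destruct (Hp t) as [d [Hd E]]. exists d. split; [exact Hd|].
    intros s Hs. rewrite <- (E s Hs). now rewrite Rmult_1_l. }
  assert (Hm' : forall t, exists d, 0 < d /\ forall s, 0 < s < d -> cauchy_integral g dg (normal_point g dg t (- s)) = wm).
  { intros t. destruct (Hm t) as [d [Hd E]]. exists d. split; [exact Hd|].
    intros s Hs. rewrite <- (E s Hs). f_equal. f_equal. ring. }
  assert (HI := indicator_locally_constant g dg Omega HO).
  assert (Cls : forall z, off_curve g z ->
            (indicator Omega z = RtoC 1 /\ cauchy_integral g dg z = wp) \/
            (indicator Omega z = RtoC 0 /\ cauchy_integral g dg z = wm)).
  { intros y Hy. destruct (nearest_point g dg y H Hy) as (t & s & Hs & -> & Hu).
    rewrite (off_curve_sides g dg (cauchy_integral g dg) wp wm H HW Hp' Hm' t s Hs Hu).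
    rewrite (off_curve_sides g dg (indicator Omega) (RtoC 1) (RtoC 0) H HI) with (s := s); auto.
    - destruct (Rlt_dec 0 s); [left|right]; auto.
    - intros x. destruct (inside_left _ _ _ HO x) as [d [Hd E]]. exists d. split; [exact Hd|].
      intros v Hv. apply indicator_in. now apply E.
    - intros x. destruct (inside_right _ _ _ HO x) as [d [Hd E]]. exists d. split; [exact Hd|].
      intros v Hv. apply indicator_out. now apply E. }
  assert (Hwm : wm = RtoC 0).
  { destruct (inside_bounded _ _ _ HO) as [R0 HR0].
    destruct (Cmod_bounded g 0 (2 * PI)) as [G [HG HGb]].
    { intros t _. now apply (loop_continuous g dg). }
    destruct (Cmod_bounded dg 0 (2 * PI)) as [M [HM HMb]].
    { intros t _. apply (loop_dcont _ _ H). }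
    assert (Far : forall r, 0 < r -> Cmod wm <= 2 * PI * (M / r)).
    { intros r Hr.
      (* A real point outside [Omega], at distance at least [r] from the curve. *)
      set (x := Rabs R0 + G + r).
      assert (Hx : Cmod (RtoC x) = x).
      { rewrite Cmod_R, Rabs_pos_eq; [reflexivity|]. unfold x. pose proof (Rabs_pos R0). lra. }
      assert (Hlow : forall t, 0 <= t <= 2 * PI -> r <= Cmod (g t - RtoC x)).
      { intros t Ht. rewrite <- Cmod_opp. replace (- (g t - RtoC x))%C with (RtoC x - g t)%C by ring.
        eapply Rle_trans; [|apply Cmod_sub_triangle]. rewrite Hx.
        specialize (HGb t Ht). unfold x. pose proof (Rabs_pos R0). lra. }
      assert (Ox : off_curve g (RtoC x)).
      { intros t E. destruct (periodic_reduce g 0 t (loop_period _ _ H)) as [y [Hy E2]].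
        assert (K := Hlow y). rewrite E2, E in K. replace (RtoC x - RtoC x)%C with (RtoC 0) in K by ring.
        rewrite Cmod_0 in K. lra. }
      destruct (Cls (RtoC x) Ox) as [[E _]|[_ E]].
      - exfalso. assert (~ Omega (RtoC x)).
        { intros K. apply HR0 in K. rewrite Hx in K. unfold x in K. pose proof (Rle_abs R0). lra. }
        rewrite indicator_out in E by assumption. injection E as E. lra.
      - rewrite <- E. replace (2 * PI * (M / r)) with ((2 * PI - 0) * (M / r)) by ring.
        eapply Cmod_is_RInt_le_const.
        3: { apply (is_RInt_cauchy g dg); auto. apply (loop_dcont _ _ H). }
        { lra. }
        intros t Ht. cbv beta. rewrite Cmod_div by (now apply off_curve_sub).
        apply Rmult_le_compat; [apply Cmod_ge_0| |now apply HMb|].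
        + left. apply Rinv_0_lt_compat. specialize (Hlow t Ht). lra.
        + apply Rinv_le_contravar; [exact Hr|now apply Hlow]. }
    apply Cmod_eq_0. destruct (Req_dec (Cmod wm) 0) as [|N]; [assumption|exfalso].
    assert (P : 0 < Cmod wm) by (pose proof (Cmod_ge_0 wm); lra).
    (* At this distance the bound is half of [Cmod wm]. *)
    specialize (Far (4 * PI * M / Cmod wm)).
    assert (0 < 4 * PI * M / Cmod wm).
    { apply Rdiv_lt_0_compat; [|exact P]. apply Rmult_lt_0_compat; lra. }
    specialize (Far H0).
    replace (2 * PI * (M / (4 * PI * M / Cmod wm))) with (Cmod wm / 2) in Far by (field; repeat split; lra).
    lra. }
  assert (J := winding_jump g dg wp wm H (Hp' PI) (Hm' PI)). rewrite Hwm in J.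
  destruct (Cls z Hz) as [[E1 E2]|[E1 E2]]; rewrite E1, E2.
  - replace wp with (wp - 0)%C by ring. rewrite J. ring.
  - rewrite Hwm. ring.
Qed.

(** * Cauchy integrals of polynomials *)

Lemma is_RInt_loop_pow g dg a n : regular_loop g dg ->
  is_RInt (V := CR) (fun t => (g t - a) ^ n * dg t)%C 0 (2 * PI) (RtoC 0).
Proof.
  intros H. pose proof two_PI_pos.
  assert (N : RtoC (INR (S n)) <> RtoC 0).
  { intros E. apply (f_equal fst) in E. change (INR (S n) = 0) in E.
    pose proof (lt_0_INR (S n) ltac:(lia)). lra. }
  assert (D : forall t, is_derive (V := CR) (fun t => / RtoC (INR (S n)) * (g t - a) ^ S n)%C t
                          ((g t - a) ^ n * dg t)%C).
  { intros t.
    replace ((g t - a) ^ n * dg t)%C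
      with (0 * (g t - a) ^ S n + / RtoC (INR (S n)) * (RtoC (INR (S n)) * (g t - a) ^ n * (dg t - 0)))%C
      by (field; exact N).
    apply is_derive_Cmult; [apply is_derive_Cconst|].
    apply is_derive_Cpow. apply is_derive_Cminus; [apply (loop_derive _ _ H)|apply is_derive_Cconst]. }
  replace (RtoC 0) with (/ RtoC (INR (S n)) * (g (2 * PI)%R - a) ^ S n - / RtoC (INR (S n)) * (g 0%R - a) ^ S n)%C.
  - apply (is_RInt_C_derive (fun t => / RtoC (INR (S n)) * (g t - a) ^ S n)%C); [lra| |].
    + intros t _. apply D.
    + intros t _. apply continuous_Cmult; [|apply (loop_dcont _ _ H)].
      apply continuous_Cpow.
      apply continuous_Cminus; [now apply (loop_continuous g dg)|apply continuous_const].
  - replace (2 * PI) with (0 + 2 * PI) by ring. rewrite (loop_period _ _ H). ring.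
Qed.

(** Induction on [(g - a)^(n+1) / (g - z) = (g - a)^n + (z - a) (g - a)^n / (g - z)]. *)
Lemma is_RInt_cauchy_pow g dg a z n : regular_loop g dg -> off_curve g z ->
  is_RInt (V := CR) (fun t => (g t - a) ^ n * dg t / (g t - z))%C 0 (2 * PI)
    ((z - a) ^ n * cauchy_integral g dg z)%C.
Proof.
  intros H Hz. induction n as [|n IH].
  - apply (is_RInt_ext (V := CR) (fun t => dg t / (g t - z))%C).
    { intros t _. as_C_equation. rewrite <- (Cmult_1_l (dg t)) at 1. reflexivity. }
    replace ((z - a) ^ 0 * cauchy_integral g dg z)%C with (cauchy_integral g dg z) by (simpl; ring).
    apply (is_RInt_cauchy g dg); auto. apply (loop_dcont _ _ H).
  - apply (is_RInt_ext (V := CR)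
      (fun t => (g t - a) ^ n * dg t + (z - a) * ((g t - a) ^ n * dg t / (g t - z)))%C).
    { intros t _. as_C_equation. rewrite (Cpow_S _ n). field. now apply off_curve_sub. }
    replace ((z - a) ^ S n * cauchy_integral g dg z)%C
      with (0 + (z - a) * ((z - a) ^ n * cauchy_integral g dg z))%C by (rewrite Cpow_S; ring).
    apply is_RInt_Cplus; [now apply is_RInt_loop_pow|now apply is_RInt_Cscal].
Qed.

(** The same recursion, with one more factor [1 / (g - z)]; it reproduces the
    recursion [(n+1) x^n = x^n + x (n x^(n-1))] of the derivatives of powers. *)
Lemma is_RInt_cauchy_derivative_pow g dg a z n : regular_loop g dg -> off_curve g z ->
  is_RInt (V := CR) (fun t => (g t - a) ^ n * dg t / (g t - z) ^ 2)%C 0 (2 * PI)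
    (RtoC (INR n) * (z - a) ^ pred n * cauchy_integral g dg z)%C.
Proof.
  intros H Hz. induction n as [|n IH].
  - apply (is_RInt_ext (V := CR) (fun t => dg t / (g t - z) ^ 2)%C).
    { intros t _. as_C_equation. rewrite <- (Cmult_1_l (dg t)) at 1. reflexivity. }
    replace (RtoC (INR 0) * (z - a) ^ pred 0 * cauchy_integral g dg z)%C
      with (cauchy_derivative g dg z).
    2: { rewrite (winding_derivative_zero g dg z H Hz). simpl. ring. }
    apply (is_RInt_cauchy_derivative g dg); auto. apply (loop_dcont _ _ H).
  - apply (is_RInt_ext (V := CR)
      (fun t => (g t - a) ^ n * dg t / (g t - z) + (z - a) * ((g t - a) ^ n * dg t / (g t - z) ^ 2))%C).
    { intros t _. as_C_equation. rewrite (Cpow_S _ n). field. now apply off_curve_sub. }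
    replace (RtoC (INR (S n)) * (z - a) ^ pred (S n) * cauchy_integral g dg z)%C
      with ((z - a) ^ n * cauchy_integral g dg z
            + (z - a) * (RtoC (INR n) * (z - a) ^ pred n * cauchy_integral g dg z))%C.
    2: { rewrite S_INR, RtoC_plus. destruct n as [|n]; [simpl; ring|].
         simpl pred. rewrite Cpow_S. ring. }
    apply is_RInt_Cplus; [now apply is_RInt_cauchy_pow|now apply is_RInt_Cscal].
Qed.

(** For [j = 0] the truncated exponent [pred j] is harmless, as its coefficient
    is [0]. *)
Definition interp_poly_derivative (N : nat) (c : nat -> C) (z z0 : C) : C :=
  sum_n (fun j => c j / RtoC (INR (fact j)) * (RtoC (INR j) * (z - z0) ^ pred j))%C N.

Lemma interp_poly_S N c z z0 :
  interp_poly (S N) c z z0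
  = (interp_poly N c z z0 + c (S N) / RtoC (INR (fact (S N))) * (z - z0) ^ S N)%C.
Proof. unfold interp_poly. rewrite sum_Sn. reflexivity. Qed.

Lemma interp_poly_0 c z z0 : interp_poly 0 c z z0 = (c O / RtoC (INR (fact 0)) * (z - z0) ^ 0)%C.
Proof. unfold interp_poly. apply sum_O. Qed.

Lemma interp_poly_derivative_S N c z z0 :
  interp_poly_derivative (S N) c z z0
  = (interp_poly_derivative N c z z0
     + c (S N) / RtoC (INR (fact (S N))) * (RtoC (INR (S N)) * (z - z0) ^ N))%C.
Proof. unfold interp_poly_derivative. rewrite sum_Sn. reflexivity. Qed.

Lemma interp_poly_derivative_0 c z z0 : interp_poly_derivative 0 c z z0 = RtoC 0.
Proof. unfold interp_poly_derivative. rewrite sum_O. simpl. ring. Qed.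

Lemma is_RInt_cauchy_interp g dg N c a z : regular_loop g dg -> off_curve g z ->
  is_RInt (V := CR) (fun t => interp_poly N c (g t) a * dg t / (g t - z))%C 0 (2 * PI)
    (interp_poly N c z a * cauchy_integral g dg z)%C.
Proof.
  intros H Hz. induction N as [|N IH].
  - apply (is_RInt_ext (V := CR)
      (fun t => c O / RtoC (INR (fact 0)) * ((g t - a) ^ 0 * dg t / (g t - z)))%C).
    { intros t _. as_C_equation. rewrite interp_poly_0. unfold Cdiv. ring. }
    rewrite interp_poly_0, <- Cmult_assoc. apply is_RInt_Cscal. now apply is_RInt_cauchy_pow.
  - apply (is_RInt_ext (V := CR)
      (fun t => interp_poly N c (g t) a * dg t / (g t - z)
         + c (S N) / RtoC (INR (fact (S N))) * ((g t - a) ^ (S N) * dg t / (g t - z)))%C).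
    { intros t _. as_C_equation. rewrite interp_poly_S. unfold Cdiv. ring. }
    rewrite interp_poly_S, Cmult_plus_distr_r, <- (Cmult_assoc (_ / _)).
    apply is_RInt_Cplus; [exact IH|]. apply is_RInt_Cscal. now apply is_RInt_cauchy_pow.
Qed.

Lemma is_RInt_cauchy_derivative_interp g dg N c a z : regular_loop g dg -> off_curve g z ->
  is_RInt (V := CR) (fun t => interp_poly N c (g t) a * dg t / (g t - z) ^ 2)%C 0 (2 * PI)
    (interp_poly_derivative N c z a * cauchy_integral g dg z)%C.
Proof.
  intros H Hz. induction N as [|N IH].
  - apply (is_RInt_ext (V := CR)
      (fun t => c O / RtoC (INR (fact 0)) * ((g t - a) ^ 0 * dg t / (g t - z) ^ 2))%C).
    { intros t _. as_C_equation. rewrite interp_poly_0. unfold Cdiv. ring. }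
    rewrite interp_poly_derivative_0.
    assert (E : forall k p w : C, (0 * w = k * (RtoC (INR 0) * p * w))%C).
    { intros k p w. change (RtoC (INR 0)) with (RtoC 0). ring. }
    specialize (E (c O / RtoC (INR (fact 0)))%C ((z - a) ^ pred 0)%C (cauchy_integral g dg z)).
    assert (K := is_RInt_Cscal (c O / RtoC (INR (fact 0))) _ _ _ _
                   (is_RInt_cauchy_derivative_pow g dg a z 0 H Hz)).
    rewrite <- E in K. exact K.
  - apply (is_RInt_ext (V := CR)
      (fun t => interp_poly N c (g t) a * dg t / (g t - z) ^ 2
         + c (S N) / RtoC (INR (fact (S N))) * ((g t - a) ^ (S N) * dg t / (g t - z) ^ 2))%C).
    { intros t _. as_C_equation. rewrite interp_poly_S. unfold Cdiv. ring. }
    rewrite interp_poly_derivative_S, Cmult_plus_distr_r, <- (Cmult_assoc (_ / _)).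
    apply is_RInt_Cplus; [exact IH|]. apply is_RInt_Cscal.
    apply (is_RInt_cauchy_derivative_pow g dg a z (S N) H Hz).
Qed.

Lemma continuous_interp_poly (f : R -> C) N c a t :
  continuous f t -> continuous (fun s => interp_poly N c (f s) a) t.
Proof.
  intros Hf. induction N as [|N IH].
  - apply (continuous_ext (fun s => c O / RtoC (INR (fact 0)) * (f s - a) ^ 0)%C).
    { intros s. now rewrite interp_poly_0. }
    apply continuous_const.
  - apply (continuous_ext (fun s => interp_poly N c (f s) a
        + c (S N) / RtoC (INR (fact (S N))) * (f s - a) ^ S N)%C).
    { intros s. now rewrite interp_poly_S. }
    apply continuous_Cplus; [exact IH|].
    apply continuous_Cmult; [apply continuous_const|].
    apply continuous_Cpow. apply continuous_Cminus; [exact Hf|apply continuous_const].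
Qed.

Lemma is_derive_interp_poly (f : R -> C) N c a t (f' : C) :
  is_derive (V := CR) f t f' ->
  is_derive (V := CR) (fun s => interp_poly N c (f s) a) t
    (interp_poly_derivative N c (f t) a * f')%C.
Proof.
  intros Hf. induction N as [|N IH].
  - apply (is_derive_ext (V := CR) (fun _ => c O / RtoC (INR (fact 0)) * 1)%C).
    { intros s. now rewrite interp_poly_0. }
    rewrite interp_poly_derivative_0, Cmult_0_l. apply is_derive_Cconst.
  - apply (is_derive_ext (V := CR) (fun s => interp_poly N c (f s) a
        + c (S N) / RtoC (INR (fact (S N))) * (f s - a) ^ S N)%C).
    { intros s. now rewrite interp_poly_S. }
    rewrite interp_poly_derivative_S, Cmult_plus_distr_r.
    apply is_derive_Cplus; [exact IH|].
    replace (c (S N) / RtoC (INR (fact (S N))) * (RtoC (INR (S N)) * (f t - a) ^ N) * f')%C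
      with (0 * (f t - a) ^ S N
            + c (S N) / RtoC (INR (fact (S N))) * (RtoC (INR (S N)) * (f t - a) ^ N * (f' - 0)))%C
      by ring.
    apply is_derive_Cmult; [apply is_derive_Cconst|]. apply is_derive_Cpow.
    apply is_derive_Cminus; [exact Hf|apply is_derive_Cconst].
Qed.

(** * The double-layer potential as a Cauchy integral *)

(** For [w = z - g t], [dot v w / |w|^2] is the real part of [v / w]; with
    [v |g'| = - i g'] this makes the kernel the real part of [i g' / (g - z)]. *)
Lemma double_layer_cauchy g dg nu phi z :
  regular_loop g dg -> velocity g = dg ->
  (forall t, nu (g t) * RtoC (Cmod (dg t)) = - (Ci * dg t))%C ->
  (forall t, continuous (fun t => phi (g t)) t) -> off_curve g z ->
  double_layer g nu phi z
  = - Re (/ (RtoC (2 * PI) * Ci) * cauchy_integral g (fun t => RtoC (phi (g t)) * dg t) z)%C.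
Proof.
  intros H Hv Hn Hphi Hz. pose proof PI_RGT_0 as Hpi.
  assert (Hf : forall t, continuous (fun t => RtoC (phi (g t)) * dg t)%C t).
  { intros t. apply continuous_Cmult; [now apply continuous_RtoC|apply (loop_dcont _ _ H)]. }
  assert (I := is_RInt_cauchy g dg _ z H Hf Hz).
  apply (is_RInt_Cscal Ci), is_RInt_C_Re in I.
  unfold double_layer.
  rewrite (is_RInt_unique _ _ _ (Re (Ci * cauchy_integral g (fun t => RtoC (phi (g t)) * dg t)%C z)%C)).
  - assert (NP : RtoC (2 * PI) <> RtoC 0) by (intros E; injection E as E; lra).
    assert (NI : Ci <> RtoC 0) by (intros E; injection E as E; lra).
    set (X := cauchy_integral g (fun t => RtoC (phi (g t)) * dg t)%C z).
    replace (/ (RtoC (2 * PI) * Ci) * X)%C with (- (RtoC (/ (2 * PI)) * (Ci * X)))%C.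
    + simpl. ring.
    + rewrite RtoC_inv by lra.
      assert (Ci2 : (Ci * Ci = - 1)%C) by (unfold Ci, Cmult, Copp, RtoC; simpl; f_equal; ring).
      transitivity (- (Ci * Ci) * X / (RtoC (2 * PI) * Ci))%C; [field; now split|].
      rewrite Ci2. field. now split.
  - revert I. apply is_RInt_ext. intros t _. rewrite Hv.
    assert (N := off_curve_sub g z t Hz).
    assert (N2 : (z - g t <> 0)%C).
    { intros E. apply N. replace (g t - z)%C with (- (z - g t))%C by ring. rewrite E. ring. }
    replace (Ci * (RtoC (phi (g t)) * dg t / (g t - z)))%C
      with (RtoC (phi (g t)) * (nu (g t) * RtoC (Cmod (dg t)) / (z - g t)))%C.
    2: { rewrite Hn. field. now split. }
    set (w := (z - g t)%C) in *. set (v := nu (g t)).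
    assert (P := Csqnorm_pos w N2). clearbody w v.
    rewrite Cmod2_alt. unfold dot, Cdiv, Cinv, Cmult, RtoC, Re, Im in *. simpl. field.
    lra.
Qed.

(** * Dominated convergence for improper integrals *)

(** An integrable function [h] on the open interval, given with a primitive [H]
    and the limits of [H] at both ends: [h] may be unbounded there, and all
    integrals of [h] that are needed are differences of values of [H]. *)
Record dominating (a b : R) (h H : R -> R) (la lb : R) : Prop := {
  dominating_derive : forall t, a < t < b -> is_derive H t (h t);
  dominating_cont : forall t, a < t < b -> continuous h t;
  dominating_left : forall k, 0 < k -> exists d, 0 < d /\
    forall t, a < t < a + d -> Rabs (H t - la) < k;
  dominating_right : forall k, 0 < k -> exists d, 0 < d /\
    forall t, b - d < t < b -> Rabs (H t - lb) < k }.

Lemma dominated_RInt a b h H la lb (f : R -> C) x y :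
  dominating a b h H la lb ->
  (forall t, a < t < b -> continuous f t) -> (forall t, a < t < b -> Cmod (f t) <= h t) ->
  a < x -> x <= y -> y < b -> Cmod (RInt (V := CRc) f x y) <= H y - H x.
Proof.
  intros D Hc Hb Hx Hxy Hy.
  apply (Cmod_is_RInt_le f h x y); [exact Hxy| | |].
  - intros t Ht. apply Hb. lra.
  - apply is_RInt_C_correct; [exact Hxy|]. intros t Ht. apply Hc. lra.
  - apply (is_RInt_derive (V := R_CompleteNormedModule) H h);
      intros t; rewrite Rmin_left, Rmax_right by lra; intros Ht.
    + apply (dominating_derive _ _ _ _ _ _ D). lra.
    + apply (dominating_cont _ _ _ _ _ _ D). lra.
Qed.

Lemma RInt_C_Chasles (f : R -> C) x y z : x <= y -> y <= z ->
  (forall t, x <= t <= z -> continuous f t) ->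
  (RInt (V := CRc) f x y + RInt (V := CRc) f y z = RInt (V := CRc) f x z)%C.
Proof.
  intros Hxy Hyz Hc. apply (RInt_Chasles (V := CRc)).
  - apply ex_RInt_C; [exact Hxy|]. intros t Ht. apply Hc. lra.
  - apply ex_RInt_C; [exact Hyz|]. intros t Ht. apply Hc. lra.
Qed.

Lemma dominated_RInt_nested a b h H la lb (f : R -> C) x x0 y0 y :
  dominating a b h H la lb ->
  (forall t, a < t < b -> continuous f t) -> (forall t, a < t < b -> Cmod (f t) <= h t) ->
  a < x -> x <= x0 -> x0 <= y0 -> y0 <= y -> y < b ->
  Cmod (RInt (V := CRc) f x y - RInt (V := CRc) f x0 y0) <= (H x0 - H x) + (H y - H y0).
Proof.
  intros D Hc Hb Hx H1 H2 H3 Hy.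
  rewrite <- (RInt_C_Chasles f x x0 y); try lra. 2: { intros t Ht; apply Hc; lra. }
  rewrite <- (RInt_C_Chasles f x0 y0 y); try lra. 2: { intros t Ht; apply Hc; lra. }
  match goal with |- Cmod ?e <= _ => replace e with (RInt (V := CRc) f x x0 + RInt (V := CRc) f y0 y)%C by ring end.
  eapply Rle_trans; [apply Cmod_triangle|].
  apply Rplus_le_compat; apply (dominated_RInt a b h H la lb); auto; lra.
Qed.

(** By the nested estimate the integrals over [[x, y]] form a Cauchy net as the
    ends approach [a] and [b]. *)
Lemma improper_dominated a b h H la lb (f : R -> C) :
  a < b -> dominating a b h H la lb ->
  (forall t, a < t < b -> continuous f t) -> (forall t, a < t < b -> Cmod (f t) <= h t) ->
  exists I : C, is_RInt_gen (V := CR) f (at_right a) (at_left b) I /\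
    forall k, 0 < k -> exists x y, a < x /\ x < y /\ y < b /\
      Rabs (H x - la) < k /\ Rabs (H y - lb) < k /\ Cmod (RInt (V := CRc) f x y - I) < k.
Proof.
  intros Hab D Hc Hb.
  set (F := filter_prod (at_right a) (at_left b)).
  assert (PF : ProperFilter F) by (apply filter_prod_proper).
  set (near := fun (d : R) (u : R * R) => a < fst u < a + d /\ b - d < snd u < b).
  assert (Hnear : forall d, 0 < d -> F (near d)).
  { intros d Hd. apply (Filter_prod _ _ _ (fun x => a < x < a + d) (fun y => b - d < y < b)).
    - exists (mkposreal d Hd). intros y Hy Hay. apply Rabs_def2 in Hy.
      unfold minus, plus, opp in Hy; simpl in Hy. lra.
    - exists (mkposreal d Hd). intros y Hy Hay. apply Rabs_def2 in Hy.
      unfold minus, plus, opp in Hy; simpl in Hy. lra.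
    - intros x y Hx Hy. split; assumption. }
  assert (Hlim : exists I : CRc, filterlim (fun u => RInt (V := CRc) f (fst u) (snd u)) F (locally I)).
  { apply (filterlim_locally_cauchy (U := CRc) (F := F)
      (fun u : R * R => RInt (V := CRc) f (fst u) (snd u))). intros eps.
    destruct (dominating_left _ _ _ _ _ _ D (eps / 8)) as [d1 [Hd1 D1]]; [pose proof (cond_pos eps); lra|].
    destruct (dominating_right _ _ _ _ _ _ D (eps / 8)) as [d2 [Hd2 D2]]; [pose proof (cond_pos eps); lra|].
    set (d := Rmin (Rmin d1 d2) ((b - a) / 2)).
    assert (Hd : 0 < d) by (repeat apply Rmin_pos; lra).
    assert (A1 := Rmin_l (Rmin d1 d2) ((b - a) / 2)). assert (A2 := Rmin_r (Rmin d1 d2) ((b - a) / 2)).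
    assert (A3 := Rmin_l d1 d2). assert (A4 := Rmin_r d1 d2). fold d in A1, A2.
    exists (near d). split; [now apply Hnear|].
    intros [x y] [x' y'] [Hx Hy] [Hx' Hy']. simpl in *.
    set (x0 := Rmax x x'). set (y0 := Rmin y y').
    assert (B1 : a < x0 < a + d) by (unfold x0, Rmax; destruct (Rle_dec x x'); lra).
    assert (B2 : b - d < y0 < b) by (unfold y0, Rmin; destruct (Rle_dec y y'); lra).
    assert (B3 := Rmax_l x x'). assert (B4 := Rmax_r x x'). fold x0 in B3, B4.
    assert (B5 := Rmin_l y y'). assert (B6 := Rmin_r y y'). fold y0 in B5, B6.
    assert (K1 := dominated_RInt_nested a b h H la lb f x x0 y0 y D Hc Hb ltac:(lra) ltac:(lra) ltac:(lra) ltac:(lra) ltac:(lra)).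
    assert (K2 := dominated_RInt_nested a b h H la lb f x' x0 y0 y' D Hc Hb ltac:(lra) ltac:(lra) ltac:(lra) ltac:(lra) ltac:(lra)).
    assert (E1 := D1 x ltac:(lra)). assert (E2 := D1 x' ltac:(lra)). assert (E3 := D1 x0 ltac:(lra)).
    assert (E4 := D2 y ltac:(lra)). assert (E5 := D2 y' ltac:(lra)). assert (E6 := D2 y0 ltac:(lra)).
    apply Rabs_def2 in E1, E2, E3, E4, E5, E6.
    apply (C_NormedModule_mixin_compat1 (RInt (V := CRc) f x y) (RInt (V := CRc) f x' y') eps).
    change (Cmod (RInt (V := CRc) f x' y' - RInt (V := CRc) f x y)%C < eps).
    replace (RInt (V := CRc) f x' y' - RInt (V := CRc) f x y)%C
      with ((RInt (V := CRc) f x' y' - RInt (V := CRc) f x0 y0)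
            + - (RInt (V := CRc) f x y - RInt (V := CRc) f x0 y0))%C by ring.
    eapply Rle_lt_trans; [apply Cmod_triangle|]. rewrite Cmod_opp. lra. }
  destruct Hlim as [I HI]. exists I. split.
  - intros P HP. specialize (HI P HP). unfold filtermap in HI.
    assert (N : F (near ((b - a) / 2))) by (apply Hnear; lra).
    unfold filtermapi. fold F. generalize (filter_and _ _ N HI). apply filter_imp.
    intros [x y] [[Hx Hy] HPxy]. simpl in *.
    exists (RInt (V := CRc) f x y). split; [|exact HPxy].
    apply is_RInt_C_correct; [lra|]. intros t Ht. apply Hc. lra.
  - intros k Hk.
    destruct (dominating_left _ _ _ _ _ _ D k Hk) as [d1 [Hd1 D1]].
    destruct (dominating_right _ _ _ _ _ _ D k Hk) as [d2 [Hd2 D2]].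
    set (d := Rmin (Rmin d1 d2) ((b - a) / 2)).
    assert (Hd : 0 < d) by (repeat apply Rmin_pos; lra).
    assert (A1 := Rmin_l (Rmin d1 d2) ((b - a) / 2)). assert (A2 := Rmin_r (Rmin d1 d2) ((b - a) / 2)).
    assert (A3 := Rmin_l d1 d2). assert (A4 := Rmin_r d1 d2). fold d in A1, A2.
    assert (L : F (fun u => Cmod (RInt (V := CRc) f (fst u) (snd u) - I) < k)).
    { apply (HI (fun w => Cmod (w - I)%C < k)).
      apply (proj2 (locally_ball_Cmod (I : C) (fun w => Cmod (w - I)%C < k))).
      exists k. split; [exact Hk|auto]. }
    destruct (filter_ex _ (filter_and _ _ (Hnear d Hd) L)) as [[x y] [[Hx Hy] Hxy]]. simpl in *.
    exists x, y. repeat split; try lra; [apply D1|apply D2]; lra.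
Qed.

(** [h] cannot be integrated up to the ends, but [f] is bounded on [[a, b]], so the
    end intervals of length [d] contribute at most [d * M]. *)
Lemma dominated_proper a b h H la lb (f : R -> C) x0 y0 :
  a < b -> dominating a b h H la lb ->
  (forall t, a <= t <= b -> continuous f t) -> (forall t, a < t < b -> Cmod (f t) <= h t) ->
  a < x0 -> x0 <= y0 -> y0 < b ->
  Cmod (RInt (V := CRc) f a b - RInt (V := CRc) f x0 y0) <= (H x0 - la) + (lb - H y0).
Proof.
  intros Hab D Hc Hb H1 H2 H3. apply le_epsilon. intros eps Heps.
  destruct (Cmod_bounded f a b Hc) as [M [HM HMb]].
  destruct (dominating_left _ _ _ _ _ _ D (eps / 4)) as [d1 [Hd1 D1]]; [lra|].
  destruct (dominating_right _ _ _ _ _ _ D (eps / 4)) as [d2 [Hd2 D2]]; [lra|].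
  set (q := eps / (4 * M)). assert (Hq : 0 < q) by (apply Rdiv_lt_0_compat; lra).
  assert (HqM : q * M = eps / 4) by (unfold q; field; lra).
  set (d := Rmin (Rmin d1 d2) (Rmin q (Rmin (x0 - a) (b - y0))) / 2).
  assert (P0 : 0 < Rmin (Rmin d1 d2) (Rmin q (Rmin (x0 - a) (b - y0)))) by (repeat apply Rmin_pos; lra).
  assert (A1 := Rmin_l (Rmin d1 d2) (Rmin q (Rmin (x0 - a) (b - y0)))).
  assert (A2 := Rmin_r (Rmin d1 d2) (Rmin q (Rmin (x0 - a) (b - y0)))).
  assert (A3 := Rmin_l d1 d2). assert (A4 := Rmin_r d1 d2).
  assert (A5 := Rmin_l q (Rmin (x0 - a) (b - y0))). assert (A6 := Rmin_r q (Rmin (x0 - a) (b - y0))).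
  assert (A7 := Rmin_l (x0 - a) (b - y0)). assert (A8 := Rmin_r (x0 - a) (b - y0)).
  assert (Hd : 0 < d) by (unfold d; lra).
  assert (Hdq : d < q) by (unfold d; lra).
  assert (Hdd : d < d1 /\ d < d2 /\ d < x0 - a /\ d < b - y0) by (unfold d; lra).
  clearbody d.
  assert (N := dominated_RInt_nested a b h H la lb f (a + d) x0 y0 (b - d) D
     (fun t Ht => Hc t ltac:(lra)) Hb ltac:(lra) ltac:(lra) H2 ltac:(lra) ltac:(lra)).
  assert (C1 : Cmod (RInt (V := CRc) f a (a + d)) <= d * M).
  { replace d with (a + d - a) at 2 by ring.
    apply (Cmod_is_RInt_le_const f a (a + d)); [lra| |].
    - intros t Ht. apply HMb. lra.
    - apply is_RInt_C_correct; [lra|]. intros t Ht. apply Hc. lra. }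
  assert (C2 : Cmod (RInt (V := CRc) f (b - d) b) <= d * M).
  { replace d with (b - (b - d)) at 2 by ring.
    apply (Cmod_is_RInt_le_const f (b - d) b); [lra| |].
    - intros t Ht. apply HMb. lra.
    - apply is_RInt_C_correct; [lra|]. intros t Ht. apply Hc. lra. }
  rewrite <- (RInt_C_Chasles f a (a + d) b); try lra; [|exact Hc].
  rewrite <- (RInt_C_Chasles f (a + d) (b - d) b); try lra. 2: { intros t Ht; apply Hc; lra. }
  match goal with |- Cmod ?e <= _ => replace e with
    (RInt (V := CRc) f a (a + d) + (RInt (V := CRc) f (b - d) b
      + (RInt (V := CRc) f (a + d) (b - d) - RInt (V := CRc) f x0 y0)))%C by ring end.
  eapply Rle_trans; [apply Cmod_triangle|].
  eapply Rle_trans; [apply Rplus_le_compat_l, Cmod_triangle|].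
  assert (E1 := D1 (a + d) ltac:(lra)). assert (E2 := D2 (b - d) ltac:(lra)).
  apply Rabs_def2 in E1, E2.
  assert (d * M <= q * M) by (apply Rmult_le_compat_r; lra).
  lra.
Qed.

(** Outside a compact subinterval all integrals are uniformly small by domination;
    on it the convergence is uniform. *)
Lemma dominated_convergence a b h H la lb (f : R -> R -> C) (f0 : R -> C) e0 (I : C) :
  a < b -> dominating a b h H la lb -> 0 < e0 ->
  (forall e, 0 < Rabs e < e0 -> forall t, a <= t <= b -> continuous (f e) t) ->
  (forall e, 0 < Rabs e < e0 -> forall t, a < t < b -> Cmod (f e t) <= h t) ->
  (forall t, a < t < b -> continuous f0 t) ->
  (forall x y k, a < x -> x <= y -> y < b -> 0 < k -> exists d, 0 < d /\
     forall e, 0 < Rabs e < d -> forall t, x <= t <= y -> Cmod (f e t - f0 t) <= k) ->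
  (forall k, 0 < k -> exists x y, a < x /\ x < y /\ y < b /\
      Rabs (H x - la) < k /\ Rabs (H y - lb) < k /\ Cmod (RInt (V := CRc) f0 x y - I) < k) ->
  forall k, 0 < k -> exists d, 0 < d /\ forall e, 0 < Rabs e < d ->
    Cmod (RInt (V := CRc) (f e) a b - I) < k.
Proof.
  intros Hab D He0 Hc Hb Hc0 Hu HI k Hk.
  destruct (HI (k / 4)) as (x & y & Hx & Hxy & Hy & E1 & E2 & E3); [lra|].
  destruct (Hu x y (k / (8 * (b - a))) Hx ltac:(lra) Hy) as [d [Hd Hdd]].
  { apply Rdiv_lt_0_compat; lra. }
  exists (Rmin d e0). split; [now apply Rmin_pos|]. intros e He.
  assert (A1 := Rmin_l d e0). assert (A2 := Rmin_r d e0).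
  assert (K1 := dominated_proper a b h H la lb (f e) x y Hab D (Hc e ltac:(lra)) (Hb e ltac:(lra))
     Hx ltac:(lra) Hy).
  assert (K2 : Cmod (RInt (V := CRc) (f e) x y - RInt (V := CRc) f0 x y) <= k / 8).
  { apply Rle_trans with ((y - x) * (k / (8 * (b - a)))).
    - apply (Cmod_is_RInt_le_const (fun t => f e t - f0 t)%C); [lra| |].
      + intros t Ht. apply (Hdd e); lra.
      + apply is_RInt_Cminus; apply is_RInt_C_correct; try lra.
        * intros t Ht. apply (Hc e); lra.
        * intros t Ht. apply Hc0; lra.
    - apply Rle_trans with ((b - a) * (k / (8 * (b - a)))).
      + apply Rmult_le_compat_r; [|lra]. left. apply Rdiv_lt_0_compat; lra.
      + right. field. lra. }
  apply Rabs_def2 in E1, E2.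
  replace (RInt (V := CRc) (f e) a b - I)%C
    with ((RInt (V := CRc) (f e) a b - RInt (V := CRc) (f e) x y)
          + ((RInt (V := CRc) (f e) x y - RInt (V := CRc) f0 x y) + (RInt (V := CRc) f0 x y - I)))%C by ring.
  eapply Rle_lt_trans; [apply Cmod_triangle|].
  eapply Rle_lt_trans; [apply Rplus_le_compat_l, Cmod_triangle|]. lra.
Qed.

Lemma Rpower_lim_0 alpha k : 0 < alpha -> 0 < k ->
  exists d, 0 < d /\ forall x, 0 < x < d -> 0 < Rpower x alpha < k.
Proof.
  intros Ha Hk. exists (Rpower k (/ alpha)). split; [apply exp_pos|].
  intros x Hx. split; [apply exp_pos|].
  replace k with (Rpower (Rpower k (/ alpha)) alpha).
  - apply Rlt_Rpower_l; lra.
  - rewrite Rpower_mult. replace (/ alpha * alpha) with 1 by (field; lra). now apply Rpower_1.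
Qed.

Lemma is_derive_Rpower alpha x : 0 < x ->
  is_derive (fun t => Rpower t alpha) x (alpha * Rpower x (alpha - 1)).
Proof.
  intros Hx. apply is_derive_Reals. now apply derivable_pt_lim_power.
Qed.

(** The two powers are integrable since [alpha - 1 > -1]; near either end, [H] is
    controlled by one power that tends to [0] and another one that is continuous. *)
Lemma dominating_power a b A B alpha : a < b -> 0 < alpha ->
  dominating a b
    (fun t => A * (Rpower (t - a) (alpha - 1) + Rpower (b - t) (alpha - 1)) + B)
    (fun t => A / alpha * (Rpower (t - a) alpha - Rpower (b - t) alpha) + B * t)
    (- (A / alpha * Rpower (b - a) alpha) + B * a)
    (A / alpha * Rpower (b - a) alpha + B * b).
Proof.
  intros Hab Ha.
  assert (D1 : forall p t, a < t < b -> is_derive (fun t => Rpower (t - a) p) t (p * Rpower (t - a) (p - 1))).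
  { intros p t Ht. replace (p * Rpower (t - a) (p - 1)) with (scal 1 (p * Rpower (t - a) (p - 1)))
      by (unfold scal; simpl; unfold mult; simpl; ring).
    apply (is_derive_comp (fun x => Rpower x p) (fun t => t - a)).
    - apply is_derive_Rpower. lra.
    - auto_derive; [exact I|ring]. }
  assert (D2 : forall p t, a < t < b -> is_derive (fun t => Rpower (b - t) p) t (- (p * Rpower (b - t) (p - 1)))).
  { intros p t Ht. replace (- (p * Rpower (b - t) (p - 1))) with (scal (-1) (p * Rpower (b - t) (p - 1)))
      by (unfold scal; simpl; unfold mult; simpl; ring).
    apply (is_derive_comp (fun x => Rpower x p) (fun t => b - t)).
    - apply is_derive_Rpower. lra.
    - auto_derive; [exact I|ring]. }
  assert (Cont : forall p x, 0 < x -> continuous (fun t => Rpower t p) x).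
  { intros p x Hx. apply (ex_derive_continuous (fun t => Rpower t p)). eexists. now apply is_derive_Rpower. }
  assert (Lim : forall k, 0 < k -> exists d, 0 < d /\ forall s, 0 < s < d ->
            Rabs (A / alpha) * (Rpower s alpha + Rabs (Rpower (b - a) alpha - Rpower (b - a - s) alpha))
            + Rabs B * s < k).
  { intros k Hk. set (c := Rabs (A / alpha) + 1).
    assert (Hc : 0 < c) by (unfold c; pose proof (Rabs_pos (A / alpha)); lra).
    assert (Hk2 : 0 < k / (4 * c)) by (apply Rdiv_lt_0_compat; lra).
    destruct (Rpower_lim_0 alpha (k / (4 * c)) Ha Hk2) as [d1 [Hd1 L1]].
    assert (HC := Cont alpha (b - a) ltac:(lra)).
    destruct (proj1 (locally_ball_R (b - a) (fun x => Rabs (Rpower x alpha - Rpower (b - a) alpha) < k / (4 * c))))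
      as [d2 [Hd2 L2]].
    { apply (HC (fun y => Rabs (y - Rpower (b - a) alpha) < k / (4 * c))).
      apply locally_ball_R. exists (k / (4 * c)). split; [exact Hk2|auto]. }
    set (q := k / (4 * (Rabs B + 1))).
    assert (HB : 0 < Rabs B + 1) by (pose proof (Rabs_pos B); lra).
    assert (Hq : 0 < q) by (apply Rdiv_lt_0_compat; lra).
    exists (Rmin (Rmin d1 d2) q). split; [repeat apply Rmin_pos; lra|].
    intros s Hs. assert (A1 := Rmin_l (Rmin d1 d2) q). assert (A2 := Rmin_r (Rmin d1 d2) q).
    assert (A3 := Rmin_l d1 d2). assert (A4 := Rmin_r d1 d2).
    assert (E1 := L1 s ltac:(lra)).
    assert (E2 : Rabs (Rpower (b - a) alpha - Rpower (b - a - s) alpha) < k / (4 * c)).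
    { rewrite Rabs_minus_sym. apply L2. replace (b - a - s - (b - a)) with (- s) by ring.
      rewrite Rabs_Ropp, Rabs_pos_eq; lra. }
    assert (E3 : Rabs (A / alpha) * (Rpower s alpha + Rabs (Rpower (b - a) alpha - Rpower (b - a - s) alpha)) <= c * (k / (4 * c) + k / (4 * c))).
    { apply Rmult_le_compat; [apply Rabs_pos| |unfold c; lra|lra].
      pose proof (Rabs_pos (Rpower (b - a) alpha - Rpower (b - a - s) alpha)). lra. }
    replace (c * (k / (4 * c) + k / (4 * c))) with (k / 2) in E3 by (field; lra).
    assert (E4 : Rabs B * s <= (Rabs B + 1) * q).
    { apply Rmult_le_compat; [apply Rabs_pos|lra|lra|lra]. }
    replace ((Rabs B + 1) * q) with (k / 4) in E4 by (unfold q; field; lra). lra. }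
  split.
  - intros t Ht.
    replace (A * (Rpower (t - a) (alpha - 1) + Rpower (b - t) (alpha - 1)) + B)
      with (plus (scal (A / alpha) (minus (alpha * Rpower (t - a) (alpha - 1)) (- (alpha * Rpower (b - t) (alpha - 1))))) (B * 1)).
    2: { unfold plus, scal, minus, plus, opp; simpl. unfold mult; simpl. field. lra. }
    apply (is_derive_plus (fun t => A / alpha * (Rpower (t - a) alpha - Rpower (b - t) alpha)) (fun t => B * t)).
    + apply (is_derive_scal (fun t => Rpower (t - a) alpha - Rpower (b - t) alpha)).
      apply (is_derive_minus (fun t => Rpower (t - a) alpha) (fun t => Rpower (b - t) alpha)); auto.
    + auto_derive; [exact I|ring].
  - intros t Ht. apply (continuous_plus (V := R_NormedModule)); [|apply continuous_const].
    apply (continuous_scal_r (V := R_NormedModule)).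
    apply (continuous_plus (V := R_NormedModule)).
    + apply (ex_derive_continuous (fun t => Rpower (t - a) (alpha - 1))). eexists. now apply D1.
    + apply (ex_derive_continuous (fun t => Rpower (b - t) (alpha - 1))). eexists. now apply D2.
  - intros k Hk. destruct (Lim k Hk) as [d [Hd L]]. exists d. split; [exact Hd|].
    intros t Ht. eapply Rle_lt_trans; [|apply (L (t - a)); lra].
    replace (b - a - (t - a)) with (b - t) by ring.
    match goal with |- Rabs ?e <= _ => replace e with
      (A / alpha * (Rpower (t - a) alpha + (Rpower (b - a) alpha - Rpower (b - t) alpha)) + B * (t - a)) by ring end.
    eapply Rle_trans; [apply Rabs_triang|]. rewrite !Rabs_mult, (Rabs_pos_eq (t - a)) by lra.
    apply Rplus_le_compat_r. apply Rmult_le_compat_l; [apply Rabs_pos|].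
    eapply Rle_trans; [apply Rabs_triang|]. rewrite (Rabs_pos_eq (Rpower _ _)); [lra|left; apply exp_pos].
  - intros k Hk. destruct (Lim k Hk) as [d [Hd L]]. exists d. split; [exact Hd|].
    intros t Ht. eapply Rle_lt_trans; [|apply (L (b - t)); lra].
    replace (b - a - (b - t)) with (t - a) by ring.
    match goal with |- Rabs ?e <= _ => replace e with
      (- (A / alpha * (Rpower (b - t) alpha + (Rpower (b - a) alpha - Rpower (t - a) alpha)) + B * (b - t))) by ring end.
    rewrite Rabs_Ropp.
    eapply Rle_trans; [apply Rabs_triang|]. rewrite !Rabs_mult, (Rabs_pos_eq (b - t)) by lra.
    apply Rplus_le_compat_r. apply Rmult_le_compat_l; [apply Rabs_pos|].
    eapply Rle_trans; [apply Rabs_triang|]. rewrite (Rabs_pos_eq (Rpower _ _)); [lra|left; apply exp_pos].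
Qed.

(** * The positively oriented boundary of a domain *)

Lemma Derive_periodic (f : R -> R) T t : (forall t, f (t + T) = f t) -> Derive f (t + T) = Derive f t.
Proof.
  intros H. unfold Derive. f_equal. apply Lim_ext. intros h.
  replace (t + T + h) with (t + h + T) by ring. now rewrite !H.
Qed.

Lemma C2_velocity gamma : (forall t, CCn_at 2 gamma t) ->
  (forall t, is_derive (V := CR) gamma t (velocity gamma t)) /\
  (forall t, exists l, is_derive (V := CR) (velocity gamma) t l).
Proof.
  intros H. split; intros t; destruct (H t) as [[H1 _] [H2 _]].
  - apply is_derive_C_pair.
    + apply Derive_correct. apply (locally_singleton t _ (H1 1%nat ltac:(lia))).
    + apply Derive_correct. apply (locally_singleton t _ (H2 1%nat ltac:(lia))).
  - exists (CDerive_n gamma 2 t). apply is_derive_C_pair.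
    + apply (Derive_correct (Derive_n (fun s => Re (gamma s)) 1)).
      apply (locally_singleton t _ (H1 2%nat ltac:(lia))).
    + apply (Derive_correct (Derive_n (fun s => Im (gamma s)) 1)).
      apply (locally_singleton t _ (H2 2%nat ltac:(lia))).
Qed.

Lemma jordan_regular_loop gamma : regular_C2_jordan gamma -> regular_loop gamma (velocity gamma).
Proof.
  intros (Hp & Hi & H2 & Hr). destruct (C2_velocity gamma H2) as [D1 D2].
  split; auto.
  - intros t. destruct (D2 t) as [l Hl]. now apply is_derive_C_continuous in Hl.
  - intros t. unfold velocity, CDerive_n. simpl. f_equal; apply Derive_periodic; intros s; now rewrite Hp.
Qed.

(** A unit vector orthogonal to the velocity is [i g' / |g'|] or its opposite; the
    first one points into [Omega] by the orientation. *)
Lemma exterior_normal_eq Omega gamma nu :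
  (forall t, velocity gamma t <> RtoC 0) ->
  counterclockwise Omega gamma -> exterior_unit_normal Omega gamma nu ->
  forall t, (nu (gamma t) * RtoC (Cmod (velocity gamma t)) = - (Ci * velocity gamma t))%C.
Proof.
  intros Hr Hccw Hnu t. destruct (Hnu t) as (H1 & H2 & d & Hd & Hout).
  destruct (Hccw t) as (d' & Hd' & Hin).
  set (v := nu (gamma t)) in *. set (w := velocity gamma t) in *.
  assert (Hw : 0 < Cmod w) by (apply Cmod_gt_0; apply Hr).
  set (r := Cmod w) in *.
  assert (R2 : Re w ^ 2 + Im w ^ 2 = r ^ 2) by (unfold r; now rewrite Cmod2_alt).
  assert (V2 : Re v ^ 2 + Im v ^ 2 = 1) by (rewrite <- Cmod2_alt, H1; ring).
  unfold dot in H2.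
  set (s := (Im v * Re w - Re v * Im w) / r).
  assert (Hs2 : s ^ 2 = 1).
  { unfold s.
    assert (E : (Im v * Re w - Re v * Im w) ^ 2 = r ^ 2).
    { replace ((Im v * Re w - Re v * Im w) ^ 2)
        with ((Re v ^ 2 + Im v ^ 2) * (Re w ^ 2 + Im w ^ 2) - (Re v * Re w + Im v * Im w) ^ 2) by ring.
      rewrite R2, V2, H2. ring. }
    unfold Rdiv. rewrite Rpow_mult_distr, E. field. lra. }
  assert (Hv : (v * RtoC r = RtoC s * (Ci * w))%C).
  { assert (E1 : Re v * r = s * - Im w).
    { unfold s. apply Rmult_eq_reg_r with r; [|lra].
      replace ((Im v * Re w - Re v * Im w) / r * - Im w * r)
        with (Re v * (Re w ^ 2 + Im w ^ 2) - Re w * (Re v * Re w + Im v * Im w)) by (field; lra).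
      rewrite R2, H2. ring. }
    assert (E2 : Im v * r = s * Re w).
    { unfold s. apply Rmult_eq_reg_r with r; [|lra].
      replace ((Im v * Re w - Re v * Im w) / r * Re w * r)
        with (Im v * (Re w ^ 2 + Im w ^ 2) - Im w * (Re v * Re w + Im v * Im w)) by (field; lra).
      rewrite R2, H2. ring. }
    clearbody s w. unfold Re, Im in E1, E2. apply injective_projections; simpl.
    - transitivity (fst v * r); [ring|]. rewrite E1. ring.
    - transitivity (snd v * r); [ring|]. rewrite E2. ring. }
  assert (S : s = 1 \/ s = -1).
  { assert ((s - 1) * (s + 1) = 0) by (replace ((s - 1) * (s + 1)) with (s ^ 2 - 1) by ring; lra).
    apply Rmult_integral in H. destruct H; [left|right]; lra. }
  destruct S as [S|S]; rewrite S in Hv; [exfalso|].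
  - set (e := Rmin d (d' * r) / 2).
    assert (0 < d' * r) by (apply Rmult_lt_0_compat; lra).
    assert (0 < Rmin d (d' * r)) by (apply Rmin_pos; lra).
    assert (A1 := Rmin_l d (d' * r)). assert (A2 := Rmin_r d (d' * r)).
    destruct (Hout e) as [Hn _]; [unfold e; lra|]. apply Hn.
    assert (Nr : RtoC r <> RtoC 0) by (intros E; injection E as E; lra).
    replace (gamma t + RtoC e * v)%C with (gamma t + RtoC (e / r) * (Ci * w))%C.
    + apply Hin. split; [apply Rdiv_lt_0_compat; unfold e; lra|].
      apply Rmult_lt_reg_r with r; [lra|]. replace (e / r * r) with e by (field; lra). unfold e; lra.
    + rewrite RtoC_div by lra. replace (Ci * w)%C with (v * RtoC r)%C by (rewrite Hv; ring). field. exact Nr.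
  - rewrite Hv. replace (RtoC (-1)) with (- RtoC 1)%C by (rewrite <- RtoC_opp; f_equal; lra). ring.
Qed.

Lemma inside_of_hypotheses Omega gamma nu :
  regular_loop gamma (velocity gamma) -> Defs.bounded Omega ->
  (forall z, boundary Omega z <-> curve gamma z) ->
  counterclockwise Omega gamma -> exterior_unit_normal Omega gamma nu ->
  inside gamma (velocity gamma) Omega.
Proof.
  intros H Hb Hbd Hccw Hnu.
  pose proof (exterior_normal_eq Omega gamma nu (loop_regular _ _ H) Hccw Hnu) as Hn.
  split; auto.
  - intros t. destruct (Hnu t) as (_ & _ & d & Hd & Hout).
    set (r := Cmod (velocity gamma t)).
    assert (Hr : 0 < r) by (apply Cmod_gt_0, (loop_regular _ _ H)).
    exists (d / r). split; [now apply Rdiv_lt_0_compat|]. intros s Hs.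
    destruct (Hout (s * r)) as [K _].
    + split; [now apply Rmult_lt_0_compat|].
      replace d with (d / r * r) by (field; lra). apply Rmult_lt_compat_r; lra.
    + replace (normal_point gamma (velocity gamma) t (- s)) with (gamma t + RtoC (s * r) * nu (gamma t))%C; [exact K|].
      unfold normal_point. rewrite RtoC_opp, RtoC_mult.
      replace (RtoC s * RtoC r * nu (gamma t))%C with (RtoC s * (nu (gamma t) * RtoC r))%C by ring.
      unfold r. rewrite Hn. ring.
  - intros z Hz. rewrite Hbd. now apply (off_curve_iff _ _ H).
Qed.

Lemma continuous_along_curve gamma phi :
  regular_loop gamma (velocity gamma) -> continuous_on_curve gamma phi ->
  forall t, continuous (fun t => phi (gamma t)) t.
Proof.
  intros H Hphi t P HP.
  assert (Hc : curve gamma (gamma t)) by (apply (curve_iff _ _ H); now exists t).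
  specialize (Hphi (gamma t) Hc P HP). unfold filtermap, within in Hphi.
  specialize (loop_continuous _ _ H t _ Hphi). unfold filtermap. apply filter_imp.
  intros s Hs. apply Hs. apply (curve_iff _ _ H). now exists s.
Qed.

(** * The interpolated representation off the curve *)

(** Replacing [phi] by [phi - P] changes the Cauchy integral by [P z] times the
    winding integral. *)
Lemma double_layer_interpolant Omega gamma nu (phi : C -> R) N c a z :
  regular_loop gamma (velocity gamma) -> inside gamma (velocity gamma) Omega ->
  (forall t, nu (gamma t) * RtoC (Cmod (velocity gamma t)) = - (Ci * velocity gamma t))%C ->
  (forall t, continuous (fun t => phi (gamma t)) t) -> off_curve gamma z ->
  double_layer gamma nu phi z =
  - Re (/ (RtoC (2 * PI) * Ci) *
          contour_integral gamma
            (fun zeta => (RtoC (phi zeta) - interp_poly N c zeta a) / (zeta - z))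
        + indicator Omega z * interp_poly N c z a)%C.
Proof.
  intros H HO Hn Hphi Hz.
  rewrite (double_layer_cauchy gamma (velocity gamma) nu phi z H eq_refl Hn Hphi Hz).
  assert (Hf : forall t, continuous (fun t => RtoC (phi (gamma t)) * velocity gamma t)%C t).
  { intros t. apply continuous_Cmult; [now apply continuous_RtoC|apply (loop_dcont _ _ H)]. }
  assert (I := is_RInt_Cminus _ _ _ _ _ _ (is_RInt_cauchy _ _ _ z H Hf Hz)
                 (is_RInt_cauchy_interp _ _ N c a z H Hz)).
  rewrite (winding_number _ _ Omega z H HO Hz) in I.
  set (X := cauchy_integral gamma (fun t => RtoC (phi (gamma t)) * velocity gamma t)%C z) in *.
  assert (E : contour_integral gamma (fun zeta => (RtoC (phi zeta) - interp_poly N c zeta a) / (zeta - z))%C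
              = (X - interp_poly N c z a * (RtoC (2 * PI) * Ci * indicator Omega z))%C).
  { unfold contour_integral. apply is_RInt_C_unique. revert I.
    apply (is_RInt_ext (V := CR)). intros t _. as_C_equation.
    unfold Cdiv. ring. }
  rewrite E. f_equal. f_equal.
  assert (NP : RtoC (2 * PI) <> RtoC 0) by (pose proof PI_RGT_0; intros K; injection K as K; lra).
  assert (NI : Ci <> RtoC 0) by (intros K; injection K as K; lra).
  field. now split.
Qed.

(** * The gradient of the double-layer potential *)

(** A remainder of second order gives Frechet differentiability, with the
    differential [h |-> Re (k h)]. *)
Lemma filterdiff_quadratic (D : C -> R) r (k : C) B d : 0 < d ->
  (forall z, Cmod (z - r) < d -> Rabs (D z - D r - Re (k * (z - r))%C) <= B * Cmod (z - r) ^ 2) ->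
  filterdiff (U := CR) (V := R_NormedModule) D (locally r) (fun h : C => Re (k * h)%C).
Proof.
  intros Hd H. split.
  - split.
    + intros x y. change (Re (k * (x + y))%C = Re (k * x)%C + Re (k * y)%C). unfold Re; simpl. ring.
    + intros l [x1 x2]. change (Re (Cmult k (l * x1, l * x2)) = l * Re (k * (x1, x2))%C).
      unfold Re; simpl. ring.
    + exists (Cmod k + 1). split; [pose proof (Cmod_ge_0 k); lra|].
      intros x. change (norm (Re (k * x)%C)) with (Rabs (Re (k * x)%C)). rewrite <- Cmod_norm.
      eapply Rle_trans; [apply re_le_Cmod|]. rewrite Cmod_mult.
      apply Rmult_le_compat_r; [apply Cmod_ge_0|lra].
  - intros x Hx. apply (is_filter_lim_locally_unique (K := R_AbsRing) (V := CR) r x) in Hx. subst x.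
    intros eps. apply (proj2 (locally_ball_Cmod r _)).
    assert (HB : 0 < Rabs B + 1) by (pose proof (Rabs_pos B); lra).
    exists (Rmin d (eps / (Rabs B + 1))). split.
    { apply Rmin_pos; [exact Hd|]. apply Rdiv_lt_0_compat; [apply cond_pos|exact HB]. }
    intros z Hz.
    assert (Hz1 : Cmod (z - r) < d) by (eapply Rlt_le_trans; [exact Hz|apply Rmin_l]).
    assert (Hz2 : Cmod (z - r) < eps / (Rabs B + 1)) by (eapply Rlt_le_trans; [exact Hz|apply Rmin_r]).
    specialize (H z Hz1). rewrite <- Cmod_norm.
    change (Rabs (D z - D r - Re (k * (z - r))%C) <= eps * Cmod (z - r)%C).
    eapply Rle_trans; [exact H|].
    apply Rle_trans with ((Rabs B + 1) * Cmod (z - r) * Cmod (z - r)).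
    + simpl. pose proof (Rle_abs B). pose proof (Cmod_ge_0 (z - r)). nra.
    + apply Rmult_le_compat_r; [apply Cmod_ge_0|].
      apply Rmult_lt_compat_l with (r := Rabs B + 1) in Hz2; [|exact HB].
      replace ((Rabs B + 1) * (eps / (Rabs B + 1))) with (pos eps) in Hz2 by (field; lra). lra.
Qed.

Lemma gradient_quadratic (D : C -> R) r (k : C) B d : 0 < d ->
  (forall z, Cmod (z - r) < d -> Rabs (D z - D r - Re (k * (z - r))%C) <= B * Cmod (z - r) ^ 2) ->
  gradient D r = (Re k, - Im k).
Proof.
  intros Hd H. destruct r as [a b]. unfold gradient. simpl. f_equal.
  - apply is_derive_unique. apply (is_derive_Re (fun x => RtoC (D (x, b))) a (RtoC (Re k))).
    apply (is_derive_quadratic _ a _ B d Hd). intros y Hy.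
    assert (E : ((y, b) - (a, b) = RtoC (y - a))%C) by (unfold Cminus, Cplus, Copp, RtoC; simpl; f_equal; ring).
    specialize (H (y, b)). rewrite E, Cmod_R in H. specialize (H Hy).
    replace (Re (k * RtoC (y - a))%C) with ((y - a) * Re k) in H by (unfold Re; simpl; ring).
    rewrite <- RtoC_mult, <- !RtoC_minus, Cmod_R. exact H.
  - apply is_derive_unique. apply (is_derive_Re (fun x => RtoC (D (a, x))) b (RtoC (- Im k))).
    apply (is_derive_quadratic _ b _ B d Hd). intros y Hy.
    assert (E : ((a, y) - (a, b) = RtoC (y - b) * Ci)%C)
      by (unfold Cminus, Cplus, Copp, RtoC, Cmult, Ci; simpl; f_equal; ring).
    specialize (H (a, y)). rewrite E, Cmod_mult, Cmod_R, Cmod_Ci, Rmult_1_r in H. specialize (H Hy).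
    replace (Re (k * (RtoC (y - b) * Ci))%C) with ((y - b) * - Im k) in H by (unfold Re, Im; simpl; ring).
    rewrite <- RtoC_mult, <- !RtoC_minus, Cmod_R. exact H.
Qed.

(** Real part of the complex expansion [cauchy_expansion]. *)
Lemma double_layer_differentiable gamma nu (phi : C -> R) r :
  regular_loop gamma (velocity gamma) ->
  (forall t, nu (gamma t) * RtoC (Cmod (velocity gamma t)) = - (Ci * velocity gamma t))%C ->
  (forall t, continuous (fun t => phi (gamma t)) t) -> off_curve gamma r ->
  let k := (- (/ (RtoC (2 * PI) * Ci)
              * cauchy_derivative gamma (fun t => RtoC (phi (gamma t)) * velocity gamma t) r))%C in
  ex_filterdiff (U := CR) (V := R_NormedModule) (double_layer gamma nu phi) (locally r) /\
  gradient (double_layer gamma nu phi) r = (Re k, - Im k).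
Proof.
  intros H Hn Hphi Hr k.
  assert (Hf : forall t, continuous (fun t => RtoC (phi (gamma t)) * velocity gamma t)%C t).
  { intros t. apply continuous_Cmult; [now apply continuous_RtoC|apply (loop_dcont _ _ H)]. }
  destruct (cauchy_expansion _ _ _ r H Hf Hr) as (B & d & HB & Hd & E).
  set (q := (/ (RtoC (2 * PI) * Ci))%C) in *.
  assert (Q : forall z, Cmod (z - r) < d ->
     Rabs (double_layer gamma nu phi z - double_layer gamma nu phi r - Re (k * (z - r))%C)
       <= Cmod q * B * Cmod (z - r) ^ 2).
  { intros z Hz. destruct (E z Hz) as [Oz Ez].
    rewrite !(double_layer_cauchy gamma (velocity gamma) nu phi _ H eq_refl Hn Hphi) by assumption.
    fold q. set (A := cauchy_integral gamma _ z) in *. set (A0 := cauchy_integral gamma _ r) in *.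
    unfold k. set (A1 := cauchy_derivative gamma _ r) in *.
    replace (- Re (q * A)%C - - Re (q * A0)%C - Re (- (q * A1) * (z - r))%C)
      with (- Re (q * (A - A0 - (z - r) * A1))%C) by (unfold Re; simpl; ring).
    rewrite Rabs_Ropp. eapply Rle_trans; [apply re_le_Cmod|]. rewrite Cmod_mult, Rmult_assoc.
    apply Rmult_le_compat_l; [apply Cmod_ge_0|exact Ez]. }
  split.
  - eexists. apply (filterdiff_quadratic _ r k (Cmod q * B) d Hd Q).
  - apply (gradient_quadratic _ r k (Cmod q * B) d Hd Q).
Qed.

(** * The interpolation error *)

Lemma is_derive_C_lipschitz (f : R -> C) t (l : C) : is_derive (V := CR) f t l ->
  exists L d, 0 < L /\ 0 < d /\ forall s, Rabs (s - t) < d -> Cmod (f s - f t) <= L * Rabs (s - t).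
Proof.
  intros [_ H]. specialize (H t (fun P HP => HP) (mkposreal 1 Rlt_0_1)).
  apply locally_ball_R in H. destruct H as [d [Hd H]].
  exists (Cmod l + 1), d. split; [pose proof (Cmod_ge_0 l); lra|]. split; [exact Hd|].
  intros s Hs. specialize (H s Hs). rewrite <- Cmod_norm in H.
  change (norm (minus s t)) with (Rabs (s - t)) in H. simpl (pos _) in H.
  match type of H with Cmod ?e <= _ => replace e with (f s - f t - RtoC (s - t) * l)%C in H end.
  2: { unfold minus, plus, opp, scal; simpl. unfold prod_plus, prod_opp, prod_scal, plus, opp, scal; simpl.
       unfold mult; simpl. unfold Cminus, Cplus, Copp, Cmult, RtoC; simpl. f_equal; ring. }
  replace (f s - f t)%C with ((f s - f t - RtoC (s - t) * l) + RtoC (s - t) * l)%C by ring.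
  eapply Rle_trans; [apply Cmod_triangle|]. rewrite Cmod_mult, Cmod_R. lra.
Qed.

Lemma ex_derive_interp_poly_derivative (f : R -> C) N c a t (f' : C) :
  is_derive (V := CR) f t f' ->
  exists l : C, is_derive (V := CR) (fun s => interp_poly_derivative N c (f s) a) t l.
Proof.
  intros Hf. induction N as [|N [l IH]].
  - exists (RtoC 0). apply (is_derive_ext (V := CR) (fun _ => RtoC 0)).
    { intros s. now rewrite interp_poly_derivative_0. }
    apply is_derive_Cconst.
  - assert (P : exists m : C, is_derive (V := CR) (fun s => (f s - a) ^ N)%C t m).
    { destruct N as [|N].
      - exists (RtoC 0). apply (is_derive_ext (V := CR) (fun _ => RtoC 1)); [reflexivity|].
        apply is_derive_Cconst.
      - eexists. apply is_derive_Cpow. apply is_derive_Cminus; [exact Hf|apply is_derive_Cconst]. }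
    destruct P as [m Hm]. eexists.
    apply (is_derive_ext (V := CR) (fun s => interp_poly_derivative N c (f s) a
        + c (S N) / RtoC (INR (fact (S N))) * (RtoC (INR (S N)) * (f s - a) ^ N))%C).
    { intros s. now rewrite interp_poly_derivative_S. }
    apply is_derive_Cplus; [exact IH|].
    apply is_derive_Cmult; [apply is_derive_Cconst|].
    apply is_derive_Cmult; [apply is_derive_Cconst|exact Hm].
Qed.

Lemma continuous_interp_poly_derivative (f : R -> C) N c a t :
  continuous f t -> continuous (fun s => interp_poly_derivative N c (f s) a) t.
Proof.
  intros Hf. induction N as [|N IH].
  - apply (continuous_ext (fun _ => RtoC 0)).
    { intros s. now rewrite interp_poly_derivative_0. }
    apply continuous_const.
  - apply (continuous_ext (fun s => interp_poly_derivative N c (f s) a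
        + c (S N) / RtoC (INR (fact (S N))) * (RtoC (INR (S N)) * (f s - a) ^ N))%C).
    { intros s. now rewrite interp_poly_derivative_S. }
    apply continuous_Cplus; [exact IH|].
    apply continuous_Cmult; [apply continuous_const|].
    apply continuous_Cmult; [apply continuous_const|].
    apply continuous_Cpow. apply continuous_Cminus; [exact Hf|apply continuous_const].
Qed.

Lemma Rpower_le_self x alpha : 0 < x <= 1 -> 0 < alpha <= 1 -> x <= Rpower x alpha.
Proof.
  intros Hx Ha. rewrite <- (exp_ln x) at 1 by lra. unfold Rpower.
  assert (ln x <= 0).
  { rewrite <- ln_1. destruct (Req_dec x 1) as [->|]; [lra|]. left. apply ln_increasing; lra. }
  destruct (Rle_lt_or_eq_dec (ln x) (alpha * ln x)) as [L|L].
  - nra.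
  - left. now apply exp_increasing.
  - right. now rewrite <- L.
Qed.

(** The centre is excluded because [Rpower 0 alpha] is [1]. *)
Definition holder_at (alpha : R) (f : R -> C) (t0 : R) : Prop :=
  exists K d, 0 < K /\ 0 < d /\ forall t, 0 < Rabs (t - t0) < d ->
    Cmod (f t - f t0) <= K * Rpower (Rabs (t - t0)) alpha.

Lemma holder_at_lipschitz alpha f t0 L d : 0 < alpha <= 1 -> 0 < L -> 0 < d ->
  (forall s, Rabs (s - t0) < d -> Cmod (f s - f t0)%C <= L * Rabs (s - t0)) -> holder_at alpha f t0.
Proof.
  intros Ha HL Hd H. exists L, (Rmin d 1). split; [exact HL|]. split; [apply Rmin_pos; lra|].
  intros t Ht. assert (A1 := Rmin_l d 1). assert (A2 := Rmin_r d 1).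
  eapply Rle_trans; [apply H; lra|]. apply Rmult_le_compat_l; [lra|].
  apply Rpower_le_self; lra.
Qed.

Lemma holder_at_minus alpha f g t0 :
  holder_at alpha f t0 -> holder_at alpha g t0 -> holder_at alpha (fun t => f t - g t)%C t0.
Proof.
  intros (K & d & HK & Hd & H) (L & e & HL & He & G).
  exists (K + L), (Rmin d e). split; [lra|]. split; [now apply Rmin_pos|].
  intros t Ht. assert (A1 := Rmin_l d e). assert (A2 := Rmin_r d e).
  replace (f t - g t - (f t0 - g t0))%C with ((f t - f t0) + - (g t - g t0))%C by ring.
  eapply Rle_trans; [apply Cmod_triangle|]. rewrite Cmod_opp.
  specialize (H t ltac:(lra)). specialize (G t ltac:(lra)). lra.
Qed.

Lemma holder_at_continuous alpha f t0 : 0 < alpha -> holder_at alpha f t0 -> continuous f t0.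
Proof.
  intros Ha (K & d & HK & Hd & H) P HP.
  apply locally_ball_Cmod in HP. destruct HP as [e [He HP]].
  destruct (Rpower_lim_0 alpha (e / K) Ha) as [d2 [Hd2 L]]; [now apply Rdiv_lt_0_compat|].
  apply locally_ball_R. exists (Rmin d d2). split; [now apply Rmin_pos|].
  intros t Ht. assert (A1 := Rmin_l d d2). assert (A2 := Rmin_r d d2).
  apply HP. destruct (Req_dec t t0) as [->|N].
  - replace (f t0 - f t0)%C with (RtoC 0) by ring. rewrite Cmod_0. exact He.
  - assert (0 < Rabs (t - t0)) by (apply Rabs_pos_lt; lra).
    eapply Rle_lt_trans; [apply H; lra|].
    specialize (L (Rabs (t - t0)) ltac:(lra)).
    replace e with (K * (e / K)) by (field; lra). apply Rmult_lt_compat_l; lra.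
Qed.

(** The derivative in the parameter is the arc-length derivative times the speed:
    the former is Hoelder with respect to the chord, which is at most a multiple
    of [|t - t0|], and the latter is Lipschitz for a [C^2] curve. *)
Lemma curve_derivative_holder gamma alpha (phi : C -> R) t0 :
  regular_C2_jordan gamma -> 0 < alpha <= 1 -> C1_holder gamma alpha phi ->
  holder_at alpha (fun t => RtoC (Derive (fun s => phi (gamma s)) t)) t0.
Proof.
  intros HJ Ha [_ [K [HK Hh]]].
  pose proof (jordan_regular_loop gamma HJ) as H.
  destruct HJ as (_ & _ & H2 & _). destruct (C2_velocity gamma H2) as [D1 D2].
  pose proof PI_RGT_0 as Hpi.
  destruct (D2 t0) as [l Hl].
  destruct (is_derive_C_lipschitz _ _ _ (D1 t0)) as (L1 & d1 & HL1 & Hd1 & E1).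
  destruct (is_derive_C_lipschitz _ _ _ Hl) as (L2 & d2 & HL2 & Hd2 & E2).
  set (v0 := Cmod (velocity gamma t0)).
  set (a0 := Rabs (arc_derive gamma phi t0)).
  assert (Hv0 : 0 < v0) by (apply Cmod_gt_0, (loop_regular _ _ H)).
  assert (Ha0 : 0 <= a0) by apply Rabs_pos.
  set (p := Rpower L1 alpha). assert (Hp : 0 < p) by apply exp_pos.
  assert (Hd : 0 < Rmin (Rmin d1 d2) 1) by (repeat apply Rmin_pos; lra).
  exists (K * p * (v0 + L2) + a0 * L2 + 1), (Rmin (Rmin d1 d2) 1). split.
  { assert (0 <= K * p * (v0 + L2)) by (repeat apply Rmult_le_pos; lra).
    assert (0 <= a0 * L2) by (apply Rmult_le_pos; lra). lra. }
  split; [exact Hd|]. intros t Ht.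
  assert (A1 := Rmin_l (Rmin d1 d2) 1). assert (A2 := Rmin_r (Rmin d1 d2) 1).
  assert (A3 := Rmin_l d1 d2). assert (A4 := Rmin_r d1 d2).
  set (x := Rabs (t - t0)) in *.
  assert (Hne : gamma t <> gamma t0).
  { intros E. assert (t = t0).
    { apply (loop_inj_near _ _ H); [exact E|]. fold x. pose proof PI2_1. unfold PI2 in *. lra. }
    unfold x in Ht. rewrite H0, Rminus_diag, Rabs_R0 in Ht. lra. }
  assert (Hg : 0 < Cmod (gamma t - gamma t0)).
  { apply Cmod_gt_0. intros E. apply Hne.
    replace (gamma t) with ((gamma t - gamma t0) + gamma t0)%C by ring. rewrite E. ring. }
  assert (B1 := E1 t). assert (B2 := E2 t). fold x in B1, B2.
  specialize (B1 ltac:(lra)). specialize (B2 ltac:(lra)).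
  assert (B3 := Hh t t0 Hne).
  assert (B4 : Rpower (Cmod (gamma t - gamma t0)) alpha <= p * Rpower x alpha).
  { unfold p. rewrite Rpower_mult_distr by lra. apply Rle_Rpower_l; lra. }
  assert (B5 : x <= Rpower x alpha) by (apply Rpower_le_self; lra).
  set (y := Rpower x alpha) in *. assert (Hy : 0 < y) by apply exp_pos.
  set (v := Cmod (velocity gamma t)).
  assert (Hv : 0 < v) by (apply Cmod_gt_0, (loop_regular _ _ H)).
  assert (B6 : Rabs (v - v0) <= L2 * x).
  { apply Rabs_le_between. split.
    - assert (Q := Cmod_sub_triangle (velocity gamma t0) (velocity gamma t)). fold v v0 in Q.
      rewrite <- Cmod_opp in Q.
      replace (- (velocity gamma t0 - velocity gamma t))%C with (velocity gamma t - velocity gamma t0)%C in Q by ring.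
      lra.
    - assert (Q := Cmod_sub_triangle (velocity gamma t) (velocity gamma t0)). fold v v0 in Q. lra. }
  assert (Ed : forall s, Derive (fun s => phi (gamma s)) s = arc_derive gamma phi s * Cmod (velocity gamma s)).
  { intros s. unfold arc_derive. field. apply Rgt_not_eq. apply Cmod_gt_0, (loop_regular _ _ H). }
  rewrite <- RtoC_minus, Cmod_R, !Ed. fold v v0.
  replace (arc_derive gamma phi t * v - arc_derive gamma phi t0 * v0)
    with ((arc_derive gamma phi t - arc_derive gamma phi t0) * v + arc_derive gamma phi t0 * (v - v0)) by ring.
  eapply Rle_trans; [apply Rabs_triang|]. rewrite !Rabs_mult, (Rabs_pos_eq v) by lra. fold a0.
  assert (B7 : Rabs (arc_derive gamma phi t - arc_derive gamma phi t0) <= K * p * y).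
  { eapply Rle_trans; [exact B3|]. rewrite Rmult_assoc. now apply Rmult_le_compat_l. }
  assert (B8 : v <= v0 + L2).
  { apply Rabs_le_between in B6. assert (L2 * x <= L2 * 1) by (apply Rmult_le_compat_l; lra). lra. }
  assert (B9 : Rabs (arc_derive gamma phi t - arc_derive gamma phi t0) * v <= K * p * y * (v0 + L2)).
  { apply Rmult_le_compat; try lra. apply Rabs_pos. }
  assert (B10 : a0 * Rabs (v - v0) <= a0 * (L2 * y)).
  { apply Rmult_le_compat_l; [lra|]. eapply Rle_trans; [exact B6|]. apply Rmult_le_compat_l; lra. }
  nra.
Qed.

Definition interp_error (gamma : R -> C) (phi : C -> R) N c (a : C) (t : R) : C :=
  (RtoC (phi (gamma t)) - interp_poly N c (gamma t) a)%C.

Definition interp_error_derivative (gamma : R -> C) (phi : C -> R) N c (a : C) (t : R) : C :=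
  (RtoC (Derive (fun s => phi (gamma s)) t)
   - interp_poly_derivative N c (gamma t) a * velocity gamma t)%C.

Lemma is_derive_interp_error gamma (phi : C -> R) N c a t :
  regular_loop gamma (velocity gamma) -> ex_derive (fun s => phi (gamma s)) t ->
  is_derive (V := CR) (interp_error gamma phi N c a) t (interp_error_derivative gamma phi N c a t).
Proof.
  intros H Hphi. apply is_derive_Cminus.
  - apply is_derive_C_pair; simpl; [|apply (is_derive_const (V := R_NormedModule))].
    now apply Derive_correct.
  - apply is_derive_interp_poly, (loop_derive _ _ H).
Qed.

Lemma interp_error_derivative_holder gamma alpha (phi : C -> R) N c a t0 :
  regular_C2_jordan gamma -> 0 < alpha <= 1 -> C1_holder gamma alpha phi ->
  holder_at alpha (interp_error_derivative gamma phi N c a) t0.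
Proof.
  intros HJ Ha Hh. apply holder_at_minus.
  - now apply curve_derivative_holder.
  - destruct HJ as (_ & _ & H2 & _). destruct (C2_velocity gamma H2) as [D1 D2].
    destruct (D2 t0) as [l Hl].
    destruct (ex_derive_interp_poly_derivative gamma N c a t0 _ (D1 t0)) as [m Hm].
    destruct (is_derive_C_lipschitz _ _ _ (is_derive_Cmult _ _ _ _ _ Hm Hl)) as (L & d & HL & Hd & E).
    now apply (holder_at_lipschitz alpha _ t0 L d).
Qed.

Lemma continuous_punctured_limit (f : R -> C) t :
  continuous f t -> filterlim f (locally' t) (locally (RtoC 0)) -> f t = RtoC 0.
Proof.
  intros Hc Hl. apply Cmod_eq_0. apply Rle_antisym; [|apply Cmod_ge_0].
  apply le_epsilon. intros e He. rewrite Rplus_0_l.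
  destruct (continuous_eps f t Hc (e / 2)) as [d [Hd H1]]; [lra|].
  assert (L : locally' t (fun s => Cmod (f s - 0)%C < e / 2)).
  { apply (Hl (fun z => Cmod (z - 0)%C < e / 2)). apply locally_ball_Cmod. exists (e / 2). split; [lra|auto]. }
  unfold locally', within in L. apply locally_ball_R in L. destruct L as [d2 [Hd2 L]].
  set (s := t + Rmin d d2 / 2).
  assert (0 < Rmin d d2) by (now apply Rmin_pos).
  assert (A1 := Rmin_l d d2). assert (A2 := Rmin_r d d2).
  assert (Hs : Rabs (s - t) = Rmin d d2 / 2).
  { unfold s. replace (t + Rmin d d2 / 2 - t) with (Rmin d d2 / 2) by ring. apply Rabs_pos_eq. lra. }
  assert (K1 := H1 s ltac:(lra)). assert (K2 := L s ltac:(lra) ltac:(unfold s; lra)).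
  replace (f t) with ((f s - 0) + - (f s - f t))%C by ring.
  eapply Rle_trans; [apply Cmod_triangle|]. rewrite Cmod_opp. lra.
Qed.

(** The conditions of order [0] and [1] are limits at the punctured point; they
    become values because the error and its derivative are continuous. *)
Lemma interpolation_conditions gamma alpha (phi : C -> R) N c t0 :
  regular_C2_jordan gamma -> (1 <= N)%nat -> 0 < alpha <= 1 -> C1_holder gamma alpha phi ->
  is_interpolant gamma (fun z => RtoC (phi z)) N t0 c ->
  interp_error gamma phi N c (gamma t0) t0 = RtoC 0 /\
  interp_error_derivative gamma phi N c (gamma t0) t0 = RtoC 0.
Proof.
  intros HJ HN Ha Hh Hi.
  pose proof (jordan_regular_loop gamma HJ) as H.
  assert (D : forall t, is_derive (V := CR) (interp_error gamma phi N c (gamma t0)) t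
                          (interp_error_derivative gamma phi N c (gamma t0) t)).
  { intros t. apply is_derive_interp_error; [exact H|]. apply Hh. }
  split; apply continuous_punctured_limit.
  - eapply is_derive_C_continuous. apply D.
  - generalize (Hi 0%nat ltac:(lia)). apply filterlim_ext. intros t.
    unfold CDerive_n, interp_error. simpl.
    symmetry. apply surjective_pairing.
  - apply (holder_at_continuous alpha); [lra|]. now apply interp_error_derivative_holder.
  - generalize (Hi 1%nat HN). apply filterlim_ext. intros t.
    unfold CDerive_n. simpl Derive_n.
    rewrite (surjective_pairing (interp_error_derivative gamma phi N c (gamma t0) t)).
    f_equal; apply is_derive_unique.
    + apply (is_derive_Re _ _ _ (D t)).
    + apply (is_derive_Im _ _ _ (D t)).
Qed.

(** The error and its derivative vanish at [t0] and the derivative is Hoelder there,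
    so the mean value inequality gains one order. *)
Lemma interp_error_bound gamma alpha (phi : C -> R) N c t0 :
  regular_C2_jordan gamma -> (1 <= N)%nat -> 0 < alpha <= 1 -> C1_holder gamma alpha phi ->
  is_interpolant gamma (fun z => RtoC (phi z)) N t0 c ->
  exists K d, 0 < K /\ 0 < d /\ forall t, 0 < Rabs (t - t0) < d ->
    Cmod (interp_error gamma phi N c (gamma t0) t)
      <= K * Rpower (Rabs (t - t0)) alpha * Rabs (t - t0).
Proof.
  intros HJ HN Ha Hh Hi.
  pose proof (jordan_regular_loop gamma HJ) as H.
  destruct (interpolation_conditions gamma alpha phi N c t0 HJ HN Ha Hh Hi) as [Z0 Z1].
  destruct (interp_error_derivative_holder gamma alpha phi N c (gamma t0) t0 HJ Ha Hh) as (K & d & HK & Hd & E).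
  exists K, d. split; [exact HK|]. split; [exact Hd|]. intros t Ht.
  replace (interp_error gamma phi N c (gamma t0) t)
    with (interp_error gamma phi N c (gamma t0) t - interp_error gamma phi N c (gamma t0) t0)%C
    by (rewrite Z0; ring).
  apply (Cmod_mean_value _ (interp_error_derivative gamma phi N c (gamma t0))).
  - intros s. apply is_derive_interp_error; [exact H|]. apply Hh.
  - intros s. apply (holder_at_continuous alpha); [lra|]. now apply interp_error_derivative_holder.
  - intros s Hs.
    assert (Hst : Rabs (s - t0) <= Rabs (t - t0)).
    { revert Hs. unfold Rmin, Rmax, Rabs.
      destruct (Rle_dec t0 t), (Rcase_abs (s - t0)), (Rcase_abs (t - t0)); lra. }
    destruct (Req_dec s t0) as [->|N0].
    + rewrite Z1, Cmod_0. apply Rmult_le_pos; [lra|left; apply exp_pos].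
    + assert (0 < Rabs (s - t0)) by (apply Rabs_pos_lt; lra).
      replace (interp_error_derivative gamma phi N c (gamma t0) s)
        with (interp_error_derivative gamma phi N c (gamma t0) s
              - interp_error_derivative gamma phi N c (gamma t0) t0)%C by (rewrite Z1; ring).
      eapply Rle_trans; [apply E; lra|]. apply Rmult_le_compat_l; [lra|].
      apply Rle_Rpower_l; lra.
Qed.

(** * The hypersingular kernel near the curve *)

Definition normal_line (gamma : R -> C) (nu : C -> C) (t0 e : R) : C :=
  (gamma t0 + RtoC e * nu (gamma t0))%C.

Definition hyper_kernel (gamma : R -> C) (phi : C -> R) N c (a w : C) (t : R) : C :=
  (interp_error gamma phi N c a t / (gamma t - w) ^ 2 * velocity gamma t)%C.

Lemma normal_line_0 gamma nu t0 : normal_line gamma nu t0 0 = gamma t0.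
Proof. unfold normal_line. ring. Qed.

Lemma normal_line_off_curve gamma nu t0 :
  regular_loop gamma (velocity gamma) ->
  (forall t, nu (gamma t) * RtoC (Cmod (velocity gamma t)) = - (Ci * velocity gamma t))%C ->
  exists d, 0 < d /\ forall e, 0 < Rabs e < d -> off_curve gamma (normal_line gamma nu t0 e).
Proof.
  intros H Hn. destruct (tube_off_curve _ _ H t0) as [d [Hd Ht]].
  set (r := Cmod (velocity gamma t0)).
  assert (Hr : 0 < r) by (apply Cmod_gt_0, (loop_regular _ _ H)).
  assert (Nr : RtoC r <> RtoC 0) by (intros E; injection E as E; lra).
  exists (d * r). split; [now apply Rmult_lt_0_compat|]. intros e He.
  assert (Hir : 0 < / r) by (now apply Rinv_0_lt_compat).
  (* [nu] is [- i g' / r], which changes the sign and the scale of the parameter. *)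
  replace (normal_line gamma nu t0 e) with (normal_point gamma (velocity gamma) t0 (- (e / r))).
  - apply Ht; [rewrite Rminus_diag, Rabs_R0; lra|].
    unfold Rdiv. rewrite Rabs_Ropp, Rabs_mult, (Rabs_pos_eq (/ r)) by lra.
    split; [apply Rmult_lt_0_compat; lra|].
    apply Rmult_lt_reg_r with r; [exact Hr|]. rewrite Rmult_assoc, Rinv_l, Rmult_1_r by lra. lra.
  - unfold normal_line, normal_point. f_equal.
    assert (E := Hn t0). fold r in E.
    rewrite RtoC_opp, RtoC_div by lra.
    replace (Ci * velocity gamma t0)%C with (- (nu (gamma t0) * RtoC r))%C by (rewrite E; ring).
    field. exact Nr.
Qed.

(** Moving off the curve along the normal does not affect the tangential
    component of the distance, which grows linearly; hence a bound independent
    of [e]. *)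
Lemma normal_line_distance gamma nu t0 :
  regular_loop gamma (velocity gamma) ->
  (forall t, nu (gamma t) * RtoC (Cmod (velocity gamma t)) = - (Ci * velocity gamma t))%C ->
  exists h k, 0 < h /\ h <= PI /\ 0 < k /\ forall t e, Rabs (t - t0) <= h ->
    k * Rabs (t - t0) <= Cmod (gamma t - normal_line gamma nu t0 e).
Proof.
  intros H Hn. destruct (tangential_growth _ _ H t0) as (h & c & Hh & Hh2 & Hc & E).
  set (r := Cmod (velocity gamma t0)).
  assert (Hr : 0 < r) by (apply Cmod_gt_0, (loop_regular _ _ H)).
  exists h, (c / r). split; [exact Hh|]. split; [exact Hh2|]. split; [now apply Rdiv_lt_0_compat|].
  intros t e Ht. specialize (E t t0 Ht). rewrite Rminus_diag, Rabs_R0 in E. specialize (E ltac:(lra)).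
  apply Rmult_le_reg_r with r; [exact Hr|].
  replace (c / r * Rabs (t - t0) * r) with (c * Rabs (t - t0)) by (field; lra).
  eapply Rle_trans; [exact E|].
  replace (Re ((gamma t - gamma t0) * Cconj (velocity gamma t0))%C)
    with (Re ((gamma t - normal_line gamma nu t0 e) * Cconj (velocity gamma t0))%C).
  - eapply Rle_trans; [apply re_le_Cmod|]. rewrite Cmod_mult, Cmod_conj. fold r. lra.
  - unfold normal_line. specialize (Hn t0). fold r in Hn.
    assert (Z : Re (nu (gamma t0) * Cconj (velocity gamma t0))%C = 0).
    { apply Rmult_eq_reg_r with r; [|lra].
      replace (Re (nu (gamma t0) * Cconj (velocity gamma t0))%C * r)
        with (Re (nu (gamma t0) * RtoC r * Cconj (velocity gamma t0))%C) by (unfold Re; simpl; ring).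
      rewrite Hn. unfold Re. destruct (velocity gamma t0). simpl. ring. }
    replace ((gamma t - (gamma t0 + RtoC e * nu (gamma t0))) * Cconj (velocity gamma t0))%C
      with ((gamma t - gamma t0) * Cconj (velocity gamma t0)
            - RtoC e * (nu (gamma t0) * Cconj (velocity gamma t0)))%C by ring.
    set (X := ((gamma t - gamma t0) * Cconj (velocity gamma t0))%C).
    set (Y := (nu (gamma t0) * Cconj (velocity gamma t0))%C) in *.
    replace (Re (X - RtoC e * Y)%C) with (Re X - e * Re Y) by (unfold Re; simpl; ring).
    rewrite Z. ring.
Qed.

Lemma Cmod_normal_line gamma nu t0 e :
  Cmod (nu (gamma t0)) = 1 -> Cmod (normal_line gamma nu t0 e - gamma t0) = Rabs e.
Proof.
  intros Hn. unfold normal_line.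
  replace (gamma t0 + RtoC e * nu (gamma t0) - gamma t0)%C with (RtoC e * nu (gamma t0))%C by ring.
  rewrite Cmod_mult, Cmod_R, Hn. ring.
Qed.

Lemma continuous_interp_error gamma (phi : C -> R) N c a t :
  regular_loop gamma (velocity gamma) -> (forall t, continuous (fun t => phi (gamma t)) t) ->
  continuous (interp_error gamma phi N c a) t.
Proof.
  intros H Hphi. apply continuous_Cminus; [now apply continuous_RtoC|].
  apply continuous_interp_poly. now apply (loop_continuous _ _ H).
Qed.

Lemma continuous_hyper_kernel gamma (phi : C -> R) N c a w t :
  regular_loop gamma (velocity gamma) -> (forall t, continuous (fun t => phi (gamma t)) t) ->
  gamma t <> w -> continuous (hyper_kernel gamma phi N c a w) t.
Proof.
  intros H Hphi Hw. apply continuous_Cmult; [|apply (loop_dcont _ _ H)].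
  apply continuous_Cmult; [now apply continuous_interp_error|].
  apply (continuous_Cinv (fun t => (gamma t - w) ^ 2)%C).
  - apply continuous_Cpow. apply continuous_Cminus; [now apply (loop_continuous _ _ H)|apply continuous_const].
  - apply Cpow_nz. intros E. apply Hw. replace (gamma t) with ((gamma t - w) + w)%C by ring. rewrite E. ring.
Qed.

Lemma hyper_kernel_periodic gamma (phi : C -> R) N c a w t :
  regular_loop gamma (velocity gamma) ->
  hyper_kernel gamma phi N c a w (t + 2 * PI) = hyper_kernel gamma phi N c a w t.
Proof.
  intros H. unfold hyper_kernel, interp_error. now rewrite (loop_period _ _ H), (loop_dperiod _ _ H).
Qed.

Lemma Cmod_hyper_kernel_le gamma (phi : C -> R) N c a w t P q M :
  0 < q -> Cmod (interp_error gamma phi N c a t) <= P -> q <= Cmod (gamma t - w) ->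
  Cmod (velocity gamma t) <= M ->
  Cmod (hyper_kernel gamma phi N c a w t) <= P * / q ^ 2 * M.
Proof.
  intros Hq HP Hw HM. unfold hyper_kernel.
  assert (Nz : (gamma t - w)%C <> RtoC 0) by (apply Cmod_gt_0; lra).
  rewrite Cmod_mult, Cmod_div, Cmod_pow by (now apply Cpow_nz).
  assert (Hq2 : 0 < q ^ 2) by (now apply pow_lt).
  assert (Hw2 : q ^ 2 <= Cmod (gamma t - w) ^ 2) by (apply pow_incr; lra).
  apply Rmult_le_compat; [|apply Cmod_ge_0| |exact HM].
  - apply Rmult_le_pos; [apply Cmod_ge_0|]. left. apply Rinv_0_lt_compat. lra.
  - apply Rmult_le_compat; [apply Cmod_ge_0| |exact HP|].
    + left. apply Rinv_0_lt_compat. lra.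
    + now apply Rinv_le_contravar.
Qed.

(** At distance [x = |t - t0|] from the singularity the numerator is of order
    [x^(1 + alpha)] and the denominator at least of order [x^2], uniformly in [e].
    By periodicity the same holds at the other end of the interval, and in between
    the kernel is bounded. *)
Lemma hyper_kernel_dominated gamma nu alpha (phi : C -> R) N c t0 :
  regular_C2_jordan gamma ->
  (forall t, nu (gamma t) * RtoC (Cmod (velocity gamma t)) = - (Ci * velocity gamma t))%C ->
  Cmod (nu (gamma t0)) = 1 ->
  (forall t, continuous (fun t => phi (gamma t)) t) ->
  (1 <= N)%nat -> 0 < alpha <= 1 -> C1_holder gamma alpha phi ->
  is_interpolant gamma (fun z => RtoC (phi z)) N t0 c ->
  exists A B e0, 0 < e0 /\ forall e t, Rabs e < e0 -> t0 < t < t0 + 2 * PI ->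
    Cmod (hyper_kernel gamma phi N c (gamma t0) (normal_line gamma nu t0 e) t)
      <= A * (Rpower (t - t0) (alpha - 1) + Rpower (t0 + 2 * PI - t) (alpha - 1)) + B.
Proof.
  intros HJ Hn Hn1 Hphi HN Ha Hh Hi. pose proof PI_RGT_0 as Hpi.
  pose proof (jordan_regular_loop gamma HJ) as H.
  destruct (interp_error_bound gamma alpha phi N c t0 HJ HN Ha Hh Hi) as (K & d & HK & Hd & E).
  destruct (normal_line_distance gamma nu t0 H Hn) as (h & k & Hh1 & Hh2 & Hk & F).
  destruct (Cmod_bounded (velocity gamma) (t0 - 2 * PI) (t0 + 2 * PI)) as [M [HM HMb]].
  { intros t _. apply (loop_dcont _ _ H). }
  destruct (Cmod_bounded (interp_error gamma phi N c (gamma t0)) t0 (t0 + 2 * PI)) as [P [HP HPb]].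
  { intros t _. now apply continuous_interp_error. }
  set (n := Rmin h (d / 2)).
  assert (Hn0 : 0 < n) by (apply Rmin_pos; lra).
  assert (A1 : n <= h) by apply Rmin_l. assert (A2 : n <= d / 2) by apply Rmin_r.
  destruct (loop_separated _ _ H t0 n) as [m [Hm Hs]]; [lra|].
  set (A := K * / k ^ 2 * M). set (B := P * / (m / 2) ^ 2 * M).
  assert (Hk2 : 0 < k ^ 2) by (now apply pow_lt).
  assert (HA : 0 < A).
  { apply Rmult_lt_0_compat; [|exact HM]. apply Rmult_lt_0_compat; [exact HK|now apply Rinv_0_lt_compat]. }
  assert (HB : 0 < B).
  { apply Rmult_lt_0_compat; [|exact HM]. apply Rmult_lt_0_compat; [exact HP|].
    apply Rinv_0_lt_compat, pow_lt. lra. }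
  assert (Near : forall e t, 0 < Rabs (t - t0) <= n ->
            Cmod (hyper_kernel gamma phi N c (gamma t0) (normal_line gamma nu t0 e) t)
              <= A * Rpower (Rabs (t - t0)) (alpha - 1)).
  { intros e t Ht. set (x := Rabs (t - t0)) in *.
    assert (Q := Cmod_hyper_kernel_le gamma phi N c (gamma t0) (normal_line gamma nu t0 e) t
                   (K * Rpower x alpha * x) (k * x) M).
    eapply Rle_trans; [apply Q|].
    - apply Rmult_lt_0_compat; lra.
    - unfold x in *. apply E. lra.
    - unfold x in *. apply F. lra.
    - apply HMb. assert (x <= PI) by lra. unfold x in H0. apply Rabs_le_between in H0. lra.
    - right. unfold A. replace (alpha - 1) with (alpha + - (1)) by ring.
      rewrite Rpower_plus, Rpower_Ropp, Rpower_1 by lra. field. lra. }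
  exists A, B, (m / 2). split; [lra|]. intros e t He Ht.
  pose proof (exp_pos ((alpha - 1) * ln (t - t0))) as P1.
  pose proof (exp_pos ((alpha - 1) * ln (t0 + 2 * PI - t))) as P2.
  fold (Rpower (t - t0) (alpha - 1)) in P1. fold (Rpower (t0 + 2 * PI - t) (alpha - 1)) in P2.
  assert (Q1 := Rmult_lt_0_compat _ _ HA P1). assert (Q2 := Rmult_lt_0_compat _ _ HA P2).
  rewrite Rmult_plus_distr_l.
  destruct (Rle_or_lt t (t0 + n)) as [L1|L1].
  - assert (Ht1 : Rabs (t - t0) = t - t0) by (apply Rabs_pos_eq; lra).
    assert (Q := Near e t ltac:(lra)). rewrite Ht1 in Q. lra.
  - destruct (Rle_or_lt (t0 + 2 * PI - n) t) as [L2|L2].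
    + assert (Ht1 : Rabs (t - 2 * PI - t0) = t0 + 2 * PI - t).
      { rewrite Rabs_left by lra. ring. }
      assert (Q := Near e (t - 2 * PI) ltac:(lra)). rewrite Ht1 in Q.
      rewrite <- (hyper_kernel_periodic _ _ _ _ _ _ _ H) in Q.
      replace (t - 2 * PI + 2 * PI) with t in Q by ring. lra.
    + assert (Q := Cmod_hyper_kernel_le gamma phi N c (gamma t0) (normal_line gamma nu t0 e) t P (m / 2) M).
      fold B in Q. assert (Q' : Cmod (hyper_kernel gamma phi N c (gamma t0) (normal_line gamma nu t0 e) t) <= B).
      { apply Q; [lra|apply HPb; lra| |apply HMb; lra].
        replace (gamma t - normal_line gamma nu t0 e)%C
          with ((gamma t - gamma t0) - (normal_line gamma nu t0 e - gamma t0))%C by ring.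
        eapply Rle_trans; [|apply Cmod_sub_triangle]. rewrite Cmod_normal_line by exact Hn1.
        specialize (Hs t ltac:(lra)). lra. }
      lra.
Qed.

Lemma hyper_kernel_uniform gamma nu (phi : C -> R) N c t0 x y k :
  regular_loop gamma (velocity gamma) -> Cmod (nu (gamma t0)) = 1 ->
  (forall t, continuous (fun t => phi (gamma t)) t) ->
  t0 < x -> x <= y -> y < t0 + 2 * PI -> 0 < k ->
  exists d, 0 < d /\ forall e, 0 < Rabs e < d -> forall t, x <= t <= y ->
    Cmod (hyper_kernel gamma phi N c (gamma t0) (normal_line gamma nu t0 e) t
          - hyper_kernel gamma phi N c (gamma t0) (gamma t0) t) <= k.
Proof.
  intros H Hn1 Hphi Hx Hxy Hy Hk.
  assert (Hg : forall t, continuous (fun t => gamma t - gamma t0)%C t).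
  { intros t. apply continuous_Cminus; [now apply (loop_continuous _ _ H)|apply continuous_const]. }
  destruct (Cmod_bounded_below (fun t => gamma t - gamma t0)%C x y Hxy) as [m [Hm Hmb]]; [auto| |].
  { intros t Ht E. assert (t = t0); [|lra]. apply (loop_inj_near _ _ H).
    - replace (gamma t) with ((gamma t - gamma t0) + gamma t0)%C by ring. rewrite E. ring.
    - rewrite Rabs_pos_eq; lra. }
  destruct (Cmod_bounded (fun t => gamma t - gamma t0)%C x y) as [G [HG HGb]]; [auto|].
  destruct (Cmod_bounded (velocity gamma) x y) as [M [HM HMb]].
  { intros t _. apply (loop_dcont _ _ H). }
  destruct (Cmod_bounded (interp_error gamma phi N c (gamma t0)) x y) as [P [HP HPb]].
  { intros t _. now apply continuous_interp_error. }
  set (Q := P * M * (2 * G + 1) * / ((m / 2) ^ 2 * m ^ 2)).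
  assert (Hden : 0 < (m / 2) ^ 2 * m ^ 2) by (apply Rmult_lt_0_compat; apply pow_lt; lra).
  assert (HQ : 0 < Q).
  { repeat apply Rmult_lt_0_compat; try lra. now apply Rinv_0_lt_compat. }
  exists (Rmin (Rmin (m / 2) 1) (k / Q)). split.
  { repeat apply Rmin_pos; try lra. now apply Rdiv_lt_0_compat. }
  intros e He t Ht.
  assert (A1 := Rmin_l (Rmin (m / 2) 1) (k / Q)). assert (A2 := Rmin_r (Rmin (m / 2) 1) (k / Q)).
  assert (A3 := Rmin_l (m / 2) 1). assert (A4 := Rmin_r (m / 2) 1).
  set (w := (gamma t - gamma t0)%C). set (dl := (normal_line gamma nu t0 e - gamma t0)%C).
  assert (Hdl : Cmod dl = Rabs e) by now apply Cmod_normal_line.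
  assert (Hw1 : m <= Cmod w) by now apply Hmb.
  assert (Hw2 : Cmod w <= G) by now apply HGb.
  assert (Hwd : m / 2 <= Cmod (w - dl)).
  { eapply Rle_trans; [|apply Cmod_sub_triangle]. lra. }
  assert (N1 : w <> RtoC 0) by (apply Cmod_gt_0; lra).
  assert (N2 : (w - dl)%C <> RtoC 0) by (apply Cmod_gt_0; lra).
  unfold hyper_kernel.
  replace (gamma t - normal_line gamma nu t0 e)%C with (w - dl)%C by (unfold w, dl; ring). fold w.
  set (p := interp_error gamma phi N c (gamma t0) t). set (v := velocity gamma t).
  replace (p / (w - dl) ^ 2 * v - p / w ^ 2 * v)%C
    with (p * v * (dl * (2 * w - dl)) * / ((w - dl) ^ 2 * w ^ 2))%C by (field; now split).
  assert (N3 : ((w - dl) ^ 2 * w ^ 2 <> 0)%C) by (apply Cmult_neq_0; now apply Cpow_nz).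
  rewrite !Cmod_mult, Cmod_inv by exact N3. rewrite Cmod_mult, !Cmod_pow, Hdl.
  assert (B1 : Cmod (2 * w - dl) <= 2 * G + 1).
  { unfold Cminus. eapply Rle_trans; [apply Cmod_triangle|].
    rewrite Cmod_opp, Cmod_mult, Cmod_R, Rabs_pos_eq by lra. lra. }
  assert (B2 : / (Cmod (w - dl) ^ 2 * Cmod w ^ 2) <= / ((m / 2) ^ 2 * m ^ 2)).
  { apply Rinv_le_contravar; [exact Hden|].
    apply Rmult_le_compat; try apply pow2_ge_0; apply pow_incr; lra. }
  assert (B3 : Cmod p * Cmod v <= P * M).
  { apply Rmult_le_compat; try apply Cmod_ge_0; [now apply HPb|now apply HMb]. }
  assert (HeQ : Rabs e * Q <= k).
  { replace k with (k / Q * Q) by (field; lra). apply Rmult_le_compat_r; lra. }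
  eapply Rle_trans; [|exact HeQ].
  replace (Rabs e * Q) with (P * M * (Rabs e * (2 * G + 1)) * / ((m / 2) ^ 2 * m ^ 2)) by (unfold Q; ring).
  assert (0 <= Cmod p * Cmod v) by (apply Rmult_le_pos; apply Cmod_ge_0).
  assert (0 <= Rabs e * Cmod (2 * w - dl)) by (apply Rmult_le_pos; [lra|apply Cmod_ge_0]).
  apply Rmult_le_compat.
  - now apply Rmult_le_pos.
  - left. apply Rinv_0_lt_compat. apply Rmult_lt_0_compat; apply pow_lt; lra.
  - apply Rmult_le_compat; auto. apply Rmult_le_compat_l; lra.
  - exact B2.
Qed.

Lemma RInt_periodic (f : R -> C) a : 0 <= a < 2 * PI ->
  (forall t, continuous f t) -> (forall t, f (t + 2 * PI) = f t) ->
  RInt (V := CRc) f a (a + 2 * PI) = RInt (V := CRc) f 0 (2 * PI).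
Proof.
  intros Ha Hc Hp.
  rewrite <- (RInt_C_Chasles f 0 a (2 * PI)); try lra; [|auto].
  rewrite <- (RInt_C_Chasles f a (2 * PI) (a + 2 * PI)); try lra; [|auto].
  rewrite Cplus_comm. f_equal.
  assert (E := RInt_comp_lin (V := CRc) f 1 (2 * PI) 0 a).
  replace (1 * 0 + 2 * PI) with (2 * PI) in E by ring. replace (1 * a + 2 * PI) with (a + 2 * PI) in E by ring.
  rewrite <- E; [|apply ex_RInt_C; [lra|auto]].
  apply (RInt_ext (V := CRc)). intros t _. rewrite Rmult_1_l, Hp. apply (scal_one (V := CRc)).
Qed.

(** * The hypersingular operator *)

(** The first interpolation condition says that [P' g'] is the derivative of [phi]
    along the curve, which is real, and [nu |g'| = - i g']. *)
Lemma interp_slope_normal gamma nu alpha (phi : C -> R) N c t0 :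
  regular_C2_jordan gamma ->
  (forall t, nu (gamma t) * RtoC (Cmod (velocity gamma t)) = - (Ci * velocity gamma t))%C ->
  (1 <= N)%nat -> 0 < alpha <= 1 -> C1_holder gamma alpha phi ->
  is_interpolant gamma (fun z => RtoC (phi z)) N t0 c ->
  Re (nu (gamma t0) * interp_poly_derivative N c (gamma t0) (gamma t0))%C = 0.
Proof.
  intros HJ Hn HN Ha Hh Hi.
  pose proof (jordan_regular_loop gamma HJ) as H.
  destruct (interpolation_conditions gamma alpha phi N c t0 HJ HN Ha Hh Hi) as [_ Z].
  unfold interp_error_derivative in Z.
  set (P := interp_poly_derivative N c (gamma t0) (gamma t0)) in *.
  set (f := Derive (fun s => phi (gamma s)) t0) in *.
  set (r := Cmod (velocity gamma t0)).
  assert (Hr : 0 < r) by (apply Cmod_gt_0, (loop_regular _ _ H)).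
  apply Rmult_eq_reg_r with r; [|lra]. rewrite Rmult_0_l.
  replace (Re (nu (gamma t0) * P)%C * r) with (Re (nu (gamma t0) * RtoC r * P)%C) by (unfold Re; simpl; ring).
  unfold r. rewrite Hn.
  replace (- (Ci * velocity gamma t0) * P)%C with (Ci * ((RtoC f - P * velocity gamma t0) - RtoC f))%C by ring.
  rewrite Z. unfold Re. simpl. ring.
Qed.

(** Off the curve, the normal derivative splits into the regularized integral and
    a term with [P'] and the indicator of [Omega]; the former converges by
    domination, and the latter tends to [0] on both sides by
    [interp_slope_normal]. *)
Lemma hypersingular_interpolant Omega gamma nu alpha (phi : C -> R) N c t0 :
  regular_C2_jordan gamma -> inside gamma (velocity gamma) Omega ->
  (forall t, nu (gamma t) * RtoC (Cmod (velocity gamma t)) = - (Ci * velocity gamma t))%C ->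
  Cmod (nu (gamma t0)) = 1 ->
  (forall t, continuous (fun t => phi (gamma t)) t) ->
  (1 <= N)%nat -> 0 < alpha <= 1 -> C1_holder gamma alpha phi -> 0 <= t0 < 2 * PI ->
  is_interpolant gamma (fun z => RtoC (phi z)) N t0 c ->
  exists I : C,
    is_RInt_gen (V := CR) (hyper_kernel gamma phi N c (gamma t0) (gamma t0))
      (at_right t0) (at_left (t0 + 2 * PI)) I /\
    is_hypersingular gamma nu phi (gamma t0)
      (- Re (nu (gamma t0) / (RtoC (2 * PI) * Ci) * I)%C).
Proof.
  intros HJ HO Hn Hn1 Hphi HN Ha Hh Ht0 Hi. pose proof PI_RGT_0 as Hpi.
  pose proof (jordan_regular_loop gamma HJ) as H.
  destruct (hyper_kernel_dominated gamma nu alpha phi N c t0 HJ Hn Hn1 Hphi HN Ha Hh Hi)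
    as (A & B & e0 & He0 & Dom).
  set (ker := hyper_kernel gamma phi N c (gamma t0)) in *.
  set (L := normal_line gamma nu t0) in *.
  assert (L0 : L 0 = gamma t0) by apply normal_line_0.
  assert (Hab : t0 < t0 + 2 * PI) by lra.
  assert (DP := dominating_power t0 (t0 + 2 * PI) A B alpha Hab (proj1 Ha)).
  set (h := fun t => A * (Rpower (t - t0) (alpha - 1) + Rpower (t0 + 2 * PI - t) (alpha - 1)) + B) in *.
  assert (Kc : forall t, t0 < t < t0 + 2 * PI -> continuous (ker (gamma t0)) t).
  { intros t Ht. apply continuous_hyper_kernel; auto. intros E.
    assert (t = t0); [|lra]. apply (loop_inj_near _ _ H); [exact E|]. rewrite Rabs_pos_eq; lra. }
  assert (Kd : forall t, t0 < t < t0 + 2 * PI -> Cmod (ker (gamma t0) t) <= h t).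
  { intros t Ht. rewrite <- L0. apply Dom; [rewrite Rabs_R0; lra|exact Ht]. }
  destruct (improper_dominated _ _ _ _ _ _ (ker (gamma t0)) Hab DP Kc Kd) as [I [HI1 HI2]].
  destruct (normal_line_off_curve gamma nu t0 H Hn) as [d1 [Hd1 Off]].
  exists I. split; [exact HI1|].
  assert (Conv : forall k, 0 < k -> exists d, 0 < d /\ forall e, 0 < Rabs e < d ->
             Cmod (RInt (V := CRc) (ker (L e)) t0 (t0 + 2 * PI) - I) < k).
  { apply (dominated_convergence _ _ _ _ _ _ (fun e => ker (L e)) (ker (gamma t0)) (Rmin e0 d1) I Hab DP); auto.
    - now apply Rmin_pos.
    - intros e He t _. assert (Q := Rmin_r e0 d1). apply continuous_hyper_kernel; auto.
      apply (Off e). lra.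
    - intros e He t Ht. assert (Q := Rmin_l e0 d1). apply Dom; [lra|exact Ht].
    - intros x y k Hx Hxy Hy Hk. now apply hyper_kernel_uniform. }
  set (q := (/ (RtoC (2 * PI) * Ci))%C).
  assert (NP : RtoC (2 * PI) <> RtoC 0) by (intros K; injection K as K; lra).
  assert (NI : Ci <> RtoC 0) by (intros K; injection K as K; lra).
  assert (Hq : Cmod q <= 1).
  { unfold q. rewrite Cmod_inv, Cmod_mult, Cmod_Ci, Cmod_R, Rabs_pos_eq by (try lra; now apply Cmult_neq_0).
    rewrite <- Rinv_1. apply Rinv_le_contravar; [lra|]. pose proof PI2_1. unfold PI2 in *. lra. }
  assert (Grad : forall e, 0 < Rabs e < d1 ->
     dot (nu (gamma t0)) (gradient (double_layer gamma nu phi) (L e))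
     = - Re (nu (gamma t0) * q * RInt (V := CRc) (ker (L e)) t0 (t0 + 2 * PI))%C
       - Re (nu (gamma t0) * indicator Omega (L e) * interp_poly_derivative N c (L e) (gamma t0))%C).
  { intros e He. assert (Oe := Off e He). fold (L e) in Oe.
    destruct (double_layer_differentiable gamma nu phi (L e) H Hn Hphi Oe) as [_ ->].
    fold q.
    assert (Hf : forall t, continuous (fun t => RtoC (phi (gamma t)) * velocity gamma t)%C t).
    { intros t. apply continuous_Cmult; [now apply continuous_RtoC|apply (loop_dcont _ _ H)]. }
    assert (J := is_RInt_Cminus _ _ _ _ _ _ (is_RInt_cauchy_derivative _ _ _ (L e) H Hf Oe)
                   (is_RInt_cauchy_derivative_interp _ _ N c (gamma t0) (L e) H Oe)).
    rewrite (winding_number _ _ Omega (L e) H HO Oe) in J.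
    rewrite RInt_periodic; [|exact Ht0| |].
    2: { intros t. apply continuous_hyper_kernel; auto. }
    2: { intros t. apply hyper_kernel_periodic, H. }
    set (X := cauchy_derivative gamma _ (L e)) in *.
    set (P := interp_poly_derivative N c (L e) (gamma t0)) in *.
    assert (E : RInt (V := CRc) (ker (L e)) 0 (2 * PI)
                = (X - P * (RtoC (2 * PI) * Ci * indicator Omega (L e)))%C).
    { apply is_RInt_C_unique. revert J. apply (is_RInt_ext (V := CR)). intros t _.
      as_C_equation.
      unfold ker, hyper_kernel, interp_error, Cdiv. ring. }
    rewrite E. set (ind := indicator Omega (L e)). set (v := nu (gamma t0)).
    assert (E2 : (v * q * (X - P * (RtoC (2 * PI) * Ci * ind)) = v * (q * X) - v * ind * P)%C).
    { unfold q. field. now split. }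
    rewrite E2. unfold dot, Re, Im. simpl. ring. }
  split.
  - unfold locally', within. apply locally_ball_R. exists d1. split; [exact Hd1|].
    intros e He Hne. rewrite Rminus_0_r in He.
    apply (double_layer_differentiable gamma nu phi (L e) H Hn Hphi).
    apply Off. split; [|exact He]. now apply Rabs_pos_lt.
  - intros P HP. apply locally_ball_R in HP. destruct HP as [k [Hk HP]].
    destruct (Conv (k / 2)) as [d2 [Hd2 C2]]; [lra|].
    assert (CP : continuous (fun e => interp_poly_derivative N c (L e) (gamma t0)) 0).
    { apply continuous_interp_poly_derivative. unfold L, normal_line.
      apply continuous_Cplus; [apply continuous_const|].
      apply continuous_Cmult; [apply continuous_RtoC, continuous_id|apply continuous_const]. }
    destruct (continuous_eps _ _ CP (k / 2)) as [d3 [Hd3 C3]]; [lra|].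
    unfold filtermap, locally', within. apply locally_ball_R.
    exists (Rmin d1 (Rmin d2 d3)). split; [repeat apply Rmin_pos; lra|].
    intros e He Hne. rewrite Rminus_0_r in He.
    assert (A1 := Rmin_l d1 (Rmin d2 d3)). assert (A2 := Rmin_r d1 (Rmin d2 d3)).
    assert (A3 := Rmin_l d2 d3). assert (A4 := Rmin_r d2 d3).
    assert (Hpos : 0 < Rabs e) by (now apply Rabs_pos_lt).
    apply HP. fold (normal_line gamma nu t0 e). fold L. rewrite Grad by lra.
    assert (K2 := C2 e ltac:(lra)). assert (K3 := C3 e). rewrite Rminus_0_r in K3.
    specialize (K3 ltac:(lra)). rewrite L0 in K3.
    set (J := RInt (V := CRc) (ker (L e)) t0 (t0 + 2 * PI)) in *.
    set (v := nu (gamma t0)) in *.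
    assert (Sl : Re (v * interp_poly_derivative N c (gamma t0) (gamma t0))%C = 0)
      by (now apply (interp_slope_normal gamma nu alpha phi)).
    set (Pe := interp_poly_derivative N c (L e) (gamma t0)) in *.
    set (P0 := interp_poly_derivative N c (gamma t0) (gamma t0)) in *.
    assert (T1 : Rabs (Re (v * q * (J - I))%C) < k / 2).
    { eapply Rle_lt_trans; [apply re_le_Cmod|]. rewrite !Cmod_mult, Hn1, Rmult_1_l.
      pose proof (Cmod_ge_0 (J - I)). nra. }
    assert (T2 : Rabs (Re (v * indicator Omega (L e) * Pe)%C) < k / 2).
    { unfold indicator. destruct (excluded_middle_informative (Omega (L e))).
      - replace (Re (v * 1 * Pe)%C) with (Re (v * (Pe - P0))%C + Re (v * P0)%C) by (unfold Re; simpl; ring).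
        rewrite Sl, Rplus_0_r. eapply Rle_lt_trans; [apply re_le_Cmod|].
        rewrite Cmod_mult, Hn1, Rmult_1_l. exact K3.
      - replace (Re (v * 0 * Pe)%C) with 0 by (unfold Re; simpl; ring). rewrite Rabs_R0. lra. }
    replace (- Re (v * q * J)%C - Re (v * indicator Omega (L e) * Pe)%C - - Re (v / (RtoC (2 * PI) * Ci) * I)%C)
      with (- Re (v * q * (J - I))%C - Re (v * indicator Omega (L e) * Pe)%C).
    + apply Rabs_def2 in T1, T2. apply Rabs_def1; lra.
    + unfold Cdiv. fold q. unfold Re. simpl. ring.
Qed.

Theorem theorem3p2
  (Omega : C -> Prop) (gamma : R -> C) (nu : C -> C) (phi : C -> R)
  (hOmega : bounded_simply_connected_domain Omega)
  (hgamma : regular_C2_jordan gamma)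
  (hboundary : forall z, boundary Omega z <-> curve gamma z)
  (hccw : counterclockwise Omega gamma)
  (hnu : exterior_unit_normal Omega gamma nu)
  (hphi : continuous_on_curve gamma phi) :
  (forall (N : nat) (t0 : R) (c : nat -> C),
      0 <= t0 < 2 * PI ->
      CCn_at N gamma t0 ->
      Cn_at N (fun t => phi (gamma t)) t0 ->
      is_interpolant gamma (fun z => RtoC (phi z)) N t0 c ->
      forall z : C, ~ curve gamma z ->
        double_layer gamma nu phi z =
        - Re (/ (RtoC (2 * PI) * Ci) *
                contour_integral gamma
                  (fun zeta => (RtoC (phi zeta) - interp_poly N c zeta (gamma t0))
                               / (zeta - z))
              + indicator Omega z * interp_poly N c z (gamma t0))%C)
  /\
  (forall (N : nat) (alpha : R),
      (1 <= N)%nat ->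
      (forall t, CCn_at N gamma t) ->
      (forall t, Cn_at N (fun s => phi (gamma s)) t) ->
      0 < alpha <= 1 ->
      C1_holder gamma alpha phi ->
      forall (t0 : R) (c : nat -> C),
        0 <= t0 < 2 * PI ->
        is_interpolant gamma (fun z => RtoC (phi z)) N t0 c ->
        exists I : C,
          is_singular_contour_integral gamma t0
            (fun zeta => (RtoC (phi zeta) - interp_poly N c zeta (gamma t0))
                         / Cpow (zeta - gamma t0) 2)%C I /\
          is_hypersingular gamma nu phi (gamma t0)
            (- Re (nu (gamma t0) / (RtoC (2 * PI) * Ci) * I)%C)).
Proof.
  pose proof (jordan_regular_loop gamma hgamma) as H.
  destruct hOmega as (_ & _ & Hb & _).
  pose proof (exterior_normal_eq Omega gamma nu (loop_regular _ _ H) hccw hnu) as Hn.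
  pose proof (inside_of_hypotheses Omega gamma nu H Hb hboundary hccw hnu) as HO.
  pose proof (continuous_along_curve gamma phi H hphi) as Hphi.
  split.
  - intros N t0 c _ _ _ _ z Hz. apply double_layer_interpolant; auto.
    now apply (off_curve_iff _ _ H).
  - intros N alpha HN _ _ Ha Hh t0 c Ht0 Hi.
    apply (hypersingular_interpolant Omega gamma nu alpha phi N c t0); auto.
    apply hnu.
Qed.
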